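(* Let $\mathcal X$ be a Banach space and $A:\mathcal X\to\mathcal X$ a bounded linear operator of positive type that is one-to-one and has unbounded inverse. Let $p\ge0$, let $\nu\ge1$ be an integer, let $0<\delta_0<1$, and fix $\lambda>\log\|A\|$. Then there is a finite constant $c>0$, independent of $u$, $v$ and $w$ below, such that the following holds. If $u\in\mathcal X$ is representable in the form $u=A^pv$ with $v\in\mathcal D((\log A)^\nu)$, and if $\|Au\|\le\delta_0$, then $$\|u\|\le c\,d_w\,\|Au\|^{\frac p{p+1}}\Bigl(\log\frac1{\|Au\|}\Bigr)^{-\frac{\nu}{p+1}},$$ where $w=(\lambda I-\log A)^\nu v$ and $d_w=\max\{\|w\|,1\}$.
   Context: Positive type: a bounded linear operator $A:\mathcal X\to\mathcal X$ is of positive type if for every $\alpha>0$ the operator $A+\alpha I:\mathcal X\to\mathcal X$ is one-to-one and onto, and $\|(A+\alpha I)^{-1}\|\le\kappa_*/\alpha$ for all $\alpha>0$, with a finite constant $\kappa_*>0$. $\mathcal R(A)$ denotes the range of $A$, which need not be dense in $\mathcal X$. Fractional powers: for $0<p<1$, $A^p u=\frac{\sin\pi p}{\pi}\int_0^\infty s^{p-1}(A+sI)^{-1}Au\,ds$ for $u\in\mathcal X$ (improper Bochner integral); for arbitrary $p>0$, $A^p=A^{p-\lfloor p\rfloor}A^{\lfloor p\rfloor}$, with $A^0=I$. The operators $A^p$, $p\ge0$, form a $C_0$-semigroup on $\overline{\mathcal R(A)}$. Logarithm: $\log A$ is the infinitesimal generator of the $C_0$-semigroup $(A^p)_{p\ge0}$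 on $\overline{\mathcal R(A)}$, i.e. $(\log A)u=\lim_{p\downarrow0}\frac1p(A^pu-u)$, with $\mathcal D(\log A)=\{u\in\mathcal X:\lim_{p\downarrow0}\frac1p(A^pu-u)\text{ exists}\}\subset\overline{\mathcal R(A)}$. $(\log A)^\nu$ is its $\nu$-fold composition with the natural domain $\mathcal D((\log A)^\nu)$. For real $x>0$, $\log x$ is the natural logarithm. Convention: for $Au=0$ the right-hand side of the inequality is read as $0$ (its limit as $\|Au\|\downarrow0$). *)

(* Defs.v *)
From Stdlib Require Export Reals FinFun.
From Coquelicot Require Export Coquelicot.

Open Scope R_scope.

(* Banach spaces are taken over the reals: the resolvents, fractional powers and
   logarithm below involve real parameters only, so a complex Banach space is
   covered by restriction of scalars. *)

Section Operators.

Context {X : CompleteNormedModule R_AbsRing}.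
Implicit Types (A B : X -> X) (u v y l : X).

(* Takes the value [p_infty] when [B] is unbounded on the unit ball. *)
Definition op_norm B : Rbar :=
  Lub_Rbar (fun r => exists u, norm u <= 1 /\ r = norm (B u)).

(* The preimage of [y] under [B]; meaningful for injective [B] and [y] in the
   range of [B]. *)
Definition op_inv B : X -> X := fun y => iota (fun u => B u = y).

Definition shift A (s : R) : X -> X := fun u => plus (A u) (scal s u).

Definition positive_type A : Prop :=
  exists kappa : R, 0 < kappa /\
    forall alpha : R, 0 < alpha ->
      Injective (shift A alpha) /\ Surjective (shift A alpha) /\
      Rbar_le (op_norm (op_inv (shift A alpha))) (Finite (kappa / alpha)).

Definition unbounded_inverse A : Prop :=
  ~ exists M : R, forall y, (exists u, A u = y) ->
      norm (op_inv A y) <= M * norm y.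

(* For 0 < q < 1. The integrand is norm continuous on (0, oo), so its Bochner and
   Riemann integrals over compact subintervals agree. *)
Definition frac_integral A (q : R) u : X :=
  scal (sin (PI * q) / PI)
    (RInt_gen (fun s => scal (Rpower s (q - 1)) (op_inv (shift A s) (A u)))
       (at_right 0) (Rbar_locally p_infty)).

(* [Int_part p] is the floor of [p] and [frac_part p] is [p - Int_part p]. *)
Definition op_pow A (p : R) u : X :=
  let y := Nat.iter (Z.to_nat (Int_part p)) A u in
  if Req_EM_T (frac_part p) 0 then y else frac_integral A (frac_part p) y.

Definition is_op_log A u l : Prop :=
  filterlim (fun p : R => scal (/ p) (minus (op_pow A p u) u))
    (at_right 0) (locally l).

Definition dom_log A u : Prop := exists l, is_op_log A u l.

(* Meaningful on [dom_log A]. *)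
Definition op_log A u : X := iota (is_op_log A u).

Fixpoint dom_log_pow A (n : nat) u : Prop :=
  match n with
  | O => True
  | S m => dom_log A u /\ dom_log_pow A m (op_log A u)
  end.

Definition shifted_log_pow A (lambda : R) (n : nat) : X -> X :=
  Nat.iter n (fun u => minus (scal lambda u) (op_log A u)).

End Operators.

(* [t^(p/(p+1)) * (log (1/t))^(-nu/(p+1))] for 0 < t < 1, extended by its limit 0
   at t = 0 (where [Rpower] and [ln] carry junk values). *)
Definition log_rate (p : R) (nu : nat) (t : R) : R :=
  if Req_EM_T t 0 then 0
  else Rpower t (p / (p + 1)) * Rpower (ln (1 / t)) (- (INR nu / (p + 1))).

(* Main.v *)
(** Let [R_s = (A + s)^-1] and [S_a = (a R_a)^m], with an integer [m >= p + nu]. Then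
    [u = S_a u + (I - S_a) u] where [|(I - S_a) u| <= C |A u| / a], and it remains to show
    [|S_a A^p v| <= C a^p (log (1/a))^-nu |w|] and to balance the two terms in [a]. The bound
    [|S_a A^q| <= C a^q] for [q <= m] is read off the integral for [A^q]. The logarithmic factor comes
    from [v = exp (- lambda T) A^T v + int_0^T exp (- lambda t) A^t (lambda - log A) v dt]: applying
    [S_a A^p] turns the integrand into [a^(p+t)], and [int_0^T a^t dt <= 1 / log (1/a)]. Only a
    telescoping form of this identity is used, which needs nothing but [A^(p+q) = A^p A^q].

    For that law, put [A_t = (1 - t) I + t A]. The operators
    [int_0^oo s^(q-1) (A_t + s)^-1 A_t ds] solve [y' = q (A - I) A_t^-1 y] on [[0, 1[], so products
    are identified by uniqueness for this equation, and [t -> 1] gives the law for [A], with the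
    normalisation [beta q = int_0^oo s^(q-1) / (1 + s) ds] in place of [PI / sin (PI q)]. The same
    equation for the quarter turn of the plane gives [beta (q/2) = 2 cos (PI q / 2) beta q]; hence
    [beta q * sin (PI q)] is invariant under [q -> q/2], and it tends to [PI] as [q -> 0]. *)

Require Import Defs.
From Stdlib Require Import Reals FinFun Lra Lia List.
From Coquelicot Require Import Coquelicot.
Open Scope R_scope.

(** * Linear identities in modules *)

(** The obstacle is the law [A^(p+q) = A^p A^q]. Multiplying two improper integrals would require
    exchanging the order of integration; an equation in the parameter [t] needs only single
    integrals. For [t < 1] the summand [1 - t] acts as a positive shift, so [A_t] is boundedly
    invertible and the equation has a bounded generator. At [t = 1] this bound is lost, [A^-1] being
    unbounded, so each law is proved for [t < 1] and carried over by an explicit rate, a power of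
    [1 - t]. The equation is used through its one-step Euler error [O(h^2)], a property stable under
    composition that turns Gronwall's inequality into a finite induction.

    The exact normalisation has a second use: [/ beta_int q * (/ q + / (1 - q)) <= 2] bounds [A^p]
    uniformly for [p] in a bounded interval, although the unnormalised integrals blow up at both
    ends of []0, 1[]. The argument for the logarithm subdivides such an interval arbitrarily finely
    and needs this uniformity. The condition [lambda > log |A|] makes [(|A| exp (- lambda))^n]
    small, which gives [|v| <= C |w|] and so controls the boundary terms. *)

Inductive lin_expr : Type :=
| LZero | LAtom (i : nat) | LPlus (a b : lin_expr) | LOpp (a : lin_expr)
| LMinus (a b : lin_expr) | LScal (r : R) (a : lin_expr).

Section LinearReflection.

Context {V : ModuleSpace R_Ring}.

Fixpoint lin_eval (env : list V) (e : lin_expr) : V :=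
  match e with
  | LZero => zero
  | LAtom i => nth i env zero
  | LPlus a b => plus (lin_eval env a) (lin_eval env b)
  | LOpp a => opp (lin_eval env a)
  | LMinus a b => minus (lin_eval env a) (lin_eval env b)
  | LScal r a => scal (r : R_Ring) (lin_eval env a)
  end.

(** Coefficients stay arbitrary real terms rather than normal forms, so the remaining equations can
    be closed by [ring] or, when divisions occur, by [field]. *)
Fixpoint lin_coef (e : lin_expr) (i : nat) : R :=
  match e with
  | LZero => 0
  | LAtom j => if Nat.eqb i j then 1 else 0
  | LPlus a b => lin_coef a i + lin_coef b i
  | LOpp a => - lin_coef a i
  | LMinus a b => lin_coef a i - lin_coef b i
  | LScal r a => r * lin_coef a i
  end.

Fixpoint lin_comb (env : list V) (k : nat) (c : nat -> R) : V :=
  match env with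
  | nil => zero
  | x :: t => plus (scal (c k : R_Ring) x) (lin_comb t (S k) c)
  end.

Lemma lin_comb_plus env k c d :
  lin_comb env k (fun i => c i + d i) = plus (lin_comb env k c) (lin_comb env k d).
Proof.
revert k; induction env as [|x t IH]; intros k; simpl.
- now rewrite plus_zero_l.
- rewrite IH. change (c k + d k) with (plus (c k : R_Ring) (d k)).
  rewrite scal_distr_r, <- !plus_assoc. f_equal.
  rewrite !plus_assoc. f_equal. apply plus_comm.
Qed.

Lemma lin_comb_scal env k c r :
  lin_comb env k (fun i => r * c i) = scal (r : R_Ring) (lin_comb env k c).
Proof.
revert k; induction env as [|x t IH]; intros k; simpl.
- now rewrite scal_zero_r.
- rewrite IH, scal_distr_l, scal_assoc. reflexivity.
Qed.

Lemma lin_comb_ext env k c d :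
  (forall i, c i = d i) -> lin_comb env k c = lin_comb env k d.
Proof.
intros H; revert k; induction env as [|x t IH]; intros k; simpl; trivial.
now rewrite IH, H.
Qed.

Lemma lin_comb_0 env k : lin_comb env k (fun _ => 0) = zero.
Proof.
revert k; induction env as [|x t IH]; intros k; simpl; trivial.
rewrite IH, plus_zero_r. apply (scal_zero_l x).
Qed.

Lemma lin_comb_atom env k j :
  lin_comb env k (fun i => if Nat.eqb i (k + j) then 1 else 0) = nth j env zero.
Proof.
revert k j; induction env as [|x t IH]; intros k [|j]; simpl; trivial.
- rewrite Nat.add_0_r, Nat.eqb_refl.
  replace (scal (1 : R_Ring) x) with x by (symmetry; apply (scal_one x)).
  assert (H : forall m, (k < m)%nat ->
    lin_comb t m (fun i => if Nat.eqb i k then 1 else 0) = zero).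
  { intros m Hm. clear IH. revert m Hm. induction t as [|y t IH]; intros m Hm; simpl; trivial.
    rewrite IH by lia. replace (Nat.eqb m k) with false by (symmetry; apply Nat.eqb_neq; lia).
    rewrite plus_zero_r. apply (scal_zero_l y). }
  rewrite H by lia. apply plus_zero_r.
- replace (Nat.eqb k (k + S j)) with false by (symmetry; apply Nat.eqb_neq; lia).
  rewrite (scal_zero_l x : scal (0 : R_Ring) x = zero), plus_zero_l.
  rewrite <- (IH (S k) j). apply lin_comb_ext. intros i.
  now replace (k + S j)%nat with (S k + j)%nat by lia.
Qed.

Lemma lin_eval_comb env e : lin_eval env e = lin_comb env 0 (lin_coef e).
Proof.
induction e as [|j|a IHa b IHb|a IHa|a IHa b IHb|r a IHa]; simpl.
- symmetry; apply lin_comb_0.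
- symmetry; apply (lin_comb_atom env 0 j).
- now rewrite IHa, IHb, lin_comb_plus.
- rewrite IHa. rewrite <- scal_opp_one.
  rewrite <- (lin_comb_scal env 0 (lin_coef a) (opp (one : R_Ring))).
  apply lin_comb_ext. intros i. unfold opp, one; simpl. ring.
- unfold minus. rewrite IHa, IHb, <- scal_opp_one.
  rewrite <- (lin_comb_scal env 0 (lin_coef b) (opp (one : R_Ring))), <- lin_comb_plus.
  apply lin_comb_ext. intros i. unfold opp, one; simpl. ring.
- now rewrite IHa, lin_comb_scal.
Qed.

Fixpoint lin_coefs_eq (env : list V) (k : nat) (c d : nat -> R) : Prop :=
  match env with
  | nil => True
  | _ :: t => c k = d k /\ lin_coefs_eq t (S k) c d
  end.

Lemma lin_eval_eq env e1 e2 :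
  lin_coefs_eq env 0 (lin_coef e1) (lin_coef e2) ->
  lin_eval env e1 = lin_eval env e2.
Proof.
rewrite !lin_eval_comb. generalize (lin_coef e1) (lin_coef e2) 0%nat.
induction env as [|x t IH]; intros c d k; simpl; trivial.
intros [H1 H2]. now rewrite H1, (IH _ _ _ H2).
Qed.

End LinearReflection.

Ltac lin_mem x l :=
  lazymatch l with
  | nil => false
  | x :: _ => true
  | _ :: ?t => lin_mem x t
  end.

Ltac lin_atoms e l :=
  lazymatch e with
  | zero => l
  | plus ?a ?b => let l1 := lin_atoms a l in lin_atoms b l1
  | minus ?a ?b => let l1 := lin_atoms a l in lin_atoms b l1
  | opp ?a => lin_atoms a l
  | scal _ ?a => lin_atoms a l
  | _ => let b := lin_mem e l in
         lazymatch b with true => l | false => constr:(e :: l) end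
  end.

Ltac lin_index x l :=
  lazymatch l with
  | x :: _ => constr:(0%nat)
  | _ :: ?t => let n := lin_index x t in constr:(S n)
  end.

Ltac lin_reify e l :=
  lazymatch e with
  | zero => constr:(LZero)
  | plus ?a ?b => let x := lin_reify a l in let y := lin_reify b l in constr:(LPlus x y)
  | minus ?a ?b => let x := lin_reify a l in let y := lin_reify b l in constr:(LMinus x y)
  | opp ?a => let x := lin_reify a l in constr:(LOpp x)
  | scal ?r ?a => let x := lin_reify a l in constr:(LScal r x)
  | _ => let n := lin_index e l in constr:(LAtom n)
  end.

(* Compares the coefficients of every atom on both sides. *)
Ltac module_eq :=
  lazymatch goal with
  | |- @eq ?T ?a ?b =>
    let l0 := lin_atoms a (@nil T) in
    let l := lin_atoms b l0 in
    let x := lin_reify a l in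
    let y := lin_reify b l in
    refine (lin_eval_eq l x y _);
    cbn [lin_coefs_eq lin_coef Nat.eqb]; repeat split
  end.
Ltac module_ring := module_eq; ring.

(** * Improper integrals over the half line *)

Lemma filterlim_norm_lt {T : Type} {V : CompleteNormedModule R_AbsRing}
    {F : (T -> Prop) -> Prop} {FF : Filter F} (f : T -> V) (l : V) :
  (forall e, 0 < e -> F (fun x => norm (minus (f x) l) < e)) <->
  filterlim f F (locally l).
Proof.
rewrite (filterlim_locally_ball_norm (K := R_AbsRing) (U := V)); split.
- intros H e. exact (H e (cond_pos e)).
- intros H e He. exact (H (mkposreal e He)).
Qed.

Lemma norm_plus_le {V : CompleteNormedModule R_AbsRing} (x y : V) :
  norm (plus x y) <= norm x + norm y.
Proof. apply (norm_triangle (K := R_AbsRing) (V := V)). Qed.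

Lemma norm_minus_sym {V : CompleteNormedModule R_AbsRing} (x y : V) :
  norm (minus x y) = norm (minus y x).
Proof. rewrite <- (norm_opp (K := R_AbsRing) (V := V)). f_equal. module_ring. Qed.

Lemma ball_of_norm {V : CompleteNormedModule R_AbsRing} (x y : V) (e : R) :
  norm (minus y x) < e -> ball x e y.
Proof. apply (norm_compat1 (K := R_AbsRing) (V := V)). Qed.

Lemma norm_minus_le {V : CompleteNormedModule R_AbsRing} (x y : V) :
  norm (minus x y) <= norm x + norm y.
Proof. unfold minus. rewrite <- (norm_opp (K := R_AbsRing) (V := V) y). apply norm_plus_le. Qed.

Lemma norm_minus_trans {V : CompleteNormedModule R_AbsRing} (x y z : V) :
  norm (minus x z) <= norm (minus x y) + norm (minus y z).
Proof.
replace (minus x z) with (plus (minus x y) (minus y z)) by module_ring.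
apply norm_plus_le.
Qed.

Lemma norm_nonneg {V : CompleteNormedModule R_AbsRing} (x : V) : 0 <= norm x.
Proof. apply (norm_ge_0 (K := R_AbsRing) (V := V)). Qed.

Lemma norm_scal_le {V : CompleteNormedModule R_AbsRing} (k : R) (x : V) :
  norm (scal k x) <= Rabs k * norm x.
Proof. apply (norm_scal (K := R_AbsRing) (V := V)). Qed.

Lemma norm_scal_pos {V : CompleteNormedModule R_AbsRing} (k : R) (x : V) :
  0 <= k -> norm (scal k x) <= k * norm x.
Proof.
intros Hk. eapply Rle_trans; [apply (norm_scal (K := R_AbsRing) (V := V))|].
change (Rabs k * norm x <= k * norm x). rewrite Rabs_pos_eq by easy. apply Rle_refl.
Qed.

Lemma norm_limit_le {T : Type} {V : CompleteNormedModule R_AbsRing} {F : (T -> Prop) -> Prop}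
    {FF : ProperFilter F} (f : T -> V) (l : V) (M : R) :
  filterlim f F (locally l) -> F (fun x => norm (f x) <= M) -> norm l <= M.
Proof.
intros Hl HM.
apply (filterlim_le (F := F) (fun x => norm (f x)) (fun _ => M) (norm l) M); trivial.
- eapply filterlim_comp; [exact Hl | apply (filterlim_norm (K := R_AbsRing) (V := V))].
- apply filterlim_const.
Qed.

Lemma zero_of_norm_le {V : CompleteNormedModule R_AbsRing} (x : V) (C : R) :
  (forall e, 0 < e -> norm x <= C * e) -> x = zero.
Proof.
intros H. apply (norm_eq_zero (K := R_AbsRing) (V := V)). apply Rle_antisym;
    [|apply (norm_ge_0 (K := R_AbsRing) (V := V))].
apply Rnot_lt_le. intros Hx.
assert (HC : 0 < Rabs C + 1) by (pose proof (Rabs_pos C); lra).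
pose proof (H (norm x / (2 * (Rabs C + 1)))) as H1.
assert (0 < norm x / (2 * (Rabs C + 1))) by (apply Rdiv_lt_0_compat; lra).
specialize (H1 H0).
assert (C * (norm x / (2 * (Rabs C + 1))) <= (Rabs C + 1) * (norm x / (2 * (Rabs C + 1)))).
{ apply Rmult_le_compat_r; [lra|]. pose proof (Rle_abs C). lra. }
replace ((Rabs C + 1) * (norm x / (2 * (Rabs C + 1)))) with (norm x / 2) in H2 by (field; lra).
lra.
Qed.

Lemma Rpower_pos x q : 0 < Rpower x q.
Proof. apply exp_pos. Qed.

Lemma Rpower_0_lim q : 0 < q ->
  forall e, 0 < e -> exists d, 0 < d /\ forall x, 0 < x < d -> Rpower x q < e.
Proof.
intros Hq e He. exists (Rpower e (/ q)). split; [apply Rpower_pos|].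
intros x [Hx0 Hx]. replace e with (Rpower (Rpower e (/ q)) q).
- now apply Rlt_Rpower_l.
- rewrite Rpower_mult, Rinv_l, Rpower_1; lra.
Qed.

Lemma Rpower_inv x q : 0 < x -> Rpower x q = Rpower (/ x) (- q).
Proof. intros Hx. unfold Rpower. rewrite ln_Rinv by easy. f_equal. ring. Qed.

Lemma Rpower_infty_lim q : q < 0 ->
  forall e, 0 < e -> exists M, 0 < M /\ forall x, M < x -> Rpower x q < e.
Proof.
intros Hq e He. destruct (Rpower_0_lim (- q) ltac:(lra) e He) as [d [Hd H]].
exists (/ d). split; [now apply Rinv_0_lt_compat|].
intros x Hx. assert (0 < / d) by now apply Rinv_0_lt_compat.
rewrite Rpower_inv by lra. apply H. split.
- apply Rinv_0_lt_compat; lra.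
- rewrite <- (Rinv_inv d). apply Rinv_lt_contravar; [|easy].
  apply Rmult_lt_0_compat; lra.
Qed.

Lemma is_derive_Rpower q x : 0 < x ->
  is_derive (fun s => Rpower s q) x (q * Rpower x (q - 1)).
Proof. intros Hx. apply is_derive_Reals. now apply derivable_pt_lim_power. Qed.

Lemma continuous_Rpower q x : 0 < x -> continuous (fun s => Rpower s q) x.
Proof.
intros Hx. apply (ex_derive_continuous (V := R_NormedModule)).
eexists. now apply is_derive_Rpower.
Qed.

Lemma is_RInt_Rpower q a b : q <> 0 -> 0 < a -> 0 < b ->
  is_RInt (fun s => Rpower s (q - 1)) a b ((Rpower b q - Rpower a q) / q).
Proof.
intros Hq Ha Hb.
replace ((Rpower b q - Rpower a q) / q) with
  (minus (Rpower b q / q) (Rpower a q / q)) by (unfold minus, plus, opp; simpl; field; easy).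
apply (is_RInt_derive (fun s => Rpower s q / q)).
- intros x [Hx _]. assert (0 < x) by (eapply Rlt_le_trans; [|exact Hx]; now apply Rmin_glb_lt).
  replace (Rpower x (q - 1)) with (q * Rpower x (q - 1) * / q) by (field; easy).
  unfold Rdiv. apply (is_derive_scal_l (K := R_AbsRing) (V := R_NormedModule) (fun s => Rpower s
      q) x _ (/ q)).
  now apply is_derive_Rpower.
- intros x [Hx _]. apply continuous_Rpower. eapply Rlt_le_trans;
    [|exact Hx]. now apply Rmin_glb_lt.
Qed.

Lemma at_right_0_intro (P : R -> Prop) d :
  0 < d -> (forall x, 0 < x < d -> P x) -> at_right 0 P.
Proof.
intros Hd H. exists (mkposreal d Hd). intros x Hx Hx0. apply H. split; trivial.
change (Rabs (x - 0) < d) in Hx. rewrite Rminus_0_r in Hx.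
now apply Rabs_lt_between in Hx.
Qed.

Notation half_line f l := (is_RInt_gen f (at_right 0) (Rbar_locally p_infty) l).

Section HalfLine.

Context {X : CompleteNormedModule R_AbsRing}.

Lemma ex_RInt_pos (f : R -> X) a b :
  (forall x, 0 < x -> continuous f x) -> 0 < a -> 0 < b -> ex_RInt f a b.
Proof.
intros Hf Ha Hb. apply (ex_RInt_continuous f). intros z [Hz _]. apply Hf.
eapply Rlt_le_trans; [|exact Hz]. now apply Rmin_glb_lt.
Qed.

Lemma half_line_of_limits (f : R -> X) (m : R) (l1 l2 : X) :
  (forall x, 0 < x -> continuous f x) -> 0 < m ->
  filterlim (fun a => RInt f a m) (at_right 0) (locally l1) ->
  filterlim (fun b => RInt f m b) (Rbar_locally p_infty) (locally l2) ->
  half_line f (plus l1 l2).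
Proof.
intros Hf Hm H1 H2.
apply (is_RInt_gen_Chasles f m).
- intros P HP. specialize (H1 P HP). unfold filtermapi.
  eapply (Filter_prod _ _ _ (fun a => 0 < a /\ P (RInt f a m)) (fun b => b = m)).
  + apply filter_and; [|exact H1]. now apply (at_right_0_intro _ 1); [lra|].
  + reflexivity.
  + intros a b [Ha Hp] ->. exists (RInt f a m). split; trivial.
    apply (RInt_correct (V := X)). now apply ex_RInt_pos.
- intros P HP. specialize (H2 P HP). unfold filtermapi.
  eapply (Filter_prod _ _ _ (fun a => a = m) (fun b => 0 < b /\ P (RInt f m b))).
  + reflexivity.
  + apply filter_and; [|exact H2]. exists 0. now intros x.
  + intros a b -> [Ha Hp]. exists (RInt f m b). split; trivial.
    apply (RInt_correct (V := X)). now apply ex_RInt_pos.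
Qed.

Lemma norm_RInt_Rpower_le (f : R -> X) (q C a b : R) :
  (forall x, 0 < x -> continuous f x) -> q <> 0 -> 0 < a <= b ->
  (forall x, a <= x <= b -> norm (f x) <= C * Rpower x (q - 1)) ->
  norm (RInt f a b) <= C * ((Rpower b q - Rpower a q) / q).
Proof.
intros Hf Hq [Ha Hb] H.
apply (norm_RInt_le f (fun s => C * Rpower s (q - 1)) a b); trivial.
- apply (RInt_correct (V := X)). apply ex_RInt_pos; trivial; lra.
- apply (is_RInt_scal (V := R_NormedModule)). apply is_RInt_Rpower; lra.
Qed.

Lemma RInt_minus_left (f : R -> X) (m a a' : R) :
  (forall x, 0 < x -> continuous f x) -> 0 < m -> 0 < a -> 0 < a' ->
  minus (RInt f a m) (RInt f a' m) = RInt f a a'.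
Proof.
intros Hf Hm Ha Ha'.
rewrite <- (RInt_Chasles f a a' m) by (apply ex_RInt_pos; trivial).
module_ring.
Qed.

Lemma RInt_minus_right (f : R -> X) (m b b' : R) :
  (forall x, 0 < x -> continuous f x) -> 0 < m -> 0 < b -> 0 < b' ->
  minus (RInt f m b') (RInt f m b) = RInt f b b'.
Proof.
intros Hf Hm Ha Ha'.
rewrite <- (RInt_Chasles f m b b') by (apply ex_RInt_pos; trivial).
module_ring.
Qed.

Lemma RInt_lim_0 (f : R -> X) (m q C : R) :
  (forall x, 0 < x -> continuous f x) -> 0 < m -> 0 < q -> 0 <= C ->
  (forall x, 0 < x -> norm (f x) <= C * Rpower x (q - 1)) ->
  exists l, filterlim (fun a => RInt f a m) (at_right 0) (locally l) /\
    norm l <= C * (Rpower m q / q).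
Proof.
intros Hf Hm Hq HC H.
assert (HL : exists l, filterlim (fun a => RInt f a m) (at_right 0) (locally l)).
{ apply (filterlim_locally_cauchy (F := at_right 0) (fun a => RInt f a m)).
  intros [e He].
  (* The integral over [[u, v]] is at most [C v^q / q], hence below [e] for such [v]. Dividing by
     [C + 1] also covers [C = 0]. *)
  destruct (Rpower_0_lim q Hq (e * q / (C + 1))) as [d [Hd Hd']].
  { apply Rdiv_lt_0_compat; [apply Rmult_lt_0_compat|]; lra. }
  exists (fun a => 0 < a < d). split.
  { now apply (at_right_0_intro _ d). }
  assert (Hle : forall u v, 0 < u < d -> 0 < v < d -> u <= v ->
     norm (minus (RInt f u m) (RInt f v m)) < e).
  { intros u v Hu Hv Huv. rewrite RInt_minus_left by (trivial; lra).
    eapply Rle_lt_trans; [apply (norm_RInt_Rpower_le f q C)|]; trivial; try lra.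
    { intros x Hx. apply H. lra. }
    specialize (Hd' v Hv). pose proof (Rpower_pos u q). pose proof (Rpower_pos v q).
    apply Rle_lt_trans with ((C + 1) * (Rpower v q / q) - Rpower v q / q).
    - unfold Rdiv. assert (0 < / q) by now apply Rinv_0_lt_compat.
      assert (0 <= C * (Rpower u q * / q)).
      { apply Rmult_le_pos; [lra|]. apply Rmult_le_pos; lra. }
      lra.
    - assert (0 < Rpower v q / q) by now apply Rdiv_lt_0_compat.
      assert ((C + 1) * (Rpower v q / q) < (C + 1) * (e * q / (C + 1) / q)).
      { apply Rmult_lt_compat_l; [lra|]. apply Rmult_lt_compat_r; trivial.
        now apply Rinv_0_lt_compat. }
      replace ((C + 1) * (e * q / (C + 1) / q)) with e in H3 by (field; lra). lra. }
  intros u v Hu Hv. apply ball_of_norm. simpl.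
  destruct (Rle_dec u v).
  - rewrite norm_minus_sym. now apply Hle.
  - apply Hle; trivial; lra. }
destruct HL as [l Hl]. exists l; split; trivial.
apply (norm_limit_le (F := at_right 0) (fun a => RInt f a m)); trivial.
apply (at_right_0_intro _ m); trivial. intros x Hx.
eapply Rle_trans; [apply (norm_RInt_Rpower_le f q C)|]; trivial; try lra.
{ intros y Hy. apply H. lra. }
apply Rmult_le_compat_l; trivial. apply Rmult_le_compat_r.
- left. now apply Rinv_0_lt_compat.
- pose proof (Rpower_pos x q). lra.
Qed.

Lemma RInt_lim_infty (f : R -> X) (m q C : R) :
  (forall x, 0 < x -> continuous f x) -> 0 < m -> q < 0 -> 0 <= C ->
  (forall x, 0 < x -> norm (f x) <= C * Rpower x (q - 1)) ->
  exists l, filterlim (fun b => RInt f m b) (Rbar_locally p_infty) (locally l) /\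
    norm l <= C * (Rpower m q / - q).
Proof.
intros Hf Hm Hq HC H.
assert (HL : exists l, filterlim (fun b => RInt f m b) (Rbar_locally p_infty) (locally l)).
{ apply (filterlim_locally_cauchy (F := Rbar_locally p_infty) (fun b => RInt f m b)).
  intros [e He].
  destruct (Rpower_infty_lim q Hq (e * - q / (C + 1))) as [d [Hd Hd']].
  { apply Rdiv_lt_0_compat; [apply Rmult_lt_0_compat|]; lra. }
  exists (fun b => d < b). split.
  { now exists d. }
  assert (Hle : forall u v, d < u -> d < v -> u <= v ->
     norm (minus (RInt f m v) (RInt f m u)) < e).
  { intros u v Hu Hv Huv. rewrite RInt_minus_right by (trivial; lra).
    eapply Rle_lt_trans; [apply (norm_RInt_Rpower_le f q C)|]; trivial; try lra.
    { intros x Hx. apply H. lra. }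
    specialize (Hd' u Hu). pose proof (Rpower_pos u q). pose proof (Rpower_pos v q).
    apply Rle_lt_trans with ((C + 1) * (Rpower u q / - q) - Rpower u q / - q).
    - replace ((Rpower v q - Rpower u q) / q) with ((Rpower u q - Rpower v q) / - q)
        by (field; lra).
      unfold Rdiv. assert (0 < / - q) by (apply Rinv_0_lt_compat; lra).
      assert (0 <= C * (Rpower v q * / - q)).
      { apply Rmult_le_pos; [lra|]. apply Rmult_le_pos; lra. }
      lra.
    - assert (0 < Rpower u q / - q) by (apply Rdiv_lt_0_compat; lra).
      assert ((C + 1) * (Rpower u q / - q) < (C + 1) * (e * - q / (C + 1) / - q)).
      { apply Rmult_lt_compat_l; [lra|]. apply Rmult_lt_compat_r; trivial.
        apply Rinv_0_lt_compat; lra. }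
      replace ((C + 1) * (e * - q / (C + 1) / - q)) with e in H3 by (field; lra). lra. }
  intros u v Hu Hv. apply ball_of_norm. simpl.
  destruct (Rle_dec u v).
  - now apply Hle.
  - rewrite norm_minus_sym. apply Hle; trivial; lra. }
destruct HL as [l Hl]. exists l; split; trivial.
apply (norm_limit_le (F := Rbar_locally p_infty) (fun b => RInt f m b)); trivial.
exists m. intros x Hx.
eapply Rle_trans; [apply (norm_RInt_Rpower_le f q C)|]; trivial; try lra.
{ intros y Hy. apply H. lra. }
apply Rmult_le_compat_l; trivial.
replace ((Rpower x q - Rpower m q) / q) with ((Rpower m q - Rpower x q) / - q)
        by (field; lra).
apply Rmult_le_compat_r.
- left. apply Rinv_0_lt_compat; lra.
- pose proof (Rpower_pos x q). lra.
Qed.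

(* Splitting the integral at [e] gives the homogeneous bound [e^q]. *)
Lemma half_line_dominated (f : R -> X) (q C e : R) :
  (forall x, 0 < x -> continuous f x) -> 0 < q < 1 -> 0 < e -> 0 <= C ->
  (forall x, 0 < x -> norm (f x) <= C * Rpower x (q - 1)) ->
  (forall x, 0 < x -> norm (f x) <= C * e * Rpower x (q - 2)) ->
  exists l, half_line f l /\ norm l <= C * Rpower e q * (/ q + / (1 - q)).
Proof.
intros Hf Hq He HC H1 H2.
destruct (RInt_lim_0 f e q C Hf He ltac:(lra) HC H1) as [l1 [L1 B1]].
destruct (RInt_lim_infty f e (q - 1) (C * e) Hf He ltac:(lra)) as [l2 [L2 B2]].
{ apply Rmult_le_pos; lra. }
{ intros x Hx. replace (q - 1 - 1) with (q - 2) by ring. now apply H2. }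
exists (plus l1 l2). split; [now apply (half_line_of_limits f e)|].
eapply Rle_trans; [apply norm_plus_le|].
replace (Rpower e (q - 1)) with (Rpower e q / e) in B2.
2:{ unfold Rminus. rewrite Rpower_plus, Rpower_Ropp, Rpower_1; trivial. }
replace (C * e * (Rpower e q / e / - (q - 1))) with (C * Rpower e q * / (1 - q)) in B2
  by (field; lra).
replace (C * (Rpower e q / q)) with (C * Rpower e q * / q) in B1 by (field; lra).
lra.
Qed.

(** This is the form in which resolvents appear: bounded for small [x], of order [1 / x] for large
    [x], with the crossover at [e]. Every estimate of a fractional power below is an instance with
    its own [e]. *)
Lemma half_line_weighted (f : R -> X) (q C e : R) :
  (forall x, 0 < x -> continuous f x) -> 0 < q < 1 -> 0 < e -> 0 <= C ->
  (forall x, 0 < x -> norm (f x) <= C) ->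
  (forall x, 0 < x -> norm (f x) <= C * e / x) ->
  exists l, half_line (fun x => scal (Rpower x (q - 1)) (f x)) l /\
    norm l <= C * Rpower e q * (/ q + / (1 - q)).
Proof.
intros Hf Hq He HC H1 H2.
assert (Hn : forall x, 0 < x -> norm (scal (Rpower x (q - 1)) (f x)) <= Rpower x (q - 1) * norm
    (f x)).
{ intros x Hx. apply norm_scal_pos. left. apply Rpower_pos. }
apply half_line_dominated; trivial.
- intros x Hx. apply (continuous_scal (K := R_AbsRing) (V := X));
    [now apply continuous_Rpower | now apply Hf].
- intros x Hx. eapply Rle_trans; [now apply Hn|]. rewrite Rmult_comm.
  apply Rmult_le_compat_r; [left; apply Rpower_pos | now apply H1].
- intros x Hx. eapply Rle_trans; [now apply Hn|].
  replace (Rpower x (q - 2)) with (Rpower x (q - 1) * / x).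
  + replace (C * e * (Rpower x (q - 1) * / x))
      with (Rpower x (q - 1) * (C * e / x)) by (unfold Rdiv; ring).
    apply Rmult_le_compat_l; [left; apply Rpower_pos | now apply H2].
  + replace (q - 2) with ((q - 1) + - (1)) by ring.
    now rewrite (Rpower_plus (q - 1)), Rpower_Ropp, Rpower_1.
Qed.

Lemma half_line_RInt_gen (f : R -> X) l :
  half_line f l -> RInt_gen f (at_right 0) (Rbar_locally p_infty) = l.
Proof. apply (is_RInt_gen_unique (V := X) f l). Qed.

Lemma half_line_unique (f : R -> X) l1 l2 : half_line f l1 -> half_line f l2 -> l1 = l2.
Proof. intros H1 H2. apply half_line_RInt_gen in H1, H2. congruence. Qed.

Lemma half_line_plus (f g : R -> X) lf lg : half_line f lf -> half_line g lg ->
  half_line (fun x => plus (f x) (g x)) (plus lf lg).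
Proof. apply (is_RInt_gen_plus (V := X)). Qed.

Lemma half_line_minus (f g : R -> X) lf lg : half_line f lf -> half_line g lg ->
  half_line (fun x => minus (f x) (g x)) (minus lf lg).
Proof. apply (is_RInt_gen_minus (V := X)). Qed.

Lemma half_line_scal (f : R -> X) (k : R) l : half_line f l ->
  half_line (fun x => scal k (f x)) (scal k l).
Proof. apply (is_RInt_gen_scal (V := X)). Qed.

Lemma half_line_ext (f g : R -> X) l :
  (forall x, 0 < x -> f x = g x) -> half_line f l -> half_line g l.
Proof.
intros H. apply is_RInt_gen_ext.
apply (Filter_prod _ _ _ (fun a => 0 < a) (fun b => 0 < b)).
- now apply (at_right_0_intro _ 1); [lra|].
- now exists 0.
- intros a b Ha Hb x [Hx _]. apply H. simpl in Hx.
  eapply Rlt_trans; [|exact Hx]. now apply Rmin_glb_lt.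
Qed.

(** A linear map commutes with each Riemann sum, and continuity carries this through the limit that
    defines the integral. *)
Lemma is_RInt_linear {Y : NormedModule R_AbsRing} (L : X -> Y) (f : R -> X) a b l :
  is_linear L -> is_RInt f a b l -> is_RInt (fun x => L (f x)) a b (L l).
Proof.
intros HL H. unfold is_RInt in *.
assert (HS : forall ptd, L (scal (sign (b - a)) (Riemann_sum f ptd)) =
                     scal (sign (b - a)) (Riemann_sum (fun x => L (f x)) ptd)).
{ intros ptd. rewrite (linear_scal L HL). f_equal.
  apply (SF_cons_ind (fun ptd => L (Riemann_sum f ptd) = Riemann_sum (fun x => L (f x)) ptd)).
  - intros x. unfold Riemann_sum; simpl. apply (linear_zero L HL).
  - intros h s IH. rewrite !Riemann_sum_cons, (linear_plus L HL), (linear_scal L HL), IH.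
    reflexivity. }
eapply filterlim_ext; [exact HS|].
eapply filterlim_comp; [exact H|]. apply (linear_cont L l HL).
Qed.

Lemma half_line_linear {Y : NormedModule R_AbsRing} (L : X -> Y) (f : R -> X) l :
  is_linear L -> half_line f l -> half_line (fun x => L (f x)) (L l).
Proof.
intros HL H P HP.
specialize (H (fun x => P (L x)) (linear_cont L l HL P HP)).
unfold filtermapi in *. eapply filter_imp; [|exact H].
intros ab [y [H1 H2]]. exists (L y). split; trivial. now apply is_RInt_linear.
Qed.

Lemma half_line_of_primitive (F f : R -> X) (l0 l1 : X) :
  (forall a b, 0 < a -> 0 < b -> is_RInt f a b (minus (F b) (F a))) ->
  (forall x, 0 < x -> continuous f x) ->
  filterlim F (at_right 0) (locally l0) ->
  filterlim F (Rbar_locally p_infty) (locally l1) ->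
  half_line f (minus l1 l0).
Proof.
intros HI Hf H0 H1.
replace (minus l1 l0) with (plus (minus (F 1) l0) (minus l1 (F 1))) by module_ring.
apply (half_line_of_limits f 1); trivial; [lra| |].
- apply filterlim_norm_lt. intros e He.
  apply (filterlim_norm_lt (F := at_right 0) F l0) with (e := e) in H0; trivial.
  assert (Hp : at_right 0 (fun x => 0 < x)) by (now apply (at_right_0_intro _ 1); [lra|]).
  generalize (filter_and _ _ Hp H0). apply filter_imp. intros x [Hx Hx2].
  rewrite (is_RInt_unique _ _ _ _ (HI x 1 Hx ltac:(lra))).
  eapply Rle_lt_trans; [|exact Hx2]. rewrite norm_minus_sym. right. f_equal. module_ring.
- apply filterlim_norm_lt. intros e He.
  apply (filterlim_norm_lt (F := Rbar_locally p_infty) F l1) with (e := e) in H1; trivial.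
  assert (Hp : Rbar_locally p_infty (fun x => 0 < x)) by (now exists 0).
  generalize (filter_and _ _ Hp H1). apply filter_imp. intros x [Hx Hx2].
  rewrite (is_RInt_unique _ _ _ _ (HI 1 x ltac:(lra) Hx)).
  eapply Rle_lt_trans; [|exact Hx2]. right. f_equal. module_ring.
Qed.

End HalfLine.

(** * Powers along the segment from the identity to an operator *)

Lemma is_derive_of_quadratic {X : CompleteNormedModule R_AbsRing} (F : R ->
    X) (s : R) (l : X) (C d : R) :
  0 < d ->
  (forall s', Rabs (s' - s) < d ->
     norm (minus (minus (F s') (F s)) (scal (s' - s) l)) <= C * (s' - s) ^ 2) ->
  is_derive F s l.
Proof.
intros Hd H. split; [apply is_linear_scal_l|].
intros x Hx. apply (is_filter_lim_locally_unique (K := R_AbsRing) (V := R_NormedModule)) in Hx.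
    subst x.
intros [e He]. simpl.
assert (HC : 0 < Rabs C + 1) by (pose proof (Rabs_pos C); lra).
assert (Hm : 0 < Rmin d (e / (Rabs C + 1))).
{ apply Rmin_glb_lt; trivial. now apply Rdiv_lt_0_compat. }
exists (mkposreal _ Hm). intros s' Hs'.
change (Rabs (s' - s) < Rmin d (e / (Rabs C + 1))) in Hs'.
change (norm (minus (minus (F s') (F s)) (scal (s' - s) l)) <= e * Rabs (s' - s)).
assert (H1 : Rabs (s' - s) < d) by (eapply Rlt_le_trans; [exact Hs'|apply Rmin_l]).
assert (H2 : Rabs (s' - s) < e / (Rabs C + 1)) by (eapply Rlt_le_trans; [exact Hs'|apply Rmin_r]).
eapply Rle_trans; [now apply H|].
rewrite <- (pow2_abs (s' - s)). pose proof (Rabs_pos (s' - s)).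
replace (C * Rabs (s' - s) ^ 2) with (C * Rabs (s' - s) * Rabs (s' - s)) by ring.
apply Rmult_le_compat_r; trivial.
apply Rle_trans with ((Rabs C + 1) * Rabs (s' - s)).
- apply Rmult_le_compat_r; trivial. pose proof (Rle_abs C). lra.
- apply Rlt_le in H2.
  apply (Rmult_le_compat_l (Rabs C + 1)) in H2; [|lra].
  replace ((Rabs C + 1) * (e / (Rabs C + 1))) with e in H2 by (field; lra). exact H2.
Qed.

Lemma continuous_of_lipschitz {X : CompleteNormedModule R_AbsRing} (F : R -> X) (s C d : R) :
  0 < d ->
  (forall s', Rabs (s' - s) < d -> norm (minus (F s') (F s)) <= C * Rabs (s' - s)) ->
  continuous F s.
Proof.
intros Hd H. apply filterlim_norm_lt. intros e He.
assert (HC : 0 < Rabs C + 1) by (pose proof (Rabs_pos C); lra).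
assert (Hm : 0 < Rmin d (e / (Rabs C + 1))).
{ apply Rmin_glb_lt; trivial. now apply Rdiv_lt_0_compat. }
exists (mkposreal _ Hm). intros s' Hs'.
change (Rabs (s' - s) < Rmin d (e / (Rabs C + 1))) in Hs'.
assert (H1 : Rabs (s' - s) < d) by (eapply Rlt_le_trans; [exact Hs'|apply Rmin_l]).
assert (H2 : Rabs (s' - s) < e / (Rabs C + 1)) by (eapply Rlt_le_trans; [exact Hs'|apply Rmin_r]).
eapply Rle_lt_trans; [now apply H|].
pose proof (Rabs_pos (s' - s)).
apply Rle_lt_trans with ((Rabs C + 1) * Rabs (s' - s)).
- apply Rmult_le_compat_r; trivial. pose proof (Rle_abs C). lra.
- apply (Rmult_lt_compat_l (Rabs C + 1)) in H2; [|lra].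
  replace ((Rabs C + 1) * (e / (Rabs C + 1))) with e in H2 by (field; lra). exact H2.
Qed.

Lemma exp_le_compat x y : x <= y -> exp x <= exp y.
Proof.
intros [H| ->]; [left; now apply exp_increasing | apply Rle_refl].
Qed.

(** Gronwall's inequality without derivatives, since the norm of a difference need not be
    differentiable. With [N] equal steps the errors [C d^2] accumulate to at most
    [C t^2 exp (M t) / N], and [N] is arbitrary. *)
Lemma gronwall_euler (a : R -> R) (t M C : R) :
  0 <= t -> 0 <= M -> 0 <= C -> a 0 = 0 ->
  (forall x y, 0 <= x <= y -> y <= t -> a y <= (1 + M * (y - x)) * a x + C * (y - x) ^ 2) ->
  a t <= 0.
Proof.
intros Ht HM HC H0 H.
assert (HN : forall N : nat, (0 < N)%nat -> a t <= C * t ^ 2 * exp (M * t) / INR N).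
{ intros N HN. assert (HN' : 0 < INR N) by (now apply lt_0_INR).
  set (d := t / INR N). assert (Hd : 0 <= d) by (apply Rdiv_le_0_compat; lra).
  assert (HdN : INR N * d = t) by (unfold d; field; lra).
  assert (HK : forall k, (k <= N)%nat ->
      a (INR k * d) <= C * d ^ 2 * INR k * exp (M * (INR k * d))).
  { induction k as [|k IH]; intros Hk.
    - simpl. rewrite !Rmult_0_l, H0. lra.
    - specialize (IH ltac:(lia)).
      assert (Hk' : INR (S k) * d <= t).
      { rewrite <- HdN. apply Rmult_le_compat_r; trivial. now apply le_INR. }
      eapply Rle_trans; [apply (H (INR k * d)); trivial|].
      { split.
        - apply Rmult_le_pos; trivial. apply pos_INR.
        - apply Rmult_le_compat_r; trivial. apply le_INR. lia. }
      rewrite S_INR. replace ((INR k + 1) * d - INR k * d) with d by ring.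
      set (E := exp (M * (INR k * d))) in *.
      replace (M * ((INR k + 1) * d)) with (M * (INR k * d) + M * d) by ring.
      rewrite exp_plus. fold E. pose proof (exp_ineq1_le (M * d)) as HE.
      assert (HMd : 0 <= M * d) by (now apply Rmult_le_pos).
      assert (HE1 : 1 <= E).
      { unfold E. rewrite <- exp_0. apply exp_le_compat. apply Rmult_le_pos; trivial.
        apply Rmult_le_pos; trivial. apply pos_INR. }
      assert (Hc : 0 <= C * d ^ 2) by (apply Rmult_le_pos; trivial; apply pow2_ge_0).
      pose proof (pos_INR k).
      apply Rle_trans with ((1 + M * d) * (C * d ^ 2 * INR k * E) + C * d ^ 2 * (E * exp (M *
          d))).
      + apply Rplus_le_compat.
        * apply Rmult_le_compat_l; lra.
        * rewrite <- (Rmult_1_r (C * d ^ 2)) at 1. apply Rmult_le_compat_l; trivial.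
          rewrite <- (Rmult_1_r 1). apply Rmult_le_compat; lra.
      + assert ((1 + M * d) * (C * d ^ 2 * INR k * E) <= exp (M * d) * (C * d ^ 2 * INR k * E)).
        { apply Rmult_le_compat_r; [|lra]. apply Rmult_le_pos; [|lra]. now apply Rmult_le_pos. }
        lra. }
  specialize (HK N ltac:(lia)). rewrite HdN in HK.
  eapply Rle_trans; [exact HK|]. right. unfold d. field. lra. }
apply Rnot_lt_le. intros Ha.
set (K := C * t ^ 2 * exp (M * t)) in *.
destruct (INR_archimed (a t) K Ha) as [n Hn].
specialize (HN (S n) ltac:(lia)). rewrite S_INR in HN. pose proof (pos_INR n).
apply (Rmult_le_compat_r (INR n + 1)) in HN; [|lra].
replace (K / (INR n + 1) * (INR n + 1)) with K in HN by (field; lra). lra.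
Qed.

(** Euler's [B(q, 1 - q)]. It is the fractional integral of the identity operator, hence the value
    at [t = 0] from which all compared solutions start. *)
Definition beta_int (q : R) : R :=
  RInt_gen (V := R_CompleteNormedModule) (fun s => Rpower s (q - 1) * / (1 + s))
    (at_right 0) (Rbar_locally p_infty).

Lemma continuous_inv_shift s : 0 < s -> continuous (fun s => / (1 + s)) s.
Proof.
intros Hs. apply (ex_derive_continuous (V := R_NormedModule)). auto_derive. lra.
Qed.

Lemma beta_int_half_line q : 0 < q < 1 ->
  is_RInt_gen (V := R_CompleteNormedModule) (fun s => Rpower s (q - 1) * / (1 + s))
    (at_right 0) (Rbar_locally p_infty) (beta_int q) /\
  Rabs (beta_int q) <= / q + / (1 - q).
Proof.
intros Hq.
assert (Hinv : forall x, 0 < x -> Rabs (/ (1 + x)) <= 1 /\ Rabs (/ (1 + x)) <= / x).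
{ intros x Hx. rewrite Rabs_pos_eq by (left; apply Rinv_0_lt_compat; lra). split.
  - rewrite <- Rinv_1. apply Rinv_le_contravar; lra.
  - apply Rinv_le_contravar; lra. }
destruct (half_line_weighted (X := R_CompleteNormedModule) (fun s => / (1 + s)) q 1 1)
    as [l [Hl Hb]];
  trivial; try lra.
- apply continuous_inv_shift.
- intros x Hx. now apply Hinv.
- intros x Hx. replace (1 * 1 / x) with (/ x) by (field; lra). now apply Hinv.
- assert (E : beta_int q = l).
  { unfold beta_int. apply (half_line_RInt_gen (X := R_CompleteNormedModule)). exact Hl. }
  rewrite E. split; [exact Hl|]. eapply Rle_trans; [exact Hb|]. right.
  unfold Rpower. rewrite ln_1, Rmult_0_r, exp_0. ring.
Qed.

(** [Q a b] is [(a I + b A)^-1]. The homogeneous form treats all [A_t + s = (1 - t + s) I + t A] at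
    once, including the multiple of the identity at [t = 0], with a bound uniform in [b]. *)
Definition resolvent_family {X : CompleteNormedModule R_AbsRing} (A : X -> X)
    (Q : R -> R -> X -> X) (kap : R) : Prop :=
  forall a b, 0 < a -> 0 <= b <= 1 ->
    (forall y, plus (scal a (Q a b y)) (scal b (A (Q a b y))) = y) /\
    (forall u, Q a b (plus (scal a u) (scal b (A u))) = u) /\
    (forall y, norm (Q a b y) <= kap / a * norm y).

(** * Two-parameter resolvents and the segment [A_t] *)

Section Resolvent.

Context {X : CompleteNormedModule R_AbsRing} (A : X -> X) (HA : is_linear A)
  (Q : R -> R -> X -> X) (kap : R) (Hkap : 0 < kap) (HQ : resolvent_family A Q kap).

Lemma Q_r a b y : 0 < a -> 0 <= b <= 1 ->
  plus (scal a (Q a b y)) (scal b (A (Q a b y))) = y.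
Proof. intros Ha Hb. apply (HQ a b Ha Hb). Qed.

Lemma Q_l a b u v : 0 < a -> 0 <= b <= 1 ->
  plus (scal a u) (scal b (A u)) = v -> Q a b v = u.
Proof. intros Ha Hb <-. apply (HQ a b Ha Hb). Qed.

Lemma Q_bound a b y : 0 < a -> 0 <= b <= 1 -> norm (Q a b y) <= kap / a * norm y.
Proof. intros Ha Hb. apply (HQ a b Ha Hb). Qed.

Lemma Q_linear a b : 0 < a -> 0 <= b <= 1 -> is_linear (Q a b).
Proof.
intros Ha Hb. split.
- intros x y. apply Q_l; trivial.
  rewrite <- (Q_r a b x) at 3 by trivial. rewrite <- (Q_r a b y) at 3 by trivial.
  rewrite (linear_plus A HA). module_ring.
- intros k x. apply Q_l; trivial.
  rewrite <- (Q_r a b x) at 3 by trivial.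
  rewrite (linear_scal A HA). module_eq; unfold mult; simpl; ring.
- exists (kap / a). split; [now apply Rdiv_lt_0_compat|]. intros x. now apply Q_bound.
Qed.

Lemma Q_A a b y : 0 < a -> 0 <= b <= 1 -> Q a b (A y) = A (Q a b y).
Proof.
intros Ha Hb. apply Q_l; trivial. rewrite <- (Q_r a b y) at 3 by trivial.
now rewrite (linear_plus A HA), !(linear_scal A HA).
Qed.

Lemma Q_commutes a b (L : X -> X) y : 0 < a -> 0 <= b <= 1 -> is_linear L ->
  (forall x, L (A x) = A (L x)) -> Q a b (L y) = L (Q a b y).
Proof.
intros Ha Hb HL HLA. apply Q_l; trivial. rewrite <- (Q_r a b y) at 3 by trivial.
now rewrite (linear_plus L HL), !(linear_scal L HL), HLA.
Qed.

Lemma Q_Q a b a' b' y : 0 < a -> 0 <= b <= 1 -> 0 < a' -> 0 <= b' <= 1 ->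
  Q a b (Q a' b' y) = Q a' b' (Q a b y).
Proof.
intros. apply Q_commutes; trivial.
- now apply Q_linear.
- intros. now apply Q_A.
Qed.

(** The identity [S^-1 - T^-1 = S^-1 (T - S) T^-1]. Varying [a] alone gives differences in [s];
    varying both parameters gives differences in [t]. *)
Lemma Q_resolvent a b a' b' y : 0 < a -> 0 <= b <= 1 -> 0 < a' -> 0 <= b' <= 1 ->
  minus (Q a b y) (Q a' b' y) =
  Q a b (plus (scal (a' - a) (Q a' b' y)) (scal (b' - b) (A (Q a' b' y)))).
Proof.
intros Ha Hb Ha' Hb'. symmetry. apply Q_l; trivial.
set (z' := Q a' b' y). set (z := Q a b y).
rewrite (linear_minus A _ _ HA).
assert (E1 : plus (scal a z) (scal b (A z)) = y) by now apply Q_r.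
assert (E2 : plus (scal a' z') (scal b' (A z')) = y) by now apply Q_r.
clearbody z z'. transitivity (minus y (plus (scal a z') (scal b (A z')))).
- rewrite <- E1. module_ring.
- rewrite <- E2. module_ring.
Qed.

Definition segment (t : R) (u : X) : X := plus (scal (1 - t) u) (scal t (A u)).

Definition seg_dir (u : X) : X := minus (A u) u.

Definition seg_res (t s : R) : X -> X := Q (1 - t + s) t.

Lemma seg_dir_linear : is_linear seg_dir.
Proof.
destruct (linear_norm A HA) as [M [HM HMA]]. split.
- intros x y. unfold seg_dir. rewrite (linear_plus A HA). module_ring.
- intros k x. unfold seg_dir. rewrite (linear_scal A HA). module_ring.
- exists (M + 1). split; [lra|]. intros x. unfold seg_dir.
  eapply Rle_trans; [apply norm_minus_le|]. specialize (HMA x). lra.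
Qed.

Lemma segment_linear t : is_linear (segment t).
Proof.
destruct (linear_norm A HA) as [M [HM HMA]]. split.
- intros x y. unfold segment. rewrite (linear_plus A HA). module_ring.
- intros k x. unfold segment. rewrite (linear_scal A HA). module_ring.
- exists (Rabs (1 - t) + Rabs t * M + 1). split.
  { pose proof (Rabs_pos (1 - t)). pose proof (Rmult_le_pos _ _ (Rabs_pos t) (Rlt_le _ _ HM)).
      lra. }
  intros x. unfold segment.
  eapply Rle_trans; [apply norm_plus_le|].
  pose proof (norm_scal_le (1 - t) x) as H1.
  pose proof (norm_scal_le t (A x)) as H2.
  pose proof (Rmult_le_compat_l _ _ _ (Rabs_pos t) (HMA x)) as H3.
  pose proof (norm_nonneg x). lra.
Qed.

Lemma segment_bound (M t : R) (u : X) : 0 <= M -> (forall x, norm (A x) <= M * norm x) ->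
  0 <= t <= 1 -> norm (segment t u) <= (1 + M) * norm u.
Proof.
intros HM HMA Ht. unfold segment. eapply Rle_trans; [apply norm_plus_le|].
pose proof (norm_scal_pos (1 - t) u ltac:(lra)). pose proof (norm_scal_pos t (A u) ltac:(lra)).
pose proof (norm_nonneg u).
assert (t * norm (A u) <= 1 * (M * norm u)).
{ apply Rmult_le_compat; trivial; try lra. apply norm_nonneg. }
assert ((1 - t) * norm u <= 1 * norm u) by (apply Rmult_le_compat_r; lra).
lra.
Qed.

Definition seg_dom (t s : R) : Prop := 0 <= t <= 1 /\ 0 < 1 - t + s.

Lemma seg_dom_pos t s : 0 <= t <= 1 -> 0 < s -> seg_dom t s.
Proof. intros; split; lra. Qed.

Lemma res_linear t s : seg_dom t s -> is_linear (seg_res t s).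
Proof. intros [H1 H2]. now apply Q_linear. Qed.

Lemma res_bound t s y : seg_dom t s -> norm (seg_res t s y) <= kap / (1 - t + s) * norm y.
Proof. intros [H1 H2]. now apply Q_bound. Qed.

Lemma res_bound_le t s d y : seg_dom t s -> 0 < d <= 1 - t + s ->
  norm (seg_res t s y) <= kap / d * norm y.
Proof.
intros H Hd. eapply Rle_trans; [now apply res_bound|].
apply Rmult_le_compat_r; [apply norm_nonneg|].
unfold Rdiv. apply Rmult_le_compat_l; [lra|]. apply Rinv_le_contravar; lra.
Qed.

Lemma res_commutes t s (L : X -> X) y : seg_dom t s -> is_linear L ->
  (forall x, L (A x) = A (L x)) -> seg_res t s (L y) = L (seg_res t s y).
Proof. intros [H1 H2]. now apply Q_commutes. Qed.

Lemma res_res t s t' s' y : seg_dom t s -> seg_dom t' s' ->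
  seg_res t s (seg_res t' s' y) = seg_res t' s' (seg_res t s y).
Proof. intros [H1 H2] [H3 H4]. now apply Q_Q. Qed.

Lemma seg_dir_A y : seg_dir (A y) = A (seg_dir y).
Proof. unfold seg_dir. now rewrite (linear_minus A _ _ HA). Qed.

Lemma res_segment t s u : seg_dom t s ->
  seg_res t s (segment t u) = minus u (scal s (seg_res t s u)).
Proof.
intros [H1 H2]. apply Q_l; trivial.
assert (E : plus (scal (1 - t + s) (seg_res t s u)) (scal t (A (seg_res t s u))) = u)
    by now apply Q_r.
rewrite (linear_minus A _ _ HA), (linear_scal A HA).
set (z := seg_res t s u) in *. clearbody z.
transitivity (minus (plus (scal (1 - t + s) u) (scal t (A u))) (scal s u)).
- rewrite <- E at 5. module_ring.
- unfold segment. module_ring.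
Qed.

Lemma res_diff_s t s s' y : seg_dom t s -> seg_dom t s' ->
  minus (seg_res t s' y) (seg_res t s y) = scal (s - s') (seg_res t s' (seg_res t s y)).
Proof.
intros [H1 H2] [_ H3]. unfold seg_res. rewrite Q_resolvent by trivial.
rewrite <- (linear_scal _ (Q_linear _ _ H3 H1)). f_equal. module_ring.
Qed.

Lemma res_diff_t t t' s y : seg_dom t s -> seg_dom t' s ->
  minus (seg_res t' s y) (seg_res t s y) =
  scal (t - t') (seg_res t' s (seg_dir (seg_res t s y))).
Proof.
intros [H1 H2] [H3 H4]. unfold seg_res. rewrite Q_resolvent by trivial.
rewrite <- (linear_scal _ (Q_linear _ _ H4 H3)). f_equal. unfold seg_dir. module_ring.
Qed.

(** Applying the resolvent identity twice makes the remainder exactly [(s' - s)^2 R_s' R_s R_s y].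
    On [|s' - s| < s / 2] all three resolvents are bounded by [kap / (s / 2)]. *)
Lemma is_derive_res t s y : 0 <= t <= 1 -> 0 < s ->
  is_derive (fun s => seg_res t s y) s (opp (seg_res t s (seg_res t s y))).
Proof.
intros Ht Hs.
pose proof (seg_dom_pos t s Ht Hs) as Hd.
apply (is_derive_of_quadratic _ s _
  (kap / (s / 2) * (kap / (s / 2) * (kap / (s / 2) * norm y))) (s / 2)); [lra|].
intros s' Hs'. apply Rabs_lt_between in Hs'.
assert (Hd' : seg_dom t s') by (apply seg_dom_pos; lra).
replace (minus (minus (seg_res t s' y) (seg_res t s y))
  (scal (s' - s) (opp (seg_res t s (seg_res t s y))))) with
  (scal ((s' - s) ^ 2) (seg_res t s' (seg_res t s (seg_res t s y)))).
- eapply Rle_trans; [apply norm_scal_pos; apply pow2_ge_0|].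
  rewrite Rmult_comm. apply Rmult_le_compat_r; [apply pow2_ge_0|].
  assert (Hk : 0 <= kap / (s / 2)) by (left; apply Rdiv_lt_0_compat; lra).
  eapply Rle_trans; [apply (res_bound_le _ _ (s / 2)); trivial; lra|].
  apply Rmult_le_compat_l; trivial.
  eapply Rle_trans; [apply (res_bound_le _ _ (s / 2)); trivial; lra|].
  apply Rmult_le_compat_l; trivial.
  apply (res_bound_le _ _ (s / 2)); trivial; lra.
- rewrite res_diff_s by trivial.
  pose proof (res_diff_s t s s' (seg_res t s y) Hd Hd') as E.
  transitivity (scal (s - s') (minus (seg_res t s' (seg_res t s y)) (seg_res t s (seg_res t s
      y)))).
  + rewrite E. module_ring.
  + module_ring.
Qed.

Lemma continuous_res t s y : 0 <= t <= 1 -> 0 < s -> continuous (fun s => seg_res t s y) s.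
Proof.
intros Ht Hs. apply (ex_derive_continuous (V := X)).
eexists. now apply is_derive_res.
Qed.

Lemma continuous_res2 t s y : 0 <= t <= 1 -> 0 < s ->
  continuous (fun s => seg_res t s (seg_res t s y)) s.
Proof.
intros Ht Hs.
pose proof (seg_dom_pos t s Ht Hs) as Hd.
apply (continuous_of_lipschitz _ s
  (2 * (kap / (s / 2) * (kap / (s / 2) * (kap / (s / 2) * norm y)))) (s / 2)); [lra|].
intros s' Hs'. assert (Hs'2 := Hs'). apply Rabs_lt_between in Hs'.
assert (Hd' : seg_dom t s') by (apply seg_dom_pos; lra).
assert (Hk : 0 <= kap / (s / 2)) by (left; apply Rdiv_lt_0_compat; lra).
assert (B : forall s1, seg_dom t s1 -> s / 2 <= s1 ->
    forall z, norm (seg_res t s1 z) <= kap / (s / 2) * norm z).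
{ intros s1 H1 H2 z. apply (res_bound_le _ _ (s / 2)); trivial; lra. }
assert (B3 : forall s1 s2 s3, s / 2 <= s1 -> s / 2 <= s2 -> s / 2 <= s3 ->
  norm (seg_res t s1 (seg_res t s2 (seg_res t s3 y))) <= kap / (s / 2) * (kap / (s / 2) * (kap /
      (s / 2) * norm y))).
{ intros s1 s2 s3 H1 H2 H3.
  eapply Rle_trans; [apply B; trivial; apply seg_dom_pos; lra|]. apply Rmult_le_compat_l; trivial.
  eapply Rle_trans; [apply B; trivial; apply seg_dom_pos; lra|]. apply Rmult_le_compat_l; trivial.
  apply B; trivial; apply seg_dom_pos; lra. }
(* With [R] and [R'] the resolvents at [s] and [s']: [R' R' - R R = (s - s') (R' R' R + R R' R)],
   because they commute. *)
replace (minus (seg_res t s' (seg_res t s' y)) (seg_res t s (seg_res t s y))) with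
  (scal (s - s') (plus (seg_res t s' (seg_res t s' (seg_res t s y))) (seg_res t s (seg_res t s'
      (seg_res t s y))))).
- eapply Rle_trans; [apply norm_scal_le|].
  rewrite Rabs_minus_sym, Rmult_comm.
  apply Rmult_le_compat_r; [apply Rabs_pos|].
  eapply Rle_trans; [apply norm_plus_le|].
  pose proof (B3 s' s' s ltac:(lra) ltac:(lra) ltac:(lra)).
  pose proof (B3 s s' s ltac:(lra) ltac:(lra) ltac:(lra)). lra.
- replace (minus (seg_res t s' (seg_res t s' y)) (seg_res t s (seg_res t s y))) with
    (plus (seg_res t s' (minus (seg_res t s' y) (seg_res t s y)))
          (minus (seg_res t s' (seg_res t s y)) (seg_res t s (seg_res t s y)))).
  + rewrite res_diff_s by trivial. rewrite (linear_scal _ (res_linear t s' Hd')).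
    rewrite (res_diff_s t s s' (seg_res t s y)) by trivial.
    rewrite (res_res t s' t s (seg_res t s y)) by trivial.
    rewrite (res_res t s' t s y) by trivial.
    module_ring.
  + rewrite (linear_minus _ _ _ (res_linear t s' Hd')). module_ring.
Qed.

(** The integrand is the derivative of [s^q R_s y], which vanishes at both ends: at [0] since [R_s]
    stays bounded by [kap / (1 - t)], at infinity since it is [O(s^(q-1))]. *)
Lemma by_parts q t y : 0 < q < 1 -> 0 <= t < 1 ->
  half_line (fun s => minus (scal (q * Rpower s (q - 1)) (seg_res t s y))
                            (scal (Rpower s q) (seg_res t s (seg_res t s y)))) zero.
Proof.
intros Hq Ht.
(* The value is rewritten as a difference of boundary limits, as [half_line_of_primitive]
   expects. *)
match goal with |- is_RInt_gen ?f ?a ?b _ =>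
  apply (eq_ind (minus zero zero : X) (is_RInt_gen f a b)); [|module_ring] end.
assert (Hc0 : forall s, 0 < s -> continuous (fun s => seg_res t s y) s).
{ intros s Hs. apply continuous_res; trivial; lra. }
assert (Hc1 : forall s, 0 < s -> continuous (fun s => opp (seg_res t s (seg_res t s y))) s).
{ intros s Hs. apply (continuous_opp (K := R_AbsRing) (V := X)). apply continuous_res2; trivial;
    lra. }
assert (Hc2 : forall s, 0 < s -> continuous (fun s => q * Rpower s (q - 1)) s).
{ intros s Hs. apply (continuous_scal_r (K := R_AbsRing) (V := R_NormedModule) q (fun s =>
    Rpower s (q - 1))).
  now apply continuous_Rpower. }
assert (Hb : forall s, 0 < s -> norm (scal (Rpower s q) (seg_res t s y)) <= Rpower s q * (kap /
    (1 - t) * norm y)).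
{ intros s Hs. eapply Rle_trans; [apply norm_scal_pos; left; apply Rpower_pos|].
  apply Rmult_le_compat_l; [left; apply Rpower_pos|]. apply res_bound_le; [split|]; lra. }
assert (Hb2 : forall s, 0 < s -> norm (scal (Rpower s q) (seg_res t s y)) <= Rpower s (q - 1) *
    (kap * norm y)).
{ intros s Hs. eapply Rle_trans; [apply norm_scal_pos; left; apply Rpower_pos|].
  replace (Rpower s (q - 1)) with (Rpower s q / s).
  2:{ unfold Rminus. now rewrite Rpower_plus, Rpower_Ropp, Rpower_1. }
  replace (Rpower s q / s * (kap * norm y)) with (Rpower s q * (kap / s * norm y)) by (field;
      lra).
  apply Rmult_le_compat_l; [left; apply Rpower_pos|]. apply res_bound_le; [split|]; lra. }
assert (Hk : forall k, 0 <= k -> forall e, 0 < e -> forall x, x < e / (k + 1) ->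
    x * k < e \/ x < 0).
{ intros k Hk e He x Hx. destruct (Rlt_le_dec x 0); [now right|left].
  apply Rle_lt_trans with (x * (k + 1)); [apply Rmult_le_compat_l; lra|].
  apply (Rmult_lt_compat_r (k + 1)) in Hx; [|lra].
  replace (e / (k + 1) * (k + 1)) with e in Hx by (field; lra). exact Hx. }
apply (half_line_of_primitive (fun s => scal (Rpower s q) (seg_res t s y))).
- intros a b Ha Hb'.
  eapply is_RInt_ext.
  2:{ apply (is_RInt_scal_derive (V := X) (fun s => Rpower s q) (fun s => seg_res t s y)
       (fun s => q * Rpower s (q - 1)) (fun s => opp (seg_res t s (seg_res t s y))));
           intros s [Hs _];
      assert (Hs0 : 0 < s) by (eapply Rlt_le_trans; [|exact Hs]; now apply Rmin_glb_lt).
      - now apply is_derive_Rpower.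
      - apply is_derive_res; lra.
      - now apply Hc2.
      - now apply Hc1. }
  intros s _. simpl. module_ring.
- intros s Hs.
  apply (continuous_minus (K := R_AbsRing) (V := X)).
  + apply (continuous_scal (K := R_AbsRing) (V := X)); auto.
  + apply (continuous_scal (K := R_AbsRing) (V := X)).
    * now apply continuous_Rpower.
    * apply continuous_res2; lra.
- apply filterlim_norm_lt. intros e He.
  set (k := kap / (1 - t) * norm y) in *.
  assert (Hk0 : 0 <= k).
  { apply Rmult_le_pos; [|apply norm_nonneg]. left. apply Rdiv_lt_0_compat; lra. }
  destruct (Rpower_0_lim q ltac:(lra) (e / (k + 1))) as [d [Hd Hd']].
  { apply Rdiv_lt_0_compat; lra. }
  apply (at_right_0_intro _ d); trivial. intros s Hs.
  eapply Rle_lt_trans; [right; apply f_equal; apply (minus_zero_r (G := X))|].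
  eapply Rle_lt_trans; [apply Hb; lra|].
  destruct (Hk k Hk0 e He _ (Hd' s Hs)); trivial. pose proof (Rpower_pos s q). lra.
- apply filterlim_norm_lt. intros e He.
  set (k := kap * norm y) in *.
  assert (Hk0 : 0 <= k).
  { apply Rmult_le_pos; [|apply norm_nonneg]. lra. }
  destruct (Rpower_infty_lim (q - 1) ltac:(lra) (e / (k + 1))) as [d [Hd Hd']].
  { apply Rdiv_lt_0_compat; lra. }
  exists d. intros s Hs.
  eapply Rle_lt_trans; [right; apply f_equal; apply (minus_zero_r (G := X))|].
  eapply Rle_lt_trans; [apply Hb2; lra|].
  destruct (Hk k Hk0 e He _ (Hd' s Hs)); trivial. pose proof (Rpower_pos s (q - 1)). lra.
Qed.

(** * Unnormalised powers of [A_t] and their evolution in [t] *)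

Context (M : R) (HM : 0 < M) (HMA : forall x, norm (A x) <= M * norm x).

(** This is [beta_int q] times the power of order [q] of [A_t]. Without the sine factor, nothing in
    this section depends on the reflection formula. *)
Definition seg_pow (q t : R) (u : X) : X :=
  RInt_gen (fun s => scal (Rpower s (q - 1)) (seg_res t s (segment t u)))
    (at_right 0) (Rbar_locally p_infty).

Lemma seg_dir_bound u : norm (seg_dir u) <= (1 + M) * norm u.
Proof.
unfold seg_dir. eapply Rle_trans; [apply norm_minus_le|]. pose proof (HMA u). lra.
Qed.

Lemma res_segment_bound t s u : 0 <= t <= 1 -> 0 < s ->
  norm (seg_res t s (segment t u)) <= (1 + kap) * norm u.
Proof.
intros Ht Hs. rewrite res_segment by (now apply seg_dom_pos).
eapply Rle_trans; [apply norm_minus_le|].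
pose proof (norm_scal_pos s (seg_res t s u) ltac:(lra)).
pose proof (res_bound_le t s s u (seg_dom_pos t s Ht Hs) ltac:(lra)) as H1.
apply (Rmult_le_compat_l s) in H1; [|lra].
replace (s * (kap / s * norm u)) with (kap * norm u) in H1 by (field; lra). lra.
Qed.

Lemma seg_pow_half_line q t u : 0 < q < 1 -> 0 <= t <= 1 ->
  half_line (fun s => scal (Rpower s (q - 1)) (seg_res t s (segment t u))) (seg_pow q t u) /\
  norm (seg_pow q t u) <= (1 + kap) * (1 + M) * (/ q + / (1 - q)) * norm u.
Proof.
intros Hq Ht.
assert (HMk : 0 <= (1 + kap) * M) by (apply Rmult_le_pos; lra).
pose proof (norm_nonneg u) as Hu.
assert (HMu : 0 <= M * norm u) by (apply Rmult_le_pos; lra).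
assert (HMku : 0 <= (1 + kap) * M * norm u) by (apply Rmult_le_pos; lra).
destruct (half_line_weighted (fun s => seg_res t s (segment t u)) q ((1 + kap) * (1 + M) * norm
    u) 1)
  as [l [Hl Hb]]; trivial; try lra.
- intros s Hs. now apply continuous_res.
- apply Rmult_le_pos; lra.
- intros s Hs. eapply Rle_trans; [now apply res_segment_bound|]. lra.
- intros s Hs. eapply Rle_trans; [apply (res_bound_le t s s); [now apply seg_dom_pos|lra]|].
  pose proof (segment_bound M t u ltac:(lra) HMA Ht) as H1.
  apply (Rmult_le_compat_l (kap / s)) in H1; [|left; apply Rdiv_lt_0_compat; lra].
  eapply Rle_trans; [exact H1|].
  replace ((1 + kap) * (1 + M) * norm u * 1 / s)
      with (kap / s * ((1 + M) * norm u) + / s * ((1 + M) * norm u)) by (field; lra).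
  assert (0 <= / s * ((1 + M) * norm u)).
  { apply Rmult_le_pos; [left; now apply Rinv_0_lt_compat | lra]. }
  lra.
- replace (seg_pow q t u) with l by (symmetry; unfold seg_pow; now apply half_line_RInt_gen).
  split; trivial. eapply Rle_trans; [exact Hb|]. right.
  unfold Rpower. rewrite ln_1, Rmult_0_r, exp_0. ring.
Qed.

Definition pow_bound (q : R) : R := (1 + kap) * (1 + M) * (/ q + / (1 - q)).

Lemma pow_bound_pos q : 0 < q < 1 -> 0 < pow_bound q.
Proof.
intros Hq. unfold pow_bound. assert (0 < / q) by (apply Rinv_0_lt_compat; lra).
assert (0 < / (1 - q)) by (apply Rinv_0_lt_compat; lra).
apply Rmult_lt_0_compat; [apply Rmult_lt_0_compat|]; lra.
Qed.

Lemma seg_pow_bound q t u : 0 < q < 1 -> 0 <= t <= 1 ->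
  norm (seg_pow q t u) <= pow_bound q * norm u.
Proof. intros. now apply seg_pow_half_line. Qed.

Lemma seg_pow_linear q t : 0 < q < 1 -> 0 <= t <= 1 -> is_linear (seg_pow q t).
Proof.
intros Hq Ht.
split.
- intros x y. unfold seg_pow at 1. apply half_line_RInt_gen.
  eapply half_line_ext.
  2:{ apply half_line_plus; apply seg_pow_half_line; trivial. }
  intros s Hs. simpl. pose proof (seg_dom_pos t s Ht Hs).
  rewrite (linear_plus _ (segment_linear t)), (linear_plus _ (res_linear t s H)). module_ring.
- intros k x. unfold seg_pow at 1. apply half_line_RInt_gen.
  eapply half_line_ext.
  2:{ apply half_line_scal; apply (seg_pow_half_line q t x); trivial. }
  intros s Hs. simpl. pose proof (seg_dom_pos t s Ht Hs).
  rewrite (linear_scal _ (segment_linear t)), (linear_scal _ (res_linear t s H)). module_ring.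
- exists (pow_bound q). split; [now apply pow_bound_pos|]. intros x. now apply seg_pow_bound.
Qed.

Lemma seg_pow_commutes q t (L : X -> X) u : 0 < q < 1 -> 0 <= t <= 1 -> is_linear L ->
  (forall x, L (A x) = A (L x)) -> seg_pow q t (L u) = L (seg_pow q t u).
Proof.
intros Hq Ht HL HLA. unfold seg_pow at 1. apply half_line_RInt_gen.
eapply half_line_ext.
2:{ apply (half_line_linear L (fun s => scal (Rpower s (q - 1)) (seg_res t s (segment t u))) _
    HL).
  now apply seg_pow_half_line. }
intros s Hs. simpl. pose proof (seg_dom_pos t s Ht Hs).
rewrite (linear_scal _ HL). f_equal. rewrite <- (res_commutes t s L) by trivial. f_equal.
unfold segment. now rewrite (linear_plus _ HL), !(linear_scal _ HL), HLA.
Qed.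

(** The two integrands differ by [s] times a difference of resolvents. This is bounded by [2 kap]
    directly and by a multiple of [(1 - t) / s] through the resolvent identity; the crossover
    [1 - t] produces the rate [(1 - t)^q]. *)
Lemma seg_pow_end q t u : 0 < q < 1 -> 0 <= t < 1 ->
  norm (minus (seg_pow q t u) (seg_pow q 1 u)) <=
  (2 * kap + kap * (1 + M) * kap) * Rpower (1 - t) q * (/ q + / (1 - q)) * norm u.
Proof.
intros Hq Ht.
pose proof (norm_nonneg u) as Hu.
assert (HC1 : 0 <= 2 * kap * norm u) by (apply Rmult_le_pos; lra).
assert (HC2 : 0 <= kap * (1 + M) * kap * norm u).
{ repeat apply Rmult_le_pos; lra. }
destruct (half_line_weighted (fun s => minus (seg_res t s (segment t u)) (seg_res 1 s (segment 1
    u)))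
  q ((2 * kap + kap * (1 + M) * kap) * norm u) (1 - t)) as [l [Hl Hb]]; trivial; try lra.
- intros s Hs. apply (continuous_minus (K := R_AbsRing) (V := X)); apply continuous_res; lra.
- intros s Hs. rewrite !res_segment by (apply seg_dom_pos; lra).
  replace (minus (minus u (scal s (seg_res t s u))) (minus u (scal s (seg_res 1 s u))))
    with (scal s (minus (seg_res 1 s u) (seg_res t s u))) by module_ring.
  eapply Rle_trans; [apply norm_scal_pos; lra|].
  pose proof (norm_minus_le (seg_res 1 s u) (seg_res t s u)) as H1.
  pose proof (res_bound_le t s s u (seg_dom_pos t s ltac:(lra) Hs) ltac:(lra)) as H2.
  pose proof (res_bound_le 1 s s u (seg_dom_pos 1 s ltac:(lra) Hs) ltac:(lra)) as H3.
  apply Rle_trans with (s * (kap / s * norm u + kap / s * norm u)).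
  + apply Rmult_le_compat_l; lra.
  + replace (s * (kap / s * norm u + kap / s * norm u)) with (2 * kap * norm u) by (field;
      lra). lra.
- intros s Hs. rewrite !res_segment by (apply seg_dom_pos; lra).
  replace (minus (minus u (scal s (seg_res t s u))) (minus u (scal s (seg_res 1 s u))))
    with (scal s (minus (seg_res 1 s u) (seg_res t s u))) by module_ring.
  rewrite res_diff_t by (apply seg_dom_pos; lra).
  replace (scal s (scal (t - 1) (seg_res 1 s (seg_dir (seg_res t s u))))) with
    (opp (scal (s * (1 - t)) (seg_res 1 s (seg_dir (seg_res t s u))))) by module_ring.
  rewrite (norm_opp (K := R_AbsRing) (V := X)).
  eapply Rle_trans; [apply norm_scal_pos; apply Rmult_le_pos; lra|].
  pose proof (res_bound_le 1 s s (seg_dir (seg_res t s u)) (seg_dom_pos 1 s ltac:(lra) Hs)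
      ltac:(lra)) as H1.
  pose proof (seg_dir_bound (seg_res t s u)) as H2.
  pose proof (res_bound_le t s s u (seg_dom_pos t s ltac:(lra) Hs) ltac:(lra)) as H3.
  assert (Hks : 0 < kap / s) by (apply Rdiv_lt_0_compat; lra).
  assert (H4 : norm (seg_res 1 s (seg_dir (seg_res t s u))) <= kap / s * ((1 + M) * (kap / s *
      norm u))).
  { eapply Rle_trans; [exact H1|]. apply Rmult_le_compat_l; [lra|].
    eapply Rle_trans; [exact H2|]. apply Rmult_le_compat_l; lra. }
  apply (Rmult_le_compat_l (s * (1 - t))) in H4; [|apply Rmult_le_pos; lra].
  eapply Rle_trans; [exact H4|].
  replace (s * (1 - t) * (kap / s * ((1 + M) * (kap / s * norm u))))
    with ((1 - t) / s * (kap * (1 + M) * kap * norm u)) by (field; lra).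
  replace ((2 * kap + kap * (1 + M) * kap) * norm u * (1 - t) / s) with
    ((1 - t) / s * ((2 * kap + kap * (1 + M) * kap) * norm u)) by (field; lra).
  apply Rmult_le_compat_l; [|lra]. left. apply Rdiv_lt_0_compat; lra.
- assert (E : l = minus (seg_pow q t u) (seg_pow q 1 u)).
  { eapply half_line_unique; [exact Hl|].
    eapply half_line_ext.
    2:{ apply half_line_minus; apply seg_pow_half_line; lra. }
    intros s Hs. simpl. module_ring. }
  rewrite <- E. lra.
Qed.

Lemma seg_pow_0 q u : 0 < q < 1 -> seg_pow q 0 u = scal (beta_int q) u.
Proof.
intros Hq. unfold seg_pow at 1. apply half_line_RInt_gen.
eapply half_line_ext.
2:{ apply (half_line_linear (X := R_CompleteNormedModule) (fun k : R => scal k u)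
      (fun s => Rpower s (q - 1) * / (1 + s))).
    - exact (is_linear_scal_l (K := R_AbsRing) (V := X) u).
    - now apply beta_int_half_line. }
intros s Hs. cbv beta.
replace (seg_res 0 s (segment 0 u)) with (scal (/ (1 + s)) u).
- module_ring.
- symmetry. apply Q_l; try lra. unfold segment. module_eq; field; lra.
Qed.

(** The logarithmic derivative [A_t^-1 (A - I)] of the segment. Its bound degenerates as [t] tends
    to [1], which is why all comparisons are made on [[0, t1]] with [t1 < 1]. *)
Definition seg_gen (t : R) (u : X) : X := seg_res t 0 (seg_dir u).

Lemma seg_dom_0 t : 0 <= t < 1 -> seg_dom t 0.
Proof. intros; split; lra. Qed.

Lemma seg_gen_linear t : 0 <= t < 1 -> is_linear (seg_gen t).
Proof.
intros Ht. apply (is_linear_comp seg_dir (seg_res t 0));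
    [apply seg_dir_linear | apply res_linear, seg_dom_0, Ht].
Qed.

Lemma seg_gen_A t u : 0 <= t < 1 -> seg_gen t (A u) = A (seg_gen t u).
Proof.
intros Ht. unfold seg_gen. rewrite seg_dir_A. apply res_commutes; trivial.
now apply seg_dom_0.
Qed.

Lemma res_seg_dir t s u : seg_dom t s -> seg_res t s (seg_dir u) = seg_dir (seg_res t s u).
Proof. intros H. apply res_commutes; trivial; [apply seg_dir_linear | apply seg_dir_A]. Qed.

Lemma seg_gen_bound t t1 u : 0 <= t <= t1 -> t1 < 1 ->
  norm (seg_gen t u) <= kap / (1 - t1) * (1 + M) * norm u.
Proof.
intros Ht H1. unfold seg_gen.
eapply Rle_trans; [apply (res_bound_le t 0 (1 - t1)); [apply seg_dom_0|]; lra|].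
rewrite Rmult_assoc. apply Rmult_le_compat_l; [left; apply Rdiv_lt_0_compat; lra|].
apply seg_dir_bound.
Qed.

Lemma seg_gen_res_segment t s u : 0 <= t < 1 -> 0 < s ->
  seg_gen t (seg_res t s (segment t u)) = seg_res t s (seg_dir u).
Proof.
intros Ht Hs. pose proof (seg_dom_pos t s ltac:(lra) Hs) as Hd. pose proof (seg_dom_0 t Ht) as H0.
unfold seg_gen. rewrite <- res_seg_dir, res_res by trivial. f_equal.
rewrite res_seg_dir by trivial. f_equal. rewrite res_segment by trivial.
module_ring.
Qed.

(* Euler consistency in [t] of [(A_t)^q], where [A_t = (1 - t) I + t A], with the
   ordinary differential equation [y' = q (A - I) A_t^-1 y]. *)
Lemma seg_pow_euler q t1 : 0 < q < 1 -> 0 <= t1 < 1 ->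
  exists C, 0 <= C /\ forall u t t', 0 <= t <= t1 -> 0 <= t' <= t1 ->
    norm (minus (minus (seg_pow q t' u) (seg_pow q t u))
                (scal ((t' - t) * q) (seg_gen t (seg_pow q t u)))) <= C * (t' - t) ^ 2 * norm u.
Proof.
intros Hq Ht1.
assert (Hb0 : 0 < / q + / (1 - q)).
{ apply Rplus_lt_0_compat; apply Rinv_0_lt_compat; lra. }
set (d := 1 - t1). assert (Hd : 0 < d <= 1) by (unfold d; lra).
set (c := kap * (1 + M) * kap * (1 + M) * kap / d / d).
assert (Hc : 0 <= c).
{ unfold c. repeat (apply Rmult_le_pos; try lra); left; apply Rinv_0_lt_compat; lra. }
exists (c * (/ q + / (1 - q))). split; [apply Rmult_le_pos; lra|].
intros u t t' Ht Ht'.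
set (h := t' - t).
(* The exact second-order remainder of [t -> (A_t + s)^-1 A_t], whose derivative is
   [s R_s (A - I) R_s]. *)
set (rem := (fun s => opp (scal (h ^ 2 * s) (seg_res t' s (seg_dir (seg_res t s (seg_dir
    (seg_res t s u))))))) : R -> X).
pose proof (norm_nonneg u) as Hu.
pose proof (pow2_ge_0 h) as Hh.
assert (HR : forall r s e x, 0 <= r <= t1 -> 0 < s -> 0 < e <= d + s ->
   norm (seg_res r s x) <= kap / e * norm x).
{ intros r s e x Hr Hs He. apply res_bound_le; [apply seg_dom_pos; lra|]. unfold d in He. lra. }
(* One of the three resolvents absorbs the factor [s]. Bounding the other two by [kap / d] serves
   small [s]; bounding one of them by [kap / s] gives the decay needed at infinity. *)
assert (Hrem : forall s e1 e2, 0 < s -> 0 < e1 <= d + s -> 0 < e2 <= d + s ->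
   norm (rem s) <= h ^ 2 * (kap * (1 + M) * kap * (1 + M) * kap / e1 / e2) * norm u).
{ intros s e1 e2 Hs He1 He2. unfold rem. rewrite (norm_opp (K := R_AbsRing) (V := X)).
  eapply Rle_trans; [apply norm_scal_pos; apply Rmult_le_pos; lra|].
  assert (Hk : forall e, 0 < e -> 0 <= kap / e) by (intros e He; left; apply Rdiv_lt_0_compat;
      lra).
  replace (h ^ 2 * (kap * (1 + M) * kap * (1 + M) * kap / e1 / e2) * norm u) with
    (h ^ 2 * s * (kap / s * ((1 + M) * (kap / e1 * ((1 + M) * (kap / e2 * norm u))))))
        by (field; lra).
  apply Rmult_le_compat_l; [apply Rmult_le_pos; lra|].
  eapply Rle_trans; [apply (HR t' s s); lra|]. apply Rmult_le_compat_l; [apply Hk; lra|].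
  eapply Rle_trans; [apply seg_dir_bound|]. apply Rmult_le_compat_l; [lra|].
  eapply Rle_trans; [apply (HR t s e1); lra|]. apply Rmult_le_compat_l; [apply Hk; lra|].
  eapply Rle_trans; [apply seg_dir_bound|]. apply Rmult_le_compat_l; [lra|].
  apply (HR t s e2); lra. }
assert (Hid : forall s, 0 < s ->
   minus (minus (seg_res t' s (segment t' u)) (seg_res t s (segment t u)))
     (scal (h * s) (seg_res t s (seg_res t s (seg_dir u)))) = rem s).
{ intros s Hs. pose proof (seg_dom_pos t s ltac:(lra) Hs) as D.
  pose proof (seg_dom_pos t' s ltac:(lra) Hs) as D'.
  rewrite !res_segment by trivial.
  rewrite (res_seg_dir t s u) by trivial.
  pose proof (res_diff_t t t' s u D D') as E1.
  pose proof (res_diff_t t t' s (seg_dir (seg_res t s u)) D D') as E2.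
  unfold rem. transitivity (scal (h * s) (minus (seg_res t' s (seg_dir (seg_res t s u)))
      (seg_res t s (seg_dir (seg_res t s u))))).
  - transitivity (minus (scal (- s) (minus (seg_res t' s u) (seg_res t s u)))
      (scal (h * s) (seg_res t s (seg_dir (seg_res t s u))))); [module_ring|].
    rewrite E1. unfold h. module_ring.
  - rewrite E2. unfold h. module_ring. }
destruct (half_line_weighted rem q (h ^ 2 * c * norm u) 1) as [l [Hl Hb]]; trivial; try lra.
- intros s Hs.
  apply (continuous_ext_loc (T := R_UniformSpace) (U := X) rem (fun s => minus (minus (seg_res
      t' s (segment t' u)) (seg_res t s (segment t u)))
     (scal (h * s) (seg_res t s (seg_res t s (seg_dir u))))) s).
  + exists (mkposreal s Hs). intros x Hx. apply Hid.
    change (Rabs (x - s) < s) in Hx. apply Rabs_lt_between in Hx. lra.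
  + apply (continuous_minus (K := R_AbsRing) (V := X)).
    * apply (continuous_minus (K := R_AbsRing) (V := X)); apply continuous_res; lra.
    * apply (continuous_scal (K := R_AbsRing) (V := X)).
      -- apply (ex_derive_continuous (V := R_NormedModule)). auto_derive. trivial.
      -- apply continuous_res2; lra.
- apply Rmult_le_pos; [apply Rmult_le_pos|]; lra.
- intros s Hs. apply (Hrem s d d); lra.
- intros s Hs. eapply Rle_trans; [apply (Hrem s s d); lra|].
  replace (h ^ 2 * c * norm u * 1 / s)
      with (h ^ 2 * (kap * (1 + M) * kap * (1 + M) * kap / s / d) * norm u * / d)
    by (unfold c; field; lra).
  rewrite <- (Rmult_1_r (h ^ 2 * _ * _)) at 1. apply Rmult_le_compat_l.
  + apply Rmult_le_pos; trivial. apply Rmult_le_pos; trivial.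
    repeat (apply Rmult_le_pos; try lra); left; apply Rinv_0_lt_compat; lra.
  + rewrite <- Rinv_1. apply Rinv_le_contravar; lra.
- assert (E : l = minus (minus (seg_pow q t' u) (seg_pow q t u))
                (scal ((t' - t) * q) (seg_gen t (seg_pow q t u)))).
  { apply (half_line_unique _ _ _ Hl).
    (* The first-order term comes out as the integral of [s^q R_s R_s (A - I) u]. Integration by
       parts turns it into that of [q s^(q-1) R_s (A - I) u], which is [q] times [seg_gen t] applied
       to the power. *)
    pose proof (by_parts q t (seg_dir u) Hq ltac:(lra)) as BP.
    destruct (seg_pow_half_line q t u Hq ltac:(lra)) as [I0 _].
    destruct (seg_pow_half_line q t' u Hq ltac:(lra)) as [I1 _].
    pose proof (half_line_linear (seg_gen t) _ _ (seg_gen_linear t ltac:(lra)) I0) as I2.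
    pose proof (half_line_minus _ _ _ _ (half_line_minus _ _ _ _ I1 I0) (half_line_scal _ ((t' -
        t) * q) _ I2)) as I3.
    pose proof (half_line_plus _ _ _ _ I3 (half_line_scal _ h _ BP)) as I4.
    match type of I4 with is_RInt_gen ?f ?a ?b (plus ?l1 ?l2) =>
      assert (I5 : is_RInt_gen f a b l1) by
        (apply (eq_ind (plus l1 l2) (is_RInt_gen f a b) I4); module_ring) end.
    revert I5. apply half_line_ext. intros s Hs. cbv beta.
    rewrite (linear_scal _ (seg_gen_linear t ltac:(lra))), seg_gen_res_segment by lra.
    rewrite <- Hid by trivial.
    replace (Rpower s q) with (Rpower s (q - 1) * s).
    2:{ unfold Rminus. rewrite Rpower_plus, Rpower_Ropp, Rpower_1 by trivial. field. lra. }
    unfold h. module_ring. }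
  eapply Rle_trans; [right; apply f_equal; symmetry; exact E|].
  eapply Rle_trans; [exact Hb|]. right.
  unfold Rpower. rewrite ln_1, Rmult_0_r, exp_0. unfold h. ring.
Qed.

(** Stands for [y' = r (A - I) A_t^-1 y] on [[0, t1]]: consistency of the Euler step with a uniform
    quadratic error. It feeds directly into [gronwall_euler], and exponents [r] add under
    composition of powers. *)
Definition euler_solution (r t1 : R) (y : R -> X) : Prop :=
  exists C, 0 <= C /\ forall t t', 0 <= t <= t1 -> 0 <= t' <= t1 ->
    norm (minus (minus (y t') (y t)) (scal ((t' - t) * r) (seg_gen t (y t)))) <= C * (t' - t) ^ 2.

Lemma euler_solution_scal r t1 k y : t1 < 1 ->
  euler_solution r t1 y -> euler_solution r t1 (fun t => scal k (y t)).
Proof.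
intros H1 [C [HC H]]. exists (Rabs k * C). split.
{ apply Rmult_le_pos; trivial. apply Rabs_pos. }
intros t t' Ht Ht'. rewrite (linear_scal _ (seg_gen_linear t ltac:(lra))).
eapply Rle_trans with (norm (scal k (minus (minus (y t') (y t)) (scal ((t' - t) * r) (seg_gen t
    (y t)))))).
- right. f_equal. module_ring.
- eapply Rle_trans; [apply norm_scal_le|]. rewrite Rmult_assoc.
  apply Rmult_le_compat_l; [apply Rabs_pos | now apply H].
Qed.

(** The norm of [y1 - y2] satisfies the recursion of [gronwall_euler]: [seg_gen] is linear with
    bound [K] on [[0, t1]], and the two Euler errors add up. *)
Lemma euler_solution_unique r t1 y1 y2 : 0 <= r -> 0 <= t1 < 1 ->
  euler_solution r t1 y1 -> euler_solution r t1 y2 -> y1 0 = y2 0 -> y1 t1 = y2 t1.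
Proof.
intros Hr Ht1 [C1 [HC1 H1]] [C2 [HC2 H2]] H0.
set (K := kap / (1 - t1) * (1 + M)).
assert (HK : 0 <= K).
{ apply Rmult_le_pos; [|lra]. left. apply Rdiv_lt_0_compat; lra. }
assert (Hle : norm (minus (y1 t1) (y2 t1)) <= 0).
{ apply (gronwall_euler (fun t => norm (minus (y1 t) (y2 t))) t1 (r * K) (C1 + C2)); try lra.
  - now apply Rmult_le_pos.
  - rewrite H0. rewrite <- (norm_zero (K := R_AbsRing) (V := X)). f_equal. module_ring.
  - intros x y Hx Hy.
    specialize (H1 x y ltac:(lra) ltac:(lra)). specialize (H2 x y ltac:(lra) ltac:(lra)).
    set (e1 := minus (minus (y1 y) (y1 x)) (scal ((y - x) * r) (seg_gen x (y1 x))) : X) in *.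
    set (e2 := minus (minus (y2 y) (y2 x)) (scal ((y - x) * r) (seg_gen x (y2 x))) : X) in *.
    pose proof (seg_gen_bound x t1 (minus (y1 x) (y2 x)) ltac:(lra) ltac:(lra))
        as H3. fold K in H3.
    eapply Rle_trans with (norm (plus (plus (minus (y1 x) (y2 x)) (scal ((y - x) * r) (seg_gen x
        (minus (y1 x) (y2 x))))) (minus e1 e2))).
    { right. f_equal. rewrite (linear_minus _ _ _ (seg_gen_linear x ltac:(lra))). unfold e1,
        e2. module_ring. }
    eapply Rle_trans; [apply norm_plus_le|].
    pose proof (norm_plus_le (minus (y1 x) (y2 x)) (scal ((y - x) * r) (seg_gen x (minus (y1 x)
        (y2 x))))) as H4.
    pose proof (norm_minus_le e1 e2) as H5.
    assert (Hyx : 0 <= (y - x) * r) by (apply Rmult_le_pos; lra).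
    pose proof (norm_scal_pos ((y - x) * r) (seg_gen x (minus (y1 x) (y2 x))) Hyx) as H6.
    apply (Rmult_le_compat_l _ _ _ Hyx) in H3.
    set (a := norm (minus (y1 x) (y2 x))) in *.
    replace ((1 + r * K * (y - x)) * a) with (a + (y - x) * r * (K * a)) by ring.
    eapply Rle_trans; [exact (Rplus_le_compat _ _ _ _ H4 H5)|]. lra. }
assert (E : minus (y1 t1) (y2 t1) = zero).
{ apply (norm_eq_zero (K := R_AbsRing) (V := X)). apply Rle_antisym; trivial. apply norm_nonneg. }
transitivity (plus (minus (y1 t1) (y2 t1)) (y2 t1)); [module_ring|].
rewrite E. module_ring.
Qed.

Lemma euler_solution_segment t1 u : 0 <= t1 < 1 -> euler_solution 1 t1 (fun t => segment t u).
Proof.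
intros Ht1. exists 0. split; [lra|]. intros t t' Ht Ht'. rewrite Rmult_0_l. right.
assert (E : seg_gen t (segment t u) = seg_dir u).
{ unfold seg_gen. pose proof (seg_dom_0 t ltac:(lra)).
  rewrite res_seg_dir, res_segment by trivial. f_equal. module_ring. }
rewrite E. rewrite <- (norm_zero (K := R_AbsRing) (V := X)). f_equal.
unfold segment, seg_dir. module_ring.
Qed.

Lemma euler_solution_seg_pow q t1 u : 0 < q < 1 -> 0 <= t1 < 1 ->
  euler_solution q t1 (fun t => seg_pow q t u).
Proof.
intros Hq Ht1. destruct (seg_pow_euler q t1 Hq Ht1) as [C [HC H]].
exists (C * norm u). split; [apply Rmult_le_pos; trivial; apply norm_nonneg|].
intros t t' Ht Ht'. specialize (H u t t' Ht Ht'). lra.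
Qed.

(** The product rule. Both contributions have the same direction because [seg_pow] commutes with
    [seg_gen], so the exponents add. *)
Lemma euler_solution_comp p r t1 y : 0 < p < 1 -> 0 <= r -> 0 <= t1 < 1 ->
  euler_solution r t1 y -> euler_solution (p + r) t1 (fun t => seg_pow p t (y t)).
Proof.
intros Hp Hr Ht1 [C1 [HC1 H1]]. destruct (seg_pow_euler p t1 Hp Ht1) as [C2 [HC2 H2]].
set (K := kap / (1 - t1) * (1 + M)).
assert (HK : 0 <= K).
{ apply Rmult_le_pos; [|lra]. left. apply Rdiv_lt_0_compat; lra. }
(* An a priori bound for [y] on [[0, t1]], from a single Euler step starting at [0]. *)
set (N := norm (y 0) + (r * (K * norm (y 0)) + C1)).
assert (HKb : forall t u, 0 <= t <= t1 -> norm (seg_gen t u) <= K * norm u).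
{ intros t u Ht. apply seg_gen_bound; lra. }
clearbody K.
assert (Hlip : forall t t', 0 <= t <= t1 -> 0 <= t' <= t1 ->
   norm (minus (y t') (y t)) <= Rabs (t' - t) * (r * (K * norm (y t)) + C1)).
{ intros t t' Ht Ht'. pose proof (H1 t t' Ht Ht') as E.
  set (e := minus (minus (y t') (y t)) (scal ((t' - t) * r) (seg_gen t (y t))) : X) in *.
  replace (minus (y t') (y t)) with (plus (scal ((t' - t) * r) (seg_gen t (y t))) e)
    by (unfold e; module_ring).
  eapply Rle_trans; [apply norm_plus_le|].
  pose proof (norm_scal_le ((t' - t) * r) (seg_gen t (y t))) as E2.
  rewrite Rabs_mult, (Rabs_pos_eq r) in E2 by lra.
  pose proof (Rabs_pos (t' - t)) as Hh.
  pose proof (Rmult_le_compat_l (Rabs (t' - t) * r) _ _ ltac:(now apply Rmult_le_pos) (HKb t (y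
      t) Ht)) as E3.
  rewrite <- (pow2_abs (t' - t)) in E.
  assert (Rabs (t' - t) <= 1) by (apply Rabs_le; lra).
  assert (C1 * Rabs (t' - t) ^ 2 <= C1 * Rabs (t' - t)).
  { apply Rmult_le_compat_l; trivial. simpl. rewrite Rmult_1_r.
    rewrite <- (Rmult_1_r (Rabs (t' - t))) at 3. now apply Rmult_le_compat_l. }
  lra. }
pose proof (norm_nonneg (y 0)) as Hy0.
assert (HN0 : 0 <= r * (K * norm (y 0)) + C1).
{ apply Rplus_le_le_0_compat; trivial. repeat apply Rmult_le_pos; trivial. }
assert (HN : forall t, 0 <= t <= t1 -> norm (y t) <= N).
{ intros t Ht. pose proof (Hlip 0 t ltac:(lra) Ht) as E.
  pose proof (norm_plus_le (y 0) (minus (y t) (y 0))) as E2.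
  replace (plus (y 0) (minus (y t) (y 0))) with (y t) in E2 by module_ring.
  assert (Rabs (t - 0) <= 1) by (apply Rabs_le; lra).
  assert (Rabs (t - 0) * (r * (K * norm (y 0)) + C1) <= 1 * (r * (K * norm (y 0)) + C1))
    by (now apply Rmult_le_compat_r).
  unfold N. lra. }
assert (HNp : 0 <= N) by (unfold N; lra).
clearbody N.
assert (HPb : exists P, 0 < P /\ forall t u, 0 <= t <= 1 -> norm (seg_pow p t u) <= P * norm u).
{ exists (pow_bound p). split; [now apply pow_bound_pos|]. intros. now apply seg_pow_bound. }
destruct HPb as [P [HP HPb]].
exists (C2 * N + P * C1 + p * (K * (P * (r * (K * N) + C1)))).
assert (HrKN : 0 <= r * (K * N) + C1).
{ apply Rplus_le_le_0_compat; trivial. repeat apply Rmult_le_pos; trivial. }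
split.
{ repeat apply Rplus_le_le_0_compat; repeat apply Rmult_le_pos; trivial; lra. }
intros t t' Ht Ht'.
pose proof (seg_pow_linear p t' Hp ltac:(lra)) as L'.
pose proof (seg_pow_linear p t Hp ltac:(lra)) as L.
pose proof (seg_gen_linear t ltac:(lra)) as LG.
set (h := t' - t) in *.
set (e1 := minus (minus (seg_pow p t' (y t')) (seg_pow p t (y t'))) (scal (h * p) (seg_gen t
    (seg_pow p t (y t')))) : X).
set (e2 := minus (minus (y t') (y t)) (scal (h * r) (seg_gen t (y t))) : X).
set (e3 := seg_gen t (seg_pow p t (minus (y t') (y t))) : X).
assert (E : minus (minus (seg_pow p t' (y t')) (seg_pow p t (y t)))
        (scal (h * (p + r)) (seg_gen t (seg_pow p t (y t)))) =
        plus (plus e1 (seg_pow p t e2)) (scal (h * p) e3)).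
{ unfold e1, e2, e3. rewrite !(linear_minus _ _ _ L), (linear_scal _ L), (linear_minus _ _ _ LG).
  rewrite (seg_pow_commutes p t (seg_gen t) (y t)); trivial; [|lra|intros; apply seg_gen_A; lra].
  module_ring. }
eapply Rle_trans; [right; apply f_equal; exact E|].
eapply Rle_trans; [apply norm_plus_le|].
pose proof (norm_plus_le e1 (seg_pow p t e2)) as B0.
assert (B1 : norm e1 <= C2 * h ^ 2 * N).
{ eapply Rle_trans; [apply H2; trivial|]. apply Rmult_le_compat_l; [|now apply HN].
  apply Rmult_le_pos; trivial. apply pow2_ge_0. }
assert (B2 : norm (seg_pow p t e2) <= P * (C1 * h ^ 2)).
{ eapply Rle_trans; [apply HPb; lra|].
  apply Rmult_le_compat_l; [lra|]. now apply H1. }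
assert (B3 : norm e3 <= K * (P * (Rabs h * (r * (K * N) + C1)))).
{ unfold e3. eapply Rle_trans; [now apply HKb|]. apply Rmult_le_compat_l; trivial.
  eapply Rle_trans; [apply HPb; lra|].
  apply Rmult_le_compat_l; [lra|]. eapply Rle_trans; [now apply Hlip|].
  apply Rmult_le_compat_l; [apply Rabs_pos|]. apply Rplus_le_compat_r.
  repeat apply Rmult_le_compat_l; trivial. now apply HN. }
pose proof (norm_scal_le (h * p) e3) as B4. rewrite Rabs_mult, (Rabs_pos_eq p) in B4 by lra.
pose proof (Rmult_le_compat_l (Rabs h * p) _ _ ltac:(apply Rmult_le_pos;
    [apply Rabs_pos|lra]) B3) as B5.
rewrite <- (pow2_abs h) in *. lra.
Qed.

Lemma zero_of_norm_le_Rpower (z : X) (C r : R) : 0 < r ->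
  (forall e, 0 < e <= 1 -> norm z <= C * Rpower e r) -> z = zero.
Proof.
intros Hr H. apply (zero_of_norm_le z (Rabs C)). intros e He.
destruct (Rpower_0_lim r Hr e He) as [d [Hd Hd']].
assert (Hm : 0 < Rmin d 1) by (apply Rmin_glb_lt; lra).
pose proof (Rmin_l d 1). pose proof (Rmin_r d 1).
eapply Rle_trans; [apply (H (Rmin d 1 / 2)); lra|].
pose proof (Rpower_pos (Rmin d 1 / 2) r).
apply Rle_trans with (Rabs C * Rpower (Rmin d 1 / 2) r).
- apply Rmult_le_compat_r; [lra|]. apply Rle_abs.
- apply Rmult_le_compat_l; [apply Rabs_pos|]. left. apply Hd'. lra.
Qed.

Lemma Rpower_le_exponent e a b : 0 < e <= 1 -> a <= b -> Rpower e b <= Rpower e a.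
Proof.
intros He Hab. unfold Rpower. apply exp_le_compat.
assert (ln e <= 0) by (rewrite <- ln_1; apply ln_le; lra).
rewrite !(Rmult_comm _ (ln e)). now apply Rmult_le_compat_neg_l.
Qed.

(** Only one factor is moved to [t = 1] at a time, and the bound of [seg_pow p t] is uniform in [t].
    Since [1 - t <= 1], the smaller exponent dominates both rates. *)
Lemma seg_pow_comp_end p q u : 0 < p < 1 -> 0 < q < 1 ->
  exists C, forall t, 0 <= t < 1 ->
    norm (minus (seg_pow p t (seg_pow q t u)) (seg_pow p 1 (seg_pow q 1 u))) <=
    C * Rpower (1 - t) (Rmin p q).
Proof.
intros Hp Hq.
set (K := 2 * kap + kap * (1 + M) * kap).
assert (HK : 0 <= K).
{ unfold K. apply Rplus_le_le_0_compat; repeat apply Rmult_le_pos; lra. }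
assert (Hi : forall r, 0 < r < 1 -> 0 <= / r + / (1 - r)).
{ intros r Hr. apply Rplus_le_le_0_compat; left; apply Rinv_0_lt_compat; lra. }
pose proof (pow_bound_pos p Hp) as HP.
exists (pow_bound p * (K * (/ q + / (1 - q)) * norm u) + K * (/ p + / (1 - p)) * norm (seg_pow q
    1 u)).
intros t Ht.
assert (HE : forall r w, 0 < r < 1 -> Rmin p q <= r ->
  norm (minus (seg_pow r t w) (seg_pow r 1 w)) <= K * (/ r + / (1 - r)) * norm w * Rpower (1 -
      t) (Rmin p q)).
{ intros r w Hr Hm. eapply Rle_trans; [now apply seg_pow_end|]. fold K.
  pose proof (Rpower_le_exponent (1 - t) _ _ ltac:(lra) Hm) as H1.
  replace (K * Rpower (1 - t) r * (/ r + / (1 - r)) * norm w) with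
    (K * (/ r + / (1 - r)) * norm w * Rpower (1 - t) r) by ring.
  apply Rmult_le_compat_l; trivial. apply Rmult_le_pos; [|apply norm_nonneg].
  apply Rmult_le_pos; trivial. now apply Hi. }
replace (minus (seg_pow p t (seg_pow q t u)) (seg_pow p 1 (seg_pow q 1 u))) with
  (plus (seg_pow p t (minus (seg_pow q t u) (seg_pow q 1 u)))
        (minus (seg_pow p t (seg_pow q 1 u)) (seg_pow p 1 (seg_pow q 1 u)))).
2:{ rewrite (linear_minus _ _ _ (seg_pow_linear p t Hp ltac:(lra))). module_ring. }
eapply Rle_trans; [apply norm_plus_le|].
pose proof (HE p (seg_pow q 1 u) Hp (Rmin_l _ _)) as B1.
pose proof (HE q u Hq (Rmin_r _ _)) as B2.
pose proof (seg_pow_bound p t (minus (seg_pow q t u) (seg_pow q 1 u)) Hp ltac:(lra)) as B3.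
apply (Rmult_le_compat_l (pow_bound p)) in B2; [|lra]. lra.
Qed.

(** The crossed factors make the initial values agree: at [t = 0] both sides equal [beta_int p *
    beta_int q * beta_int (p + q)] times [u]. Both solve the equation of exponent [p + q] up to
    [1 - e], and [e] tends to [0]. *)
Lemma seg_pow_mul p q u : 0 < p -> 0 < q -> p + q < 1 ->
  scal (beta_int (p + q)) (seg_pow p 1 (seg_pow q 1 u)) =
  scal (beta_int p * beta_int q) (seg_pow (p + q) 1 u).
Proof.
intros Hp Hq Hpq.
destruct (seg_pow_comp_end p q u ltac:(lra) ltac:(lra)) as [C HC].
set (K := (2 * kap + kap * (1 + M) * kap) * (/ (p + q) + / (1 - (p + q))) * norm u).
assert (E : minus (scal (beta_int (p + q)) (seg_pow p 1 (seg_pow q 1 u)))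
  (scal (beta_int p * beta_int q) (seg_pow (p + q) 1 u)) = zero).
{ apply (zero_of_norm_le_Rpower _ (Rabs (beta_int (p + q)) * C + Rabs (beta_int p * beta_int q)
    * K) (Rmin p q)).
  { apply Rmin_glb_lt; lra. }
  intros e He. pose proof (HC (1 - e) ltac:(lra)) as B1.
  pose proof (seg_pow_end (p + q) (1 - e) u ltac:(lra) ltac:(lra)) as B2.
  replace (1 - (1 - e)) with e in B1, B2 by ring.
  assert (B3 : norm (minus (seg_pow (p + q) (1 - e) u) (seg_pow (p + q) 1 u)) <= K * Rpower e
      (Rmin p q)).
  { eapply Rle_trans; [exact B2|].
    pose proof (Rpower_le_exponent e (Rmin p q) (p + q) He ltac:(pose proof (Rmin_l p q);
        lra)) as H1.
    apply (Rmult_le_compat_l K) in H1.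
    - unfold K in *. lra.
    - unfold K. repeat (apply Rmult_le_pos || apply Rplus_le_le_0_compat); try lra;
        try apply norm_nonneg;
      left; apply Rinv_0_lt_compat; lra. }
  assert (E0 : scal (beta_int (p + q)) (seg_pow p (1 - e) (seg_pow q (1 - e) u)) =
    scal (beta_int p * beta_int q) (seg_pow (p + q) (1 - e) u)).
  { apply (euler_solution_unique (p + q) (1 - e)
      (fun t => scal (beta_int (p + q)) (seg_pow p t (seg_pow q t u)))
      (fun t => scal (beta_int p * beta_int q) (seg_pow (p + q) t u))); try lra.
    - apply euler_solution_scal; [lra|]. apply (euler_solution_comp p q); try lra.
      apply euler_solution_seg_pow; lra.
    - apply euler_solution_scal; [lra|]. apply euler_solution_seg_pow; lra.
    - rewrite !seg_pow_0 by lra. module_ring. }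
  set (x1 := seg_pow p 1 (seg_pow q 1 u)) in *. set (x2 := seg_pow (p + q) 1 u) in *.
  set (z1 := seg_pow p (1 - e) (seg_pow q (1 - e) u)) in *. set (z2 := seg_pow (p + q) (1 - e)
      u) in *.
  eapply Rle_trans with (norm (minus (scal (beta_int p * beta_int q) (minus z2 x2)) (scal
      (beta_int (p + q)) (minus z1 x1)))).
  { right. f_equal. transitivity (plus (minus (scal (beta_int p * beta_int q) z2) (scal
      (beta_int (p + q)) z1))
     (minus (scal (beta_int (p + q)) x1) (scal (beta_int p * beta_int q) x2))); [rewrite E0|];
         module_ring. }
  eapply Rle_trans; [apply norm_minus_le|].
  pose proof (norm_scal_le (beta_int p * beta_int q) (minus z2 x2)) as B4.
  pose proof (norm_scal_le (beta_int (p + q)) (minus z1 x1)) as B5.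
  apply (Rmult_le_compat_l _ _ _ (Rabs_pos (beta_int p * beta_int q))) in B3.
  apply (Rmult_le_compat_l _ _ _ (Rabs_pos (beta_int (p + q)))) in B1. lra. }
transitivity (plus (minus (scal (beta_int (p + q)) (seg_pow p 1 (seg_pow q 1 u)))
  (scal (beta_int p * beta_int q) (seg_pow (p + q) 1 u))) (scal (beta_int p * beta_int q)
      (seg_pow (p + q) 1 u))).
- module_ring.
- rewrite E. module_ring.
Qed.

Lemma seg_pow_mul_1 p q u : 0 < p -> 0 < q -> p + q = 1 ->
  seg_pow p 1 (seg_pow q 1 u) = scal (beta_int p * beta_int q) (A u).
Proof.
intros Hp Hq Hpq.
destruct (seg_pow_comp_end p q u ltac:(lra) ltac:(lra)) as [C HC].
set (b := beta_int p * beta_int q).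
assert (E : minus (seg_pow p 1 (seg_pow q 1 u)) (scal b (A u)) = zero).
{ apply (zero_of_norm_le_Rpower _ (C + Rabs b * ((1 + M) * norm u)) (Rmin p q)).
  { apply Rmin_glb_lt; lra. }
  intros e He. pose proof (HC (1 - e) ltac:(lra)) as B1.
  replace (1 - (1 - e)) with e in B1 by ring.
  pose proof (seg_dir_bound u) as B2.
  assert (E0 : seg_pow p (1 - e) (seg_pow q (1 - e) u) = scal b (segment (1 - e) u)).
  { apply (euler_solution_unique 1 (1 - e)
      (fun t => seg_pow p t (seg_pow q t u)) (fun t => scal b (segment t u))); try lra.
    - rewrite <- Hpq. apply (euler_solution_comp p q); try lra.
      apply euler_solution_seg_pow; lra.
    - apply euler_solution_scal; [lra|]. apply euler_solution_segment; lra.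
    - rewrite !seg_pow_0 by lra. unfold segment, b. module_ring. }
  set (x1 := seg_pow p 1 (seg_pow q 1 u)) in *.
  rewrite E0 in B1.
  eapply Rle_trans with (norm (minus (scal (- (b * e)) (seg_dir u)) (minus (scal b (segment (1 -
      e) u)) x1))).
  { right. f_equal. unfold segment, seg_dir. module_ring. }
  eapply Rle_trans; [apply norm_minus_le|].
  pose proof (norm_scal_le (- (b * e)) (seg_dir u)) as B3.
  rewrite Rabs_Ropp, Rabs_mult, (Rabs_pos_eq e) in B3 by lra.
  pose proof (Rpower_le_exponent e (Rmin p q) 1 He ltac:(pose proof (Rmin_l p q); lra)) as H1.
  rewrite Rpower_1 in H1 by lra.
  assert (Rabs b * e * norm (seg_dir u) <= Rabs b * Rpower e (Rmin p q) * ((1 + M) * norm u)).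
  { apply Rmult_le_compat; trivial.
    - apply Rmult_le_pos; [apply Rabs_pos|lra].
    - apply norm_nonneg.
    - apply Rmult_le_compat_l; [apply Rabs_pos|exact H1]. }
  eapply Rle_trans; [exact (Rplus_le_compat _ _ _ _ B3 B1)|]. lra. }
transitivity (plus (minus (seg_pow p 1 (seg_pow q 1 u)) (scal b (A u))) (scal b (A u))).
- module_ring.
- rewrite E. module_ring.
Qed.

End Resolvent.

(** * The reflection formula for the normalising integral *)

Definition plane : CompleteNormedModule R_AbsRing := C_R_CompleteNormedModule.

Definition pt (x y : R) : plane := (x, y).

Lemma plane_norm_le (z : plane) : norm z <= Rabs (fst z) + Rabs (snd z).
Proof.
assert (E : norm z = norm (plus (pt (fst z) 0) (pt 0 (snd z)))).
{ f_equal. destruct z as [x y]. unfold pt. simpl. unfold plus; simpl. unfold prod_plus; simpl.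
  unfold plus; simpl. f_equal; ring. }
rewrite E. eapply Rle_trans; [apply norm_plus_le|]. apply Rplus_le_compat.
- change (sqrt (Rabs (fst z) ^ 2 + Rabs 0 ^ 2) <= Rabs (fst z)).
  rewrite Rabs_R0. replace (Rabs (fst z) ^ 2 + 0 ^ 2) with (Rabs (fst z) ^ 2) by ring.
  rewrite sqrt_pow2; [apply Rle_refl | apply Rabs_pos].
- change (sqrt (Rabs 0 ^ 2 + Rabs (snd z) ^ 2) <= Rabs (snd z)).
  rewrite Rabs_R0. replace (0 ^ 2 + Rabs (snd z) ^ 2) with (Rabs (snd z) ^ 2) by ring.
  rewrite sqrt_pow2; [apply Rle_refl | apply Rabs_pos].
Qed.

Lemma plane_norm_ge (z : plane) : Rabs (fst z) <= norm z /\ Rabs (snd z) <= norm z.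
Proof.
change (Rabs (fst z) <= sqrt (Rabs (fst z) ^ 2 + Rabs (snd z) ^ 2) /\
        Rabs (snd z) <= sqrt (Rabs (fst z) ^ 2 + Rabs (snd z) ^ 2)).
pose proof (pow2_ge_0 (Rabs (fst z))). pose proof (pow2_ge_0 (Rabs (snd z))).
split.
- rewrite <- (sqrt_pow2 (Rabs (fst z))) at 1 by apply Rabs_pos. apply sqrt_le_1_alt. lra.
- rewrite <- (sqrt_pow2 (Rabs (snd z))) at 1 by apply Rabs_pos. apply sqrt_le_1_alt. lra.
Qed.

(* Multiplication by the imaginary unit on [C], as a real normed space, and [(a + b i)^-1]. *)
Definition rot (z : plane) : plane := pt (- snd z) (fst z).

Definition rot_res (a b : R) (z : plane) : plane :=
  pt ((a * fst z + b * snd z) / (a * a + b * b)) ((a * snd z - b * fst z) / (a * a + b * b)).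

Ltac plane_eq :=
  unfold rot, rot_res, pt; simpl; unfold plus, minus, opp, scal; simpl;
  unfold prod_plus, prod_scal, plus, minus, opp, scal, mult; simpl;
  try (apply injective_projections; simpl);
  repeat (unfold mult, plus, opp; simpl);
  match goal with |- @eq _ ?a ?b => change (@eq R a b) end.

Lemma rot_bound (z : plane) : norm (rot z) <= 2 * norm z.
Proof.
eapply Rle_trans; [apply plane_norm_le|]. unfold rot, pt; simpl. rewrite Rabs_Ropp.
pose proof (plane_norm_ge z). lra.
Qed.

Lemma rot_linear : is_linear rot.
Proof.
split.
- intros x y. plane_eq; ring.
- intros k x. plane_eq; ring.
- exists 2. split; [lra|]. exact rot_bound.
Qed.

(** Both [a / (a^2 + b^2)] and [b / (a^2 + b^2)] are at most [1 / a], so each coordinate is at most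
    [2 / a] times the norm; two coordinates give [4]. *)
Lemma rot_resolvent : resolvent_family rot rot_res 4.
Proof.
intros a b Ha Hb.
assert (HD : 0 < a * a + b * b).
{ apply Rplus_lt_le_0_compat; [now apply Rmult_lt_0_compat | apply Rmult_le_pos; lra]. }
split; [|split].
- intros y. plane_eq; field; lra.
- intros y. plane_eq; field; lra.
- intros y. eapply Rle_trans; [apply plane_norm_le|]. unfold rot_res, pt; simpl.
  pose proof (plane_norm_ge y) as [H1 H2].
  assert (Ha' : a / (a * a + b * b) <= / a).
  { apply Rmult_le_reg_r with (a * (a * a + b * b)); [now apply Rmult_lt_0_compat|].
    replace (a / (a * a + b * b) * (a * (a * a + b * b))) with (a * a) by (field; lra).
    replace (/ a * (a * (a * a + b * b))) with (a * a + b * b) by (field; lra).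
    pose proof (Rmult_le_pos b b ltac:(lra) ltac:(lra)). lra. }
  assert (Hb' : b / (a * a + b * b) <= / a).
  { apply Rmult_le_reg_r with (a * (a * a + b * b)); [now apply Rmult_lt_0_compat|].
    replace (b / (a * a + b * b) * (a * (a * a + b * b))) with (a * b) by (field; lra).
    replace (/ a * (a * (a * a + b * b))) with (a * a + b * b) by (field; lra).
    pose proof (Rle_0_sqr (a - b)) as Hs. unfold Rsqr in Hs.
    pose proof (Rmult_le_pos a b ltac:(lra) ltac:(lra)). lra. }
  assert (HA : 0 <= a / (a * a + b * b)) by (apply Rdiv_le_0_compat; lra).
  assert (HB : 0 <= b / (a * a + b * b)) by (apply Rdiv_le_0_compat; lra).
  assert (Hi : 0 < / a) by now apply Rinv_0_lt_compat.
  assert (K : forall x y', Rabs x <= norm y -> Rabs y' <= norm y ->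
     Rabs (a / (a * a + b * b) * x + b / (a * a + b * b) * y') <= / a * norm y + / a * norm y).
  { intros x y' Hx Hy. eapply Rle_trans; [apply Rabs_triang|]. rewrite !Rabs_mult.
    rewrite (Rabs_pos_eq (a / _)), (Rabs_pos_eq (b / _)) by trivial.
    apply Rplus_le_compat; apply Rmult_le_compat; trivial; apply Rabs_pos. }
  pose proof (K (fst y) (snd y) H1 H2) as K1.
  pose proof (K (snd y) (- fst y) H2) as K2. rewrite Rabs_Ropp in K2. specialize (K2 H1).
  replace ((a * fst y + b * snd y) / (a * a + b * b)) with
    (a / (a * a + b * b) * fst y + b / (a * a + b * b) * snd y) by (field; lra).
  replace ((a * snd y - b * fst y) / (a * a + b * b)) with
    (a / (a * a + b * b) * snd y + b / (a * a + b * b) * - fst y) by (field; lra).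
  unfold Rdiv at 5. lra.
Qed.

Lemma taylor_1 (f f1 f2 : R -> R) (a b C : R) :
  (forall t, a <= t <= b -> is_derive f t (f1 t)) ->
  (forall t, a <= t <= b -> is_derive f1 t (f2 t)) ->
  (forall t, a <= t <= b -> Rabs (f2 t) <= C) ->
  forall t t', a <= t <= b -> a <= t' <= b ->
  Rabs (f t' - f t - (t' - t) * f1 t) <= C * (t' - t) ^ 2.
Proof.
intros H1 H2 HC t t' Ht Ht'.
assert (Hin : forall u v x, a <= u <= b -> a <= v <= b -> Rmin u v <= x <= Rmax u v ->
    a <= x <= b).
{ intros u v x Hu Hv [Hx1 Hx2]. split.
  - eapply Rle_trans; [|exact Hx1]. apply Rmin_glb; lra.
  - eapply Rle_trans; [exact Hx2|]. apply Rmax_lub; lra. }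
assert (HM : forall g g1, (forall t, a <= t <= b -> is_derive g t (g1 t)) ->
  forall u v, a <= u <= b -> a <= v <= b ->
  exists c, Rmin u v <= c <= Rmax u v /\ g v - g u = g1 c * (v - u)).
{ intros g g1 Hg u v Hu Hv. apply (MVT_gen g u v g1).
  - intros x Hx. apply Hg. apply (Hin u v); trivial; lra.
  - intros x Hx. apply derivable_continuous_pt. exists (g1 x).
    apply is_derive_Reals. apply Hg. now apply (Hin u v). }
destruct (HM f f1 H1 t t' Ht Ht') as [c [Hc E1]].
pose proof (Hin t t' c Ht Ht' Hc) as Hcab.
destruct (HM f1 f2 H2 t c Ht Hcab) as [d [Hd E2]].
pose proof (Hin t c d Ht Hcab Hd) as Hdab.
replace (f t' - f t - (t' - t) * f1 t) with ((f1 c - f1 t) * (t' - t)) by (rewrite E1; ring).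
rewrite E2, !Rabs_mult.
assert (Hct : Rabs (c - t) <= Rabs (t' - t)).
{ revert Hc. unfold Rmin, Rmax. destruct (Rle_dec t t'); intros Hc.
  - rewrite !Rabs_pos_eq; lra.
  - rewrite !Rabs_left1; lra. }
rewrite <- (pow2_abs (t' - t)).
replace (C * Rabs (t' - t) ^ 2) with (C * Rabs (t' - t) * Rabs (t' - t)) by ring.
apply Rmult_le_compat_r; [apply Rabs_pos|].
apply Rmult_le_compat; try apply Rabs_pos; trivial. now apply HC.
Qed.

Lemma bounded_on_segment (f : R -> R) (a b : R) :
  (forall x, a <= x <= b -> ex_derive f x) ->
  exists C, 0 <= C /\ forall x, a <= x <= b -> Rabs (f x) <= C.
Proof.
intros H. destruct (bounded_continuity (K := R_AbsRing) (V := R_NormedModule) f a b) as [C HC].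
- intros x Hx. apply (ex_derive_continuous (V := R_NormedModule)). now apply H.
- exists (Rabs C). split; [apply Rabs_pos|]. intros x Hx. left.
  eapply Rlt_le_trans; [now apply HC | apply Rle_abs].
Qed.

(** The squared modulus of [(1 - t) + t i], the point of the segment from [1] to [i]. *)
Definition seg_norm2 (t : R) : R := (1 - t) ^ 2 + t ^ 2.

Lemma seg_norm2_pos t : 0 < seg_norm2 t.
Proof.
unfold seg_norm2. pose proof (pow2_ge_0 (2 * t - 1)).
replace ((1 - t) ^ 2 + t ^ 2) with ((1 + (2 * t - 1) ^ 2) / 2) by field. lra.
Qed.

Lemma is_derive_seg_norm2 t : is_derive seg_norm2 t (4 * t - 2).
Proof. unfold seg_norm2. auto_derive; trivial. ring. Qed.

(** * Explicit powers of the quarter turn *)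

Section RotationPower.

Context (q : R) (Hq : 0 < q < 1).

(** The argument of [(1 - t) + t i] is [atan (t / (1 - t))]; the addition formula rewrites it as
    [PI / 4 + atan (2 t - 1)], which is smooth up to [t = 1]. So [re + i im] is the principal power
    of order [q]. *)
Let angle (t : R) : R := q * (PI / 4 + atan (2 * t - 1)).
Let modulus (t : R) : R := exp (q / 2 * ln (seg_norm2 t)).
Let re (t : R) : R := modulus t * cos (angle t).
Let im (t : R) : R := modulus t * sin (angle t).
(** Coordinates of [q (i - 1) / ((1 - t) + t i)] times the power, using [(i - 1) / ((1 - t) + t i) =
    ((2 t - 1) + i) / seg_norm2 t]. *)
Let dre (t : R) : R := q * ((2 * t - 1) * re t - im t) / seg_norm2 t.
Let dim (t : R) : R := q * ((2 * t - 1) * im t + re t) / seg_norm2 t.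

Lemma is_derive_angle t : is_derive angle t (q / seg_norm2 t).
Proof.
pose proof (seg_norm2_pos t) as HN. unfold angle.
evar_last.
- apply (is_derive_scal (fun t => PI / 4 + atan (2 * t - 1))).
  apply (is_derive_plus (K := R_AbsRing) (V := R_NormedModule) (fun _ => PI / 4) (fun t => atan
      (2 * t - 1))).
  + apply is_derive_const.
  + apply (is_derive_comp (K := R_AbsRing) (V := R_NormedModule) atan (fun t => 2 * t - 1)).
    * apply is_derive_atan.
    * instantiate (1 := 2). auto_derive; trivial. ring.
- unfold plus, zero, scal, Rsqr; simpl. unfold mult; simpl.
  unfold seg_norm2 in *. field. split; [lra|].
  replace (1 + (2 * t - 1) * (2 * t - 1)) with (2 * ((1 - t) ^ 2 + t ^ 2)) by ring. lra.
Qed.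

Lemma is_derive_modulus t : is_derive modulus t (q * (2 * t - 1) / seg_norm2 t * modulus t).
Proof.
pose proof (seg_norm2_pos t) as HN. pose proof (is_derive_seg_norm2 t) as Hd. unfold modulus.
auto_derive.
- split; [eexists; exact Hd | split; trivial].
- replace (Derive (fun x => seg_norm2 x) t) with (4 * t - 2) by (symmetry;
    now apply is_derive_unique).
  field. lra.
Qed.

Lemma is_derive_re t : is_derive re t (dre t).
Proof.
pose proof (seg_norm2_pos t) as HN. pose proof (is_derive_angle t)
    as Ha. pose proof (is_derive_modulus t) as Hm.
unfold dre, re, im.
evar_last.
- apply (is_derive_mult modulus (fun t => cos (angle t))); [exact Hm| |intros; apply Rmult_comm].
  apply (is_derive_comp (K := R_AbsRing) (V := R_NormedModule) cos angle);
      [apply is_derive_cos | exact Ha].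
- unfold plus, scal, mult; simpl. unfold mult; simpl. field. lra.
Qed.

Lemma is_derive_im t : is_derive im t (dim t).
Proof.
pose proof (seg_norm2_pos t) as HN. pose proof (is_derive_angle t)
    as Ha. pose proof (is_derive_modulus t) as Hm.
unfold dim, re, im.
evar_last.
- apply (is_derive_mult modulus (fun t => sin (angle t))); [exact Hm| |intros; apply Rmult_comm].
  apply (is_derive_comp (K := R_AbsRing) (V := R_NormedModule) sin angle);
      [apply is_derive_sin | exact Ha].
- unfold plus, scal, mult; simpl. unfold mult; simpl. field. lra.
Qed.

Let ddre (t : R) : R := q * ((2 * re t + (2 * t - 1) * dre t - dim t) * seg_norm2 t
  - ((2 * t - 1) * re t - im t) * (4 * t - 2)) / seg_norm2 t ^ 2.
Let ddim (t : R) : R := q * ((2 * im t + (2 * t - 1) * dim t + dre t) * seg_norm2 t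
  - ((2 * t - 1) * im t + re t) * (4 * t - 2)) / seg_norm2 t ^ 2.

(** The common shape of [dre], with [g = - im], and of [dim], with [g = re]. *)
Lemma is_derive_quotient (f g : R -> R) t df dg : is_derive f t df -> is_derive g t dg ->
  is_derive (fun t => q * ((2 * t - 1) * f t + g t) / seg_norm2 t) t
    (q * ((2 * f t + (2 * t - 1) * df + dg) * seg_norm2 t
      - ((2 * t - 1) * f t + g t) * (4 * t - 2)) / seg_norm2 t ^ 2).
Proof.
intros Hf Hg. pose proof (seg_norm2_pos t). pose proof (is_derive_seg_norm2 t) as HN.
auto_derive.
- repeat split; try (eexists; eassumption). lra.
- replace (Derive (fun x => f x) t) with df by (symmetry; now apply is_derive_unique).
  replace (Derive (fun x => g x) t) with dg by (symmetry; now apply is_derive_unique).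
  replace (Derive (fun x => seg_norm2 x) t) with (4 * t - 2) by (symmetry;
      now apply is_derive_unique).
  field. lra.
Qed.

Lemma is_derive_dre t : is_derive dre t (ddre t).
Proof.
apply (is_derive_ext (fun t => q * ((2 * t - 1) * re t + - im t) / seg_norm2 t)).
- intros x. reflexivity.
- evar_last.
  + apply is_derive_quotient; [apply is_derive_re|].
    apply (is_derive_opp (K := R_AbsRing) (V := R_NormedModule) im). apply is_derive_im.
  + reflexivity.
Qed.

Lemma is_derive_dim t : is_derive dim t (ddim t).
Proof. apply is_derive_quotient; [apply is_derive_im | apply is_derive_re]. Qed.

(** Valid on the closed interval: it serves both as the Euler estimate below [1] and for the limit
    of the explicit power at [t = 1]. *)
Lemma rotation_taylor :
  exists C, 0 <= C /\ forall t t', 0 <= t <= 1 -> 0 <= t' <= 1 ->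
   Rabs (re t' - re t - (t' - t) * dre t) <= C * (t' - t) ^ 2 /\
   Rabs (im t' - im t - (t' - t) * dim t) <= C * (t' - t) ^ 2 /\
   Rabs (dre t) <= C /\ Rabs (dim t) <= C.
Proof.
assert (D1 : forall t, ex_derive re t) by (intros t; eexists; apply is_derive_re).
assert (D2 : forall t, ex_derive im t) by (intros t; eexists; apply is_derive_im).
assert (D3 : forall t, ex_derive dre t) by (intros t; eexists; apply is_derive_dre).
assert (D4 : forall t, ex_derive dim t) by (intros t; eexists; apply is_derive_dim).
assert (D5 : forall t, ex_derive seg_norm2 t) by (intros t; eexists; apply is_derive_seg_norm2).
destruct (bounded_on_segment ddre 0 1) as [C1 [P1 B1]].
{ intros x _. unfold ddre. auto_derive. repeat split; auto. pose proof (seg_norm2_pos x). nra. }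
destruct (bounded_on_segment ddim 0 1) as [C2 [P2 B2]].
{ intros x _. unfold ddim. auto_derive. repeat split; auto. pose proof (seg_norm2_pos x). nra. }
destruct (bounded_on_segment dre 0 1) as [C3 [P3 B3]]; [intros; auto|].
destruct (bounded_on_segment dim 0 1) as [C4 [P4 B4]]; [intros; auto|].
exists (C1 + C2 + C3 + C4). split; [lra|]. intros t t' Ht Ht'.
pose proof (pow2_ge_0 (t' - t)) as Hh.
repeat split.
- eapply Rle_trans; [apply (taylor_1 re dre ddre 0 1 C1); trivial; intros;
    [apply is_derive_re | apply is_derive_dre]|].
  apply Rmult_le_compat_r; lra.
- eapply Rle_trans; [apply (taylor_1 im dim ddim 0 1 C2); trivial; intros;
    [apply is_derive_im | apply is_derive_dim]|].
  apply Rmult_le_compat_r; lra.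
- specialize (B3 t Ht). lra.
- specialize (B4 t Ht). lra.
Qed.

Lemma rotation_gen t : 0 <= t < 1 ->
  scal q (seg_gen rot rot_res t (pt (re t) (im t))) = pt (dre t) (dim t).
Proof.
intros Ht. pose proof (seg_norm2_pos t) as HN. unfold seg_gen, seg_res, seg_dir, dre, dim,
    seg_norm2 in *.
generalize (re t) (im t). intros x y.
assert (E : (1 - t + 0) * (1 - t + 0) + t * t = (1 - t) ^ 2 + t ^ 2) by ring.
plane_eq; rewrite E; field; lra.
Qed.

Lemma rotation_euler t1 : 0 <= t1 < 1 ->
  euler_solution rot rot_res q t1 (fun t => pt (re t) (im t)).
Proof.
intros Ht1. destruct rotation_taylor as [C [HC H]].
exists (C + C). split; [lra|]. intros t t' Ht Ht'.
destruct (H t t' ltac:(lra) ltac:(lra)) as [H1 [H2 _]].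
eapply Rle_trans with (norm (minus (minus (pt (re t') (im t')) (pt (re t) (im t)))
  (scal (t' - t) (scal q (seg_gen rot rot_res t (pt (re t) (im t))))))).
{ right. f_equal. module_ring. }
rewrite rotation_gen by lra.
eapply Rle_trans; [apply plane_norm_le|].
replace ((C + C) * (t' - t) ^ 2) with (C * (t' - t) ^ 2 + C * (t' - t) ^ 2) by ring.
apply Rplus_le_compat; assumption.
Qed.

(** Uniqueness identifies the integral with the explicit power for [t < 1]. At [t = 1] both sides
    are limits, and the explicit one is [i^q], of modulus [1] and angle [q PI / 2]. *)
Lemma rotation_pow :
  seg_pow rot rot_res q 1 (pt 1 0) = scal (beta_int q) (pt (cos (q * (PI / 2))) (sin (q * (PI /
      2)))).
Proof.
assert (Y : forall t, 0 <= t < 1 ->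
  seg_pow rot rot_res q t (pt 1 0) = scal (beta_int q) (pt (re t) (im t))).
{ intros t Ht.
  apply (euler_solution_unique rot rot_linear rot_res 4 ltac:(lra) rot_resolvent 2 ltac:(lra)
      rot_bound
    q t (fun t => seg_pow rot rot_res q t (pt 1 0)) (fun t => scal (beta_int q) (pt (re t) (im
        t)))); try lra.
  - apply (euler_solution_seg_pow rot rot_linear rot_res 4 ltac:(lra) rot_resolvent 2 ltac:(lra)
      rot_bound); lra.
  - apply (euler_solution_scal rot rot_linear rot_res 4 ltac:(lra) rot_resolvent); [lra|].
    now apply rotation_euler.
  - rewrite (seg_pow_0 rot rot_res 4 rot_resolvent) by trivial. f_equal.
    unfold re, im, modulus, angle, seg_norm2.
    replace (2 * 0 - 1) with (- (1)) by ring. rewrite atan_opp, atan_1.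
    replace ((1 - 0) ^ 2 + 0 ^ 2) with 1 by ring. rewrite ln_1, Rmult_0_r, exp_0.
    replace (q * (PI / 4 + - (PI / 4))) with 0 by ring. rewrite cos_0, sin_0.
    f_equal; ring. }
assert (E1 : pt (re 1) (im 1) = pt (cos (q * (PI / 2))) (sin (q * (PI / 2)))).
{ unfold re, im, modulus, angle, seg_norm2.
  replace (2 * 1 - 1) with 1 by ring. rewrite atan_1.
  replace ((1 - 1) ^ 2 + 1 ^ 2) with 1 by ring. rewrite ln_1, Rmult_0_r, exp_0.
  replace (PI / 4 + PI / 4) with (PI / 2) by field. f_equal; ring. }
rewrite <- E1.
destruct rotation_taylor as [C [HC HT]].
(* The constant of [seg_pow_end] for [kap = 4] and [M = 2]. *)
set (K := (2 * 4 + 4 * (1 + 2) * 4) * (/ q + / (1 - q)) * norm (pt 1 0)).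
assert (Z : minus (scal (beta_int q) (pt (re 1) (im 1))) (seg_pow rot rot_res q 1 (pt 1 0)) =
    zero).
{ apply (zero_of_norm_le_Rpower _ (K + Rabs (beta_int q) * (2 * (C + C))) q); [lra|].
  intros e He.
  pose proof (seg_pow_end rot rot_linear rot_res 4 ltac:(lra) rot_resolvent 2 ltac:(lra) rot_bound
    q (1 - e) (pt 1 0) Hq ltac:(lra)) as B1.
  rewrite Y in B1 by lra. replace (1 - (1 - e)) with e in B1 by ring.
  destruct (HT 1 (1 - e) ltac:(lra) ltac:(lra)) as [T1 [T2 [T3 T4]]].
  replace (1 - e - 1) with (- e) in T1, T2 by ring.
  assert (He2 : C * (- e) ^ 2 <= C * e).
  { replace (C * (- e) ^ 2) with (C * e * e) by ring.
    rewrite <- (Rmult_1_r (C * e)) at 2. apply Rmult_le_compat_l; [apply Rmult_le_pos|]; lra. }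
  assert (K1 : forall x x' d, Rabs (x' - x - - e * d) <= C * (- e) ^ 2 -> Rabs d <= C ->
      Rabs (x - x') <= (C + C) * e).
  { intros x x' d Hx Hd. replace (x - x') with (- (x' - x - - e * d) + e * d) by ring.
    eapply Rle_trans; [apply Rabs_triang|]. rewrite Rabs_Ropp, Rabs_mult, (Rabs_pos_eq e) by lra.
    apply (Rmult_le_compat_l e) in Hd; lra. }
  assert (B2 : norm (minus (pt (re 1) (im 1)) (pt (re (1 - e)) (im (1 - e)))) <= 2 * (C + C) * e).
  { eapply Rle_trans; [apply plane_norm_le|].
    pose proof (K1 _ _ _ T1 T3) as K2. pose proof (K1 _ _ _ T2 T4) as K3.
    eapply Rle_trans; [exact (Rplus_le_compat _ _ _ _ K2 K3)|]. lra. }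
  pose proof (Rpower_le_exponent e q 1 He ltac:(lra)) as H1. rewrite Rpower_1 in H1 by lra.
  eapply Rle_trans; [apply (norm_minus_trans _ (scal (beta_int q) (pt (re (1 - e)) (im (1 -
      e)))))|].
  assert (B3 : norm (minus (scal (beta_int q) (pt (re 1) (im 1))) (scal (beta_int q) (pt (re (1
      - e)) (im (1 - e)))))
    <= Rabs (beta_int q) * (2 * (C + C) * Rpower e q)).
  { eapply Rle_trans with (norm (scal (beta_int q) (minus (pt (re 1) (im 1)) (pt (re (1 - e))
      (im (1 - e)))))).
    { right. f_equal. module_ring. }
    eapply Rle_trans; [apply norm_scal_le|]. apply Rmult_le_compat_l; [apply Rabs_pos|].
    eapply Rle_trans; [exact B2|]. apply Rmult_le_compat_l; lra. }
  eapply Rle_trans; [exact (Rplus_le_compat _ _ _ _ B3 B1)|]. right. unfold K. ring. }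
transitivity (minus (scal (beta_int q) (pt (re 1) (im 1)))
  (minus (scal (beta_int q) (pt (re 1) (im 1))) (seg_pow rot rot_res q 1 (pt 1 0)))).
- module_ring.
- rewrite Z. module_ring.
Qed.

End RotationPower.

(** * Duplication and reflection for the beta integral *)

Lemma half_line_square (f : R -> R) (l : R) :
  (forall x, 0 < x -> continuous f x) ->
  is_RInt_gen (V := R_CompleteNormedModule) f (at_right 0) (Rbar_locally p_infty) l ->
  is_RInt_gen (V := R_CompleteNormedModule) (fun s => 2 * s * f (s * s))
    (at_right 0) (Rbar_locally p_infty) l.
Proof.
intros Hf H P HP. specialize (H P HP). unfold filtermapi in *.
destruct H as [Qa Qb Ha Hb Hab].
apply (Filter_prod _ _ _ (fun a => 0 < a /\ Qa (a * a)) (fun b => 0 < b /\ Qb (b * b))).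
- destruct Ha as [[d Hd] Ha]. assert (Hm : 0 < Rmin d 1) by (apply Rmin_glb_lt; lra).
  apply (at_right_0_intro _ (Rmin d 1)); trivial. intros x [Hx0 Hx].
  pose proof (Rmin_l d 1). pose proof (Rmin_r d 1).
  assert (Hxx : 0 < x * x) by (now apply Rmult_lt_0_compat).
  split; trivial. apply Ha; trivial.
  change (Rabs (x * x - 0) < d). rewrite Rminus_0_r, Rabs_pos_eq by lra.
  apply Rle_lt_trans with (x * 1); [apply Rmult_le_compat_l|]; lra.
- destruct Hb as [N Hb]. exists (Rmax N 1). intros x Hx.
  pose proof (Rmax_l N 1). pose proof (Rmax_r N 1). split; [lra|]. apply Hb.
  apply Rlt_le_trans with (x * 1); [lra|]. apply Rmult_le_compat_l; lra.
- intros a b [Ha0 Ha1] [Hb0 Hb1]. destruct (Hab _ _ Ha1 Hb1) as [y [Hy HPy]]. simpl in *.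
  exists y. split; trivial. rewrite <- (is_RInt_unique (V := R_CompleteNormedModule) _ _ _ _ Hy).
  apply (is_RInt_comp (V := R_CompleteNormedModule) f (fun s => s * s) (fun s => 2 * s) a b).
  + intros x [Hx _]. apply Hf. assert (0 < x) by (eapply Rlt_le_trans; [|exact Hx];
      now apply Rmin_glb_lt).
    now apply Rmult_lt_0_compat.
  + intros x _. split.
    * auto_derive; trivial. ring.
    * apply (ex_derive_continuous (V := R_NormedModule)). auto_derive. trivial.
Qed.

Lemma continuous_beta_integrand q s : 0 < s ->
    continuous (fun s => Rpower s (q - 1) * / (1 + s)) s.
Proof.
intros Hs. apply (continuous_mult (K := R_AbsRing));
    [now apply continuous_Rpower | now apply continuous_inv_shift].
Qed.

(** The real part of [i / (i + s)] is [1 / (1 + s^2)], and substituting the square of [s] turns the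
    integral of [s^(q-1) / (1 + s^2)] into half of [beta_int (q / 2)]. *)
Lemma rotation_pow_re q : 0 < q < 1 ->
  fst (seg_pow rot rot_res q 1 (pt 1 0)) = beta_int (q / 2) / 2.
Proof.
intros Hq.
destruct (seg_pow_half_line rot rot_linear rot_res 4 ltac:(lra) rot_resolvent 2 ltac:(lra)
    rot_bound
  q 1 (pt 1 0) Hq ltac:(lra)) as [H _].
apply (half_line_linear (Y := R_NormedModule) (fun z : plane => fst z)) in H;
    [|apply is_linear_fst].
apply (half_line_unique (X := R_CompleteNormedModule) _ _ _ H).
destruct (beta_int_half_line (q / 2) ltac:(lra)) as [HB _].
apply half_line_square in HB; [|intros; now apply continuous_beta_integrand].
apply (half_line_scal (X := R_CompleteNormedModule) _ (/ 2)) in HB.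
replace (beta_int (q / 2) / 2) with (scal (/ 2) (beta_int (q / 2))) by (unfold scal; simpl;
    unfold mult; simpl; field).
revert HB. apply (half_line_ext (X := R_CompleteNormedModule)). intros s Hs.
assert (E : Rpower s (q - 1) = s * Rpower (s * s) (q / 2 - 1)).
{ unfold Rpower. rewrite ln_mult by trivial. rewrite <- (exp_ln s) at 2 by trivial.
  rewrite <- exp_plus. f_equal. field. }
assert (Hss : 0 < s * s) by (now apply Rmult_lt_0_compat).
rewrite E. unfold seg_res, segment.
plane_eq. field. lra.
Qed.

Lemma beta_int_duplication q : 0 < q < 1 ->
  beta_int (q / 2) = 2 * cos (PI * q / 2) * beta_int q.
Proof.
intros Hq. pose proof (rotation_pow_re q Hq) as H.
rewrite rotation_pow in H by trivial.
change (beta_int q * cos (q * (PI / 2)) = beta_int (q / 2) / 2) in H.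
replace (PI * q / 2) with (q * (PI / 2)) by field. lra.
Qed.

Lemma half_line_ge_RInt (f : R -> R) (l a b : R) :
  (forall x, 0 < x -> continuous f x) -> (forall x, 0 < x -> 0 <= f x) -> 0 < a < b ->
  is_RInt_gen (V := R_CompleteNormedModule) f (at_right 0) (Rbar_locally p_infty) l ->
  RInt (V := R_CompleteNormedModule) f a b <= l.
Proof.
intros Hf Hp Hab H. apply Rnot_lt_le. intros Hl.
set (e := RInt (V := R_CompleteNormedModule) f a b - l) in *.
assert (He : 0 < e) by (unfold e; lra).
specialize (H (ball (l : R_CompleteNormedModule) e) (locally_ball (T := R_UniformSpace) l
    (mkposreal e He))).
destruct H as [Qa Qb Ha Hb HQ].
assert (Ha' : at_right 0 (fun x => 0 < x < a)) by (now apply (at_right_0_intro _ a)).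
assert (Hb' : Rbar_locally p_infty (fun x => b < x)) by (now exists b).
destruct (filter_ex _ (filter_and _ _ Ha Ha')) as [x [Qx Hx]].
destruct (filter_ex _ (filter_and _ _ Hb Hb')) as [y [Qy Hy]].
destruct (HQ x y Qx Qy) as [z [Hz Hzl]]. simpl in *.
change (Rabs (z - l) < e) in Hzl. apply Rabs_lt_between in Hzl.
assert (Hex : forall u v, 0 < u -> 0 < v -> ex_RInt (V := R_CompleteNormedModule) f u v).
{ intros. now apply (ex_RInt_pos (X := R_CompleteNormedModule)). }
assert (Hge : forall u v, 0 < u <= v -> 0 <= RInt (V := R_CompleteNormedModule) f u v).
{ intros u v Huv. apply RInt_ge_0; [lra|apply Hex; lra|]. intros; apply Hp; lra. }
pose proof (RInt_Chasles (V := R_CompleteNormedModule) f x a b (Hex x a ltac:(lra) ltac:(lra))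
    (Hex a b ltac:(lra) ltac:(lra))) as E1.
pose proof (RInt_Chasles (V := R_CompleteNormedModule) f x b y (Hex x b ltac:(lra) ltac:(lra))
    (Hex b y ltac:(lra) ltac:(lra))) as E2.
change (RInt (V := R_CompleteNormedModule) f x a + RInt (V := R_CompleteNormedModule) f a b =
    RInt (V := R_CompleteNormedModule) f x b) in E1.
change (RInt (V := R_CompleteNormedModule) f x b + RInt (V := R_CompleteNormedModule) f b y =
    RInt (V := R_CompleteNormedModule) f x y) in E2.
apply (is_RInt_unique (V := R_CompleteNormedModule)) in Hz.
pose proof (Hge x a ltac:(lra)). pose proof (Hge b y ltac:(lra)). unfold e in *. lra.
Qed.

(** On []0, 1]] the integrand is at least [s^(q-1) - 1], because the deficit [s^q / (1 + s)] is at
    most [1]. *)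
Lemma beta_int_lower q : 0 < q < 1 -> / q - 1 <= beta_int q.
Proof.
intros Hq. destruct (beta_int_half_line q Hq) as [HB _].
apply Rnot_lt_le. intros Hlt. set (d := / q - 1 - beta_int q). assert (Hd : 0 < d) by (unfold d;
    lra).
(* The part below [a] costs at most [a^q / q], which is made smaller than the assumed gap [d]. *)
destruct (Rpower_0_lim q ltac:(lra) (q * d)) as [a0 [Ha0 Ha]]; [apply Rmult_lt_0_compat; lra|].
set (a := Rmin a0 1 / 2). assert (0 < Rmin a0 1) by (apply Rmin_glb_lt; lra).
pose proof (Rmin_l a0 1). pose proof (Rmin_r a0 1).
assert (Haa : 0 < a < 1 /\ a < a0) by (unfold a; lra).
specialize (Ha a ltac:(lra)).
assert (Hp : forall x, 0 < x -> 0 <= Rpower x (q - 1) * / (1 + x)).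
{ intros x Hx. apply Rmult_le_pos; [left; apply Rpower_pos | left; apply Rinv_0_lt_compat; lra]. }
pose proof (half_line_ge_RInt _ _ a 1 (continuous_beta_integrand q) Hp ltac:(lra) HB) as HR1.
pose proof (is_RInt_minus (V := R_NormedModule) _ _ a 1 _ _ (is_RInt_Rpower q a 1 ltac:(lra)
    ltac:(lra) ltac:(lra))
  (is_RInt_const (V := R_NormedModule) a 1 1)) as I1.
assert (Hex : ex_RInt (V := R_CompleteNormedModule) (fun s => Rpower s (q - 1) * / (1 + s)) a 1).
{ apply (ex_RInt_pos (X := R_CompleteNormedModule));
    [apply continuous_beta_integrand | lra | lra]. }
pose proof (RInt_correct (V := R_CompleteNormedModule) _ _ _ Hex) as I2.
assert (H2 : (Rpower 1 q - Rpower a q) / q - (1 - a) * 1 <= RInt (V := R_CompleteNormedModule)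
    (fun s => Rpower s (q - 1) * / (1 + s)) a 1).
{ apply (is_RInt_le (fun s => minus (Rpower s (q - 1)) 1) (fun s => Rpower s (q - 1) * / (1 +
    s)) a 1); trivial; [lra|].
  intros x Hx. change (Rpower x (q - 1) - 1 <= Rpower x (q - 1) * / (1 + x)).
  apply Rmult_le_reg_r with (1 + x); [lra|].
  replace (Rpower x (q - 1) * / (1 + x) * (1 + x)) with (Rpower x (q - 1)) by (field; lra).
  assert (Hpx : Rpower x (q - 1) * x <= 1).
  { rewrite <- (Rpower_1 x) at 2 by lra. rewrite <- Rpower_plus.
    replace (q - 1 + 1) with q by ring.
    pose proof (Rpower_le_exponent x 0 q ltac:(lra) ltac:(lra)) as Hxq.
    now rewrite Rpower_O in Hxq by lra. }
  lra. }
assert (H3 : (Rpower 1 q - Rpower a q) / q = / q - Rpower a q / q).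
{ replace (Rpower 1 q) with 1; [field; lra|]. unfold Rpower. now rewrite ln_1, Rmult_0_r, exp_0. }
assert (H4 : Rpower a q / q < d).
{ apply Rmult_lt_reg_r with q; [lra|]. replace (Rpower a q / q * q) with (Rpower a q) by (field;
    lra). lra. }
pose proof (Rle_trans _ _ _ H2 HR1). unfold d in *. lra.
Qed.

Lemma sin_first_order x : Rabs (sin x - x) <= x ^ 2.
Proof.
pose proof (taylor_1 sin cos (fun x => - sin x) (- Rabs x) (Rabs x) 1) as H.
assert (Hx : - Rabs x <= x <= Rabs x).
{ pose proof (Rle_abs x). pose proof (Rle_abs (- x)). rewrite Rabs_Ropp in H1. lra. }
pose proof (Rabs_pos x).
specialize (H ltac:(intros; apply is_derive_sin) ltac:(intros; apply is_derive_cos)).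
assert (HC : forall t, - Rabs x <= t <= Rabs x -> Rabs (- sin t) <= 1).
{ intros t _. rewrite Rabs_Ropp. apply Rabs_le. apply SIN_bound. }
specialize (H HC 0 x ltac:(lra) Hx).
rewrite sin_0, cos_0 in H. rewrite !Rminus_0_r, !Rmult_1_r, Rmult_1_l in H. exact H.
Qed.

Lemma beta_int_sin q : 0 < q < 1 -> beta_int q * sin (PI * q) = PI.
Proof.
intros Hq.
pose proof PI_RGT_0 as HPI.
(* Duplication supplies [2 cos (PI r / 2)], exactly the factor that turns [sin (PI r / 2)] into
   [sin (PI r)]. *)
assert (Hhalf : forall n, beta_int (q / 2 ^ n) * sin (PI * (q / 2 ^ n)) = beta_int q * sin (PI *
    q)).
{ induction n as [|n IH].
  - simpl. now rewrite Rdiv_1_r.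
  - rewrite <- IH. assert (H2 : 1 <= 2 ^ n) by (apply pow_R1_Rle; lra).
    assert (Hr : 0 < q / 2 ^ n < 1).
    { split; [apply Rdiv_lt_0_compat; lra|]. apply Rmult_lt_reg_r with (2 ^ n); [lra|].
      replace (q / 2 ^ n * 2 ^ n) with q by (field; lra). lra. }
    set (r := q / 2 ^ n) in *. replace (q / 2 ^ S n) with (r / 2) by (unfold r; simpl; field;
        lra).
    rewrite beta_int_duplication by trivial.
    replace (PI * r) with (2 * (PI * (r / 2))) by field. rewrite sin_2a.
    replace (2 * (PI * (r / 2)) / 2) with (PI * (r / 2)) by field. ring. }
set (g := beta_int q * sin (PI * q)) in *.
assert (Hbound : forall e, 0 < e <= / 2 -> beta_int e * sin (PI * e) = g ->
    Rabs (g - PI) <= (2 * PI ^ 2 + 2 * PI) * e).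
{ intros e He Hg.
  pose proof (beta_int_lower e ltac:(lra)) as B1.
  destruct (beta_int_half_line e ltac:(lra)) as [_ B2].
  assert (B3 : / (1 - e) <= 2).
  { rewrite <- (Rinv_inv 2). apply Rinv_le_contravar; lra. }
  (* The singularity [1 / e] is isolated with a bounded error; multiplied by
     [sin (PI e) = PI e + O(e^2)] it leaves [PI + O(e)]. *)
  assert (B4 : Rabs (beta_int e - / e) <= 2).
  { pose proof (Rle_abs (beta_int e)). apply Rabs_le. lra. }
  pose proof (sin_first_order (PI * e)) as S1.
  assert (Hie : 0 < / e) by (apply Rinv_0_lt_compat; lra).
  replace (g - PI) with ((beta_int e - / e) * (sin (PI * e) - PI * e) + (beta_int e - / e) * (PI
      * e)
     + / e * (sin (PI * e) - PI * e)) by (rewrite <- Hg; field; lra).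
  eapply Rle_trans; [apply Rabs_triang|].
  pose proof (Rabs_triang ((beta_int e - / e) * (sin (PI * e) - PI * e)) ((beta_int e - / e) *
      (PI * e))) as T.
  rewrite !Rabs_mult in *.
  rewrite (Rabs_pos_eq PI), (Rabs_pos_eq e), (Rabs_pos_eq (/ e)) in * by lra.
  pose proof (Rabs_pos (beta_int e - / e)). pose proof (Rabs_pos (sin (PI * e) - PI * e)).
  assert (T1 : Rabs (beta_int e - / e) * Rabs (sin (PI * e) - PI * e) <= 2 * (PI * e) ^ 2)
    by (now apply Rmult_le_compat).
  assert (T2 : Rabs (beta_int e - / e) * (PI * e) <= 2 * (PI * e)).
  { apply Rmult_le_compat_r; trivial. apply Rmult_le_pos; lra. }
  assert (T3 : / e * Rabs (sin (PI * e) - PI * e) <= / e * (PI * e) ^ 2)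
      by (apply Rmult_le_compat_l; lra).
  replace (/ e * (PI * e) ^ 2) with (PI ^ 2 * e) in T3 by (field; lra).
  assert (T4 : 2 * (PI * e) ^ 2 <= PI ^ 2 * e).
  { replace (2 * (PI * e) ^ 2) with (PI ^ 2 * e * (2 * e)) by ring.
    rewrite <- (Rmult_1_r (PI ^ 2 * e)) at 2. apply Rmult_le_compat_l; [|lra].
    apply Rmult_le_pos; [apply pow2_ge_0 | lra]. }
  lra. }
set (C := 2 * PI ^ 2 + 2 * PI) in *.
assert (HC : 0 < C) by (unfold C; pose proof (pow2_ge_0 PI); lra).
apply Rminus_diag_uniq. apply Rabs_eq_0. apply Rle_antisym; [|apply Rabs_pos].
apply Rnot_lt_le. intros Hpos.
destruct (pow_lt_1_zero (/ 2)) with (y := Rmin (Rabs (g - PI) / C) 1) as [N HN].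
{ rewrite Rabs_pos_eq; lra. }
{ apply Rmin_glb_lt; [now apply Rdiv_lt_0_compat | lra]. }
specialize (HN (S N) ltac:(lia)).
rewrite Rabs_pos_eq in HN by (apply pow_le; lra).
assert (H2 : 0 < 2 ^ S N) by (apply pow_lt; lra).
assert (He : q / 2 ^ S N <= (/ 2) ^ S N).
{ rewrite pow_inv. unfold Rdiv. rewrite <- (Rmult_1_l (/ 2 ^ S N)) at 2.
  apply Rmult_le_compat_r; [left; now apply Rinv_0_lt_compat | lra]. }
assert (He2 : (/ 2) ^ S N <= / 2).
{ simpl. rewrite <- (Rmult_1_r (/ 2)) at 3. apply Rmult_le_compat_l; [lra|].
  rewrite <- (pow1 N). apply pow_incr. lra. }
assert (He3 : 0 < q / 2 ^ S N) by (apply Rdiv_lt_0_compat; lra).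
pose proof (Hbound _ (conj He3 (Rle_trans _ _ _ He He2)) (Hhalf (S N))) as H.
pose proof (Rmin_l (Rabs (g - PI) / C) 1) as Hm.
assert (Hlt : q / 2 ^ S N < Rabs (g - PI) / C) by lra.
apply (Rmult_lt_compat_l C) in Hlt; trivial.
replace (C * (Rabs (g - PI) / C)) with (Rabs (g - PI)) in Hlt by (field; lra). lra.
Qed.

Lemma sin_PI_pos q : 0 < q < 1 -> 0 < sin (PI * q).
Proof.
intros Hq. pose proof PI_RGT_0. apply sin_gt_0.
- apply Rmult_lt_0_compat; lra.
- rewrite <- (Rmult_1_r PI) at 2. apply Rmult_lt_compat_l; lra.
Qed.

Lemma beta_int_eq q : 0 < q < 1 -> beta_int q = PI / sin (PI * q).
Proof.
intros Hq. pose proof (sin_PI_pos q Hq). rewrite <- (beta_int_sin q Hq) at 1. field. lra.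
Qed.

(** * Fractional powers and the logarithm of an operator of positive type *)

Section OperatorNorm.

Context {X : CompleteNormedModule R_AbsRing}.

Lemma norm_le_of_unit_ball (B : X -> X) (M : R) :
  (forall (k : R) u, B (scal k u) = scal k (B u)) ->
  (forall u, norm u <= 1 -> norm (B u) <= M) ->
  forall u, norm (B u) <= M * norm u.
Proof.
intros HB H u. pose proof (norm_nonneg u) as Hu.
destruct (Req_dec (norm u) 0) as [E|E].
(* A vector of norm zero cannot be normalised; homogeneity of [B] with factor [0] replaces the
   scaling. *)
- assert (Eu : u = scal 0 u).
  { assert (u = zero) by (apply (norm_eq_zero (K := R_AbsRing) (V := X)); exact E).
    subst u. module_ring. }
  rewrite Eu at 1. rewrite HB.
  eapply Rle_trans; [apply norm_scal_le|]. rewrite E, Rabs_R0. lra.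
- assert (Hpos : 0 < norm u) by lra.
  assert (E1 : u = scal (norm u) (scal (/ norm u) u)).
  { module_eq; field; lra. }
  rewrite E1 at 1. rewrite HB.
  eapply Rle_trans; [apply norm_scal_pos; lra|]. rewrite Rmult_comm.
  apply Rmult_le_compat_r; trivial. apply H.
  eapply Rle_trans; [apply norm_scal_pos; left; now apply Rinv_0_lt_compat|].
  rewrite Rinv_l by easy. apply Rle_refl.
Qed.

Lemma op_norm_bound (B : X -> X) (M : R) :
  (forall (k : R) u, B (scal k u) = scal k (B u)) ->
  Rbar_le (op_norm B) (Finite M) ->
  forall u, norm (B u) <= M * norm u.
Proof.
intros HB HM. apply norm_le_of_unit_ball; trivial. intros u Hu.
assert (H : Rbar_le (Finite (norm (B u))) (op_norm B)).
{ apply (Lub_Rbar_correct (fun r => exists u, norm u <= 1 /\ r = norm (B u))).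
  now exists u. }
exact (Rbar_le_trans _ _ _ H HM).
Qed.

Lemma op_norm_linear (B : X -> X) : is_linear B ->
  0 <= real (op_norm B) /\ forall u, norm (B u) <= real (op_norm B) * norm u.
Proof.
intros HB. destruct (linear_norm B HB) as [M [HM HMB]].
assert (Hub : Rbar_le (op_norm B) (Finite M)).
{ apply (Lub_Rbar_correct (fun r => exists u, norm u <= 1 /\ r = norm (B u))).
  intros r [u [Hu ->]]. simpl. eapply Rle_trans; [apply HMB|].
  rewrite <- (Rmult_1_r M) at 2. apply Rmult_le_compat_l; lra. }
assert (Hlb : Rbar_le (Finite 0) (op_norm B)).
{ apply Rbar_le_trans with (Finite (norm (B zero))).
  - apply norm_nonneg.
  - apply (Lub_Rbar_correct (fun r => exists u, norm u <= 1 /\ r = norm (B u))).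
    exists zero. split; trivial. rewrite (norm_zero (K := R_AbsRing) (V := X)). lra. }
assert (E : op_norm B = Finite (real (op_norm B))).
{ destruct (op_norm B); simpl in *; trivial; contradiction. }
split.
- rewrite E in Hlb. exact Hlb.
- apply op_norm_bound.
  + apply (linear_scal B HB).
  + rewrite <- E. destruct (op_norm B); simpl; trivial. apply Rle_refl.
Qed.

Lemma op_inv_correct (B : X -> X) : Injective B -> Surjective B ->
  forall y, B (op_inv B y) = y.
Proof.
intros HI HS y. unfold op_inv. apply (iota_correct (V := X) (fun u => B u = y)).
destruct (HS y) as [u Hu]. exists u. split; trivial.
intros u' Hu'. apply HI. congruence.
Qed.

Context (A : X -> X) (HA : is_linear A).

(** Since [(a + b A)^-1 = (A + a / b)^-1 (1 / b)], all values reduce to the resolvents in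
    [positive_type]; [b = 0] is separate because [a / b] is then meaningless. *)
Definition type_res (a b : R) (y : X) : X :=
  if Req_EM_T b 0 then scal (/ a) y else op_inv (shift A (a / b)) (scal (/ b) y).

Lemma pt_res_1 s y : type_res s 1 y = op_inv (shift A s) y.
Proof.
unfold type_res. destruct (Req_EM_T 1 0); [lra|].
rewrite Rdiv_1_r. f_equal. module_eq. field.
Qed.

Lemma positive_type_resolvent : positive_type A ->
  exists kap, 1 <= kap /\ resolvent_family A type_res kap.
Proof.
intros [k [Hk H]].
(* At [b = 0] the operator is [(1 / a) I], whose bound requires a constant of at least [1]. *)
exists (Rmax k 1). split; [apply Rmax_r|].
intros a b Ha Hb.
assert (Hm : forall c, 0 <= c -> k / a * c <= Rmax k 1 / a * c).
{ intros c Hc. apply Rmult_le_compat_r; trivial.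
  apply Rmult_le_compat_r; [left; now apply Rinv_0_lt_compat | apply Rmax_l]. }
assert (Hm1 : forall c, 0 <= c -> / a * c <= Rmax k 1 / a * c).
{ intros c Hc. apply Rmult_le_compat_r; trivial. rewrite <- (Rmult_1_l (/ a)).
  apply Rmult_le_compat_r; [left; now apply Rinv_0_lt_compat | apply Rmax_r]. }
unfold type_res. destruct (Req_EM_T b 0) as [E|E].
- subst b. repeat split.
  + intros y. rewrite (linear_scal A HA). module_eq; field; lra.
  + intros u. module_eq; field; lra.
  + intros y. eapply Rle_trans; [apply norm_scal_pos; left; now apply Rinv_0_lt_compat|].
    apply Hm1, norm_nonneg.
- assert (Hb' : 0 < b) by lra.
  assert (Hab : 0 < a / b) by now apply Rdiv_lt_0_compat.
  destruct (H _ Hab) as [HI [HS HN]].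
  pose proof (op_inv_correct _ HI HS) as HC.
  assert (HU : forall u v, shift A (a / b) u = v -> op_inv (shift A (a / b)) v = u).
  { intros u v Huv. apply HI. now rewrite HC. }
  assert (HB : forall (c : R) u, op_inv (shift A (a / b)) (scal c u) = scal c (op_inv (shift A
      (a / b)) u)).
  { intros c u. apply HU. rewrite <- (HC u) at 2. unfold shift. rewrite (linear_scal A HA).
      module_ring. }
  repeat split.
  + intros y. set (z := op_inv (shift A (a / b)) (scal (/ b) y)).
    assert (Ez : shift A (a / b) z = scal (/ b) y) by apply HC.
    transitivity (scal b (shift A (a / b) z)).
    * unfold shift. module_eq; field; lra.
    * rewrite Ez. module_eq; field; lra.
  + intros u. apply HU. unfold shift. module_eq; field; lra.
  + intros y. eapply Rle_trans; [apply (op_norm_bound _ _ HB HN)|].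
    eapply Rle_trans with (k / (a / b) * (/ b * norm y)).
    * apply Rmult_le_compat_l; [left; now apply Rdiv_lt_0_compat|].
      apply norm_scal_pos. left. now apply Rinv_0_lt_compat.
    * replace (k / (a / b) * (/ b * norm y)) with (k / a * norm y) by (field; lra).
      apply Hm, norm_nonneg.
Qed.

End OperatorNorm.

(** * Fractional powers of [A] and their semigroup law *)

Section FractionalPowers.

Context {X : CompleteNormedModule R_AbsRing} (A : X -> X) (HA : is_linear A)
  (kap : R) (Hkap : 1 <= kap) (HQ : resolvent_family A (type_res A) kap)
  (M : R) (HM : 1 <= M) (HMA : forall x, norm (A x) <= M * norm x).

Let Hkap0 : 0 < kap. Proof. lra. Qed.
Let HM0 : 0 < M. Proof. lra. Qed.

Lemma frac_integral_eq q u : 0 < q < 1 ->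
  frac_integral A q u = scal (/ beta_int q) (seg_pow A (type_res A) q 1 u).
Proof.
intros Hq. unfold frac_integral. pose proof (sin_PI_pos q Hq). pose proof PI_RGT_0.
rewrite beta_int_eq by trivial. replace (/ (PI / sin (PI * q)))
    with (sin (PI * q) / PI) by (field; lra).
f_equal. apply half_line_RInt_gen.
destruct (seg_pow_half_line A HA (type_res A) kap Hkap0 HQ M HM0 HMA q 1 u Hq ltac:(lra))
    as [Hh _].
revert Hh. apply half_line_ext. intros s Hs. unfold seg_res.
replace (1 - 1 + s) with s by ring. rewrite pt_res_1. f_equal. f_equal.
unfold segment. module_ring.
Qed.

Lemma beta_int_pos q : 0 < q < 1 -> 0 < beta_int q.
Proof.
intros Hq. rewrite beta_int_eq by trivial.
apply Rdiv_lt_0_compat; [apply PI_RGT_0 | now apply sin_PI_pos].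
Qed.

(** By reflection [/ beta_int q = sin (PI q) / PI], which is at most [q] and, by symmetry of the
    sine, at most [1 - q]. This removes the blow-up of the integral bounds at both ends. *)
Lemma inv_beta_int_le q : 0 < q < 1 -> / beta_int q * (/ q + / (1 - q)) <= 2.
Proof.
intros Hq. rewrite beta_int_eq by trivial.
pose proof (sin_PI_pos q Hq). pose proof PI_RGT_0.
assert (S : forall r, 0 < r < 1 -> sin (PI * r) / PI <= r).
{ intros r Hr. assert (0 < PI * r) by (apply Rmult_lt_0_compat; lra).
  pose proof (sin_lt_x (PI * r) H1). apply Rmult_le_reg_r with PI; trivial.
  replace (sin (PI * r) / PI * PI) with (sin (PI * r)) by (field; lra). lra. }
replace (/ (PI / sin (PI * q))) with (sin (PI * q) / PI) by (field; lra).
pose proof (S q Hq) as S1.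
assert (S2 : sin (PI * q) / PI <= 1 - q).
{ rewrite <- (sin_PI_x (PI * q)). replace (PI - PI * q)
    with (PI * (1 - q)) by ring. apply S. lra. }
set (c := sin (PI * q) / PI) in *.
rewrite Rmult_plus_distr_l. replace 2 with (1 + 1) by ring. apply Rplus_le_compat.
- apply Rmult_le_reg_r with q; [lra|]. replace (c * / q * q) with c by (field; lra). lra.
- apply Rmult_le_reg_r with (1 - q); [lra|]. replace (c * / (1 - q) * (1 - q)) with c by (field;
    lra). lra.
Qed.

Lemma frac_integral_linear q : 0 < q < 1 -> is_linear (frac_integral A q).
Proof.
intros Hq.
apply (is_linear_ext (fun u => scal (/ beta_int q) (seg_pow A (type_res A) q 1 u))).
- intros u. now rewrite frac_integral_eq.
- apply (is_linear_comp (seg_pow A (type_res A) q 1) (fun x => scal (/ beta_int q) x)).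
  + apply (seg_pow_linear A HA (type_res A) kap Hkap0 HQ M HM0 HMA); lra.
  + apply (is_linear_scal_r (K := R_AbsRing) (V := X)). intros; apply Rmult_comm.
Qed.

Lemma frac_integral_bound q u : 0 < q < 1 ->
  norm (frac_integral A q u) <= 2 * (1 + kap) * (1 + M) * norm u.
Proof.
intros Hq. rewrite frac_integral_eq by trivial. pose proof (beta_int_pos q Hq) as Hb.
eapply Rle_trans; [apply norm_scal_pos; left; now apply Rinv_0_lt_compat|].
pose proof (seg_pow_bound A HA (type_res A) kap Hkap0 HQ M HM0 HMA q 1 u Hq ltac:(lra)) as H.
apply (Rmult_le_compat_l (/ beta_int q)) in H; [|left; now apply Rinv_0_lt_compat].
eapply Rle_trans; [exact H|]. unfold pow_bound.
replace (/ beta_int q * ((1 + kap) * (1 + M) * (/ q + / (1 - q)) * norm u)) with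
  (/ beta_int q * (/ q + / (1 - q)) * ((1 + kap) * (1 + M) * norm u)) by ring.
replace (2 * (1 + kap) * (1 + M) * norm u) with (2 * ((1 + kap) * (1 + M) * norm u)) by ring.
apply Rmult_le_compat_r; [|now apply inv_beta_int_le].
apply Rmult_le_pos; [apply Rmult_le_pos; lra | apply norm_nonneg].
Qed.

Lemma frac_integral_commutes q (L : X -> X) u : 0 < q < 1 -> is_linear L ->
  (forall x, L (A x) = A (L x)) -> frac_integral A q (L u) = L (frac_integral A q u).
Proof.
intros Hq HL HLA. rewrite !frac_integral_eq, (linear_scal L HL) by trivial. f_equal.
apply (seg_pow_commutes A HA (type_res A) kap Hkap0 HQ M HM0 HMA); trivial; lra.
Qed.

Lemma frac_integral_mul p q u : 0 < p -> 0 < q -> p + q < 1 ->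
  frac_integral A p (frac_integral A q u) = frac_integral A (p + q) u.
Proof.
intros Hp Hq Hpq. rewrite (frac_integral_eq q),
    (linear_scal _ (frac_integral_linear p ltac:(lra))) by lra.
rewrite !frac_integral_eq by lra.
pose proof (seg_pow_mul A HA (type_res A) kap Hkap0 HQ M HM0 HMA p q u Hp Hq Hpq) as E.
pose proof (beta_int_pos p ltac:(lra)). pose proof (beta_int_pos q ltac:(lra)).
pose proof (beta_int_pos (p + q) ltac:(lra)).
set (x := seg_pow A (type_res A) p 1 (seg_pow A (type_res A) q 1 u)) in *.
set (y := seg_pow A (type_res A) (p + q) 1 u) in *.
transitivity (scal (/ (beta_int p * beta_int q * beta_int (p + q))) (scal (beta_int (p + q)) x)).
- module_eq; field; lra.
- rewrite E. module_eq; field; lra.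
Qed.

Lemma frac_integral_mul_1 p q u : 0 < p -> 0 < q -> p + q = 1 ->
  frac_integral A p (frac_integral A q u) = A u.
Proof.
intros Hp Hq Hpq. rewrite (frac_integral_eq q),
    (linear_scal _ (frac_integral_linear p ltac:(lra))) by lra.
rewrite !frac_integral_eq by lra.
rewrite (seg_pow_mul_1 A HA (type_res A) kap Hkap0 HQ M HM0 HMA p q u Hp Hq Hpq).
pose proof (beta_int_pos p ltac:(lra)). pose proof (beta_int_pos q ltac:(lra)).
module_eq; field; lra.
Qed.

Definition frac_pow (r : R) (u : X) : X :=
  if Req_EM_T r 0 then u else frac_integral A r u.

Lemma frac_pow_0 u : frac_pow 0 u = u.
Proof. unfold frac_pow. now destruct (Req_EM_T 0 0). Qed.

Lemma frac_pow_pos r u : 0 < r -> frac_pow r u = frac_integral A r u.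
Proof. intros Hr. unfold frac_pow. destruct (Req_EM_T r 0); trivial. lra. Qed.

Lemma frac_pow_linear r : 0 <= r < 1 -> is_linear (frac_pow r).
Proof.
intros Hr. destruct (Req_dec r 0) as [->|Hr0].
- apply (is_linear_ext (fun u : X => u)).
  + intros u. now rewrite frac_pow_0.
  + apply is_linear_id.
- apply (is_linear_ext (frac_integral A r)).
  + intros u. rewrite frac_pow_pos; trivial. lra.
  + apply frac_integral_linear. lra.
Qed.

Lemma frac_pow_commutes r (L : X -> X) u : 0 <= r < 1 -> is_linear L ->
  (forall x, L (A x) = A (L x)) -> frac_pow r (L u) = L (frac_pow r u).
Proof.
intros Hr HL HLA. destruct (Req_dec r 0) as [->|Hr0].
- now rewrite !frac_pow_0.
- rewrite !frac_pow_pos by lra. apply frac_integral_commutes; trivial. lra.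
Qed.

Lemma frac_pow_bound r u : 0 <= r < 1 -> norm (frac_pow r u) <= 2 * (1 + kap) * (1 + M) * norm u.
Proof.
intros Hr. destruct (Req_dec r 0) as [->|Hr0].
- rewrite frac_pow_0. rewrite <- (Rmult_1_l (norm u)) at 1.
  apply Rmult_le_compat_r; [apply norm_nonneg|].
  assert (1 * 1 <= (1 + kap) * (1 + M)) by (apply Rmult_le_compat; lra). lra.
- rewrite frac_pow_pos by lra. apply frac_integral_bound. lra.
Qed.

Lemma frac_pow_mul r s u : 0 <= r < 1 -> 0 <= s < 1 -> r + s < 1 ->
  frac_pow r (frac_pow s u) = frac_pow (r + s) u.
Proof.
intros Hr Hs Hrs.
destruct (Req_dec r 0) as [->|Hr0]; [now rewrite frac_pow_0, Rplus_0_l|].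
destruct (Req_dec s 0) as [->|Hs0]; [now rewrite frac_pow_0, Rplus_0_r|].
rewrite !frac_pow_pos by lra. apply frac_integral_mul; lra.
Qed.

(** Write [A = A^(1-s) A^s], then merge [A^(r+s-1) A^(1-s)] into [A^r]; this keeps every exponent
    inside []0, 1[]. *)
Lemma frac_pow_mul_ge r s u : 0 <= r < 1 -> 0 <= s < 1 -> 1 <= r + s ->
  frac_pow r (frac_pow s u) = frac_pow (r + s - 1) (A u).
Proof.
intros Hr Hs Hrs.
destruct (Req_dec (r + s) 1) as [E|E].
- replace (r + s - 1) with 0 by lra. rewrite frac_pow_0, !frac_pow_pos by lra.
  apply frac_integral_mul_1; lra.
- rewrite !frac_pow_pos by lra.
  rewrite <- (frac_integral_mul_1 (1 - s) s u) by lra.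
  rewrite (frac_integral_mul (r + s - 1) (1 - s)) by lra. f_equal. ring.
Qed.

Lemma iter_linear n (L : X -> X) : is_linear L -> is_linear (Nat.iter n L).
Proof.
intros HL. induction n as [|n IH].
- apply (is_linear_ext (fun u : X => u)); [reflexivity | apply is_linear_id].
- apply (is_linear_ext (fun u => L (Nat.iter n L u))); [reflexivity|].
  now apply (is_linear_comp (Nat.iter n L) L).
Qed.

Lemma iter_commutes n (L B : X -> X) u :
  (forall x, L (B x) = B (L x)) -> L (Nat.iter n B u) = Nat.iter n B (L u).
Proof. intros H. induction n as [|n IH]; simpl; trivial. now rewrite H, IH. Qed.

Lemma op_pow_eq n r u : 0 <= r < 1 ->
  op_pow A (INR n + r) u = frac_pow r (Nat.iter n A u).
Proof.
intros Hr. unfold op_pow.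
assert (E : Int_part (INR n + r) = Z.of_nat n).
{ symmetry. apply Int_part_spec. rewrite <- INR_IZR_INZ. lra. }
assert (E2 : frac_part (INR n + r) = r).
{ unfold frac_part. rewrite E, <- INR_IZR_INZ. ring. }
rewrite E, E2, Znat.Nat2Z.id. reflexivity.
Qed.

Lemma nat_frac_decomposition p : 0 <= p -> exists n r, p = INR n + r /\ 0 <= r < 1.
Proof.
intros Hp. destruct (base_Int_part p) as [H1 H2].
assert (Hz : (0 <= Int_part p)%Z).
{ assert (H : IZR (-1) < IZR (Int_part p)) by lra. apply lt_IZR in H. lia. }
exists (Z.to_nat (Int_part p)), (p - IZR (Int_part p)).
rewrite INR_IZR_INZ, Znat.Z2Nat.id by trivial. split; [ring | lra].
Qed.

Lemma op_pow_linear p : 0 <= p -> is_linear (op_pow A p).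
Proof.
intros Hp. destruct (nat_frac_decomposition p Hp) as [n [r [-> Hr]]].
apply (is_linear_ext (fun u => frac_pow r (Nat.iter n A u))).
- intros u. now rewrite op_pow_eq.
- apply (is_linear_comp (Nat.iter n A) (frac_pow r));
    [now apply iter_linear | now apply frac_pow_linear].
Qed.

Lemma op_pow_nat n u : op_pow A (INR n) u = Nat.iter n A u.
Proof. rewrite <- (Rplus_0_r (INR n)). rewrite op_pow_eq by lra. apply frac_pow_0. Qed.

Lemma op_pow_plus p h u : 0 <= p -> 0 <= h -> op_pow A (p + h) u = op_pow A p (op_pow A h u).
Proof.
intros Hp Hh.
destruct (nat_frac_decomposition p Hp) as [n [r [-> Hr]]].
destruct (nat_frac_decomposition h Hh) as [m [s [-> Hs]]].
rewrite !op_pow_eq by trivial.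
rewrite <- (frac_pow_commutes s (Nat.iter n A)); trivial; [|now apply iter_linear|].
2:{ intros x. symmetry. now apply iter_commutes. }
rewrite <- Nat.iter_add.
(* The fractional parts either add without carry, or carry one into the integer part and contribute
   an extra factor [A]. *)
destruct (Rlt_le_dec (r + s) 1) as [H|H].
- replace (INR n + r + (INR m + s)) with (INR (n + m) + (r + s)) by (rewrite plus_INR; ring).
  rewrite op_pow_eq by lra. now rewrite frac_pow_mul.
- replace (INR n + r + (INR m + s)) with (INR (S (n + m)) + (r + s - 1))
    by (rewrite S_INR, plus_INR; ring).
  rewrite op_pow_eq by lra. rewrite frac_pow_mul_ge by trivial. reflexivity.
Qed.

Lemma op_pow_bound (N : nat) : exists C, 0 < C /\
  forall p u, 0 <= p <= INR N -> norm (op_pow A p u) <= C * norm u.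
Proof.
exists (2 * (1 + kap) * (1 + M) * M ^ N). split.
{ apply Rmult_lt_0_compat; [apply Rmult_lt_0_compat; lra | apply pow_lt; lra]. }
intros p u Hp. destruct (nat_frac_decomposition p ltac:(lra)) as [n [r [-> Hr]]].
rewrite op_pow_eq by trivial. eapply Rle_trans; [now apply frac_pow_bound|].
rewrite (Rmult_assoc _ (M ^ N)). apply Rmult_le_compat_l.
{ apply Rmult_le_pos; lra. }
assert (Hn : (n <= N)%nat) by (apply INR_le; lra).
apply Rle_trans with (M ^ n * norm u).
- clear Hp Hn. induction n as [|k IH]; simpl; [lra|]. eapply Rle_trans; [apply HMA|].
  rewrite Rmult_assoc. apply Rmult_le_compat_l; lra.
- apply Rmult_le_compat_r; [apply norm_nonneg|]. apply Rle_pow; trivial.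
Qed.

(** * Smoothing by iterated resolvents *)

Definition smooth (alpha : R) (u : X) : X := scal alpha (type_res A alpha 1 u).

Lemma smooth_linear alpha : 0 < alpha -> is_linear (smooth alpha).
Proof.
intros Ha. apply (is_linear_comp (type_res A alpha 1) (fun x => scal alpha x)).
- apply (Q_linear A HA (type_res A) kap Hkap0 HQ); lra.
- apply (is_linear_scal_r (K := R_AbsRing) (V := X)). intros; apply Rmult_comm.
Qed.

Lemma smooth_A alpha u : 0 < alpha -> smooth alpha (A u) = A (smooth alpha u).
Proof.
intros Ha. unfold smooth. rewrite (linear_scal A HA). f_equal.
apply (Q_A A HA (type_res A) kap HQ); lra.
Qed.

Lemma pt_res_bound alpha u : 0 < alpha -> norm (type_res A alpha 1 u) <= kap / alpha * norm u.
Proof. intros Ha. apply (Q_bound A (type_res A) kap HQ); lra. Qed.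

Lemma smooth_bound alpha u : 0 < alpha -> norm (smooth alpha u) <= kap * norm u.
Proof.
intros Ha. unfold smooth. eapply Rle_trans; [apply norm_scal_pos; lra|].
pose proof (pt_res_bound alpha u Ha) as H. apply (Rmult_le_compat_l alpha) in H; [|lra].
replace (alpha * (kap / alpha * norm u)) with (kap * norm u) in H by (field; lra). exact H.
Qed.

Lemma smooth_diff alpha u : 0 < alpha -> minus u (smooth alpha u) = type_res A alpha 1 (A u).
Proof.
intros Ha. rewrite (Q_A A HA (type_res A) kap HQ) by lra.
assert (E : plus (scal alpha (type_res A alpha 1 u)) (scal 1 (A (type_res A alpha 1 u))) = u).
{ apply (Q_r A (type_res A) kap HQ); lra. }
unfold smooth. rewrite <- E at 1. module_ring.
Qed.

Lemma res_A_bound alpha u : 0 < alpha -> norm (type_res A alpha 1 (A u)) <= (1 + kap) * norm u.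
Proof.
intros Ha. rewrite <- smooth_diff by trivial. eapply Rle_trans; [apply norm_minus_le|].
pose proof (smooth_bound alpha u Ha). lra.
Qed.

Lemma smooth_A_bound alpha u : 0 < alpha ->
    norm (smooth alpha (A u)) <= (1 + kap) * alpha * norm u.
Proof.
intros Ha. unfold smooth. eapply Rle_trans; [apply norm_scal_pos; lra|].
pose proof (res_A_bound alpha u Ha) as H. apply (Rmult_le_compat_l alpha) in H; lra.
Qed.

(** Under the integral, [smooth alpha] composed with [R_s A] is bounded by [kap (1 + kap)] and, when
    the factor [A] is given to [smooth], by [kap (1 + kap) alpha / s]. The crossover [alpha] yields
    [alpha^r]. *)
Lemma smooth_frac_bound alpha r u : 0 < alpha -> 0 < r < 1 ->
  norm (smooth alpha (frac_integral A r u)) <= 2 * (kap * (1 + kap)) * Rpower alpha r * norm u.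
Proof.
intros Ha Hr. rewrite frac_integral_eq, (linear_scal _ (smooth_linear alpha Ha)) by trivial.
pose proof (norm_nonneg u) as Hu.
assert (Hk : 0 <= kap * (1 + kap)) by (apply Rmult_le_pos; lra).
set (f := fun s => smooth alpha (seg_res (type_res A) 1 s (segment A 1 u))).
assert (Ef : forall s, 0 < s -> f s = smooth alpha (type_res A s 1 (A u))).
{ intros s Hs. unfold f, seg_res. f_equal. replace (1 - 1 + s) with s by ring. f_equal.
  unfold segment. module_ring. }
destruct (half_line_weighted f r (kap * (1 + kap) * norm u) alpha) as [l [Hl Hb]]; trivial.
- intros s Hs. apply (continuous_comp (U := R_UniformSpace) (V := X) (W := X)
    (fun s => seg_res (type_res A) 1 s (segment A 1 u)) (smooth alpha)).
  + apply (continuous_res A HA (type_res A) kap Hkap0 HQ); lra.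
  + apply (linear_cont (K := R_AbsRing) (U := X) (V := X)). now apply smooth_linear.
- now apply Rmult_le_pos.
- intros s Hs. rewrite Ef by trivial. eapply Rle_trans; [now apply smooth_bound|].
  rewrite Rmult_assoc. apply Rmult_le_compat_l; [lra|]. now apply res_A_bound.
- intros s Hs. rewrite Ef by trivial.
  rewrite (Q_A A HA (type_res A) kap HQ) by lra.
  eapply Rle_trans; [now apply smooth_A_bound|].
  pose proof (pt_res_bound s u Hs) as H. apply (Rmult_le_compat_l ((1 + kap) * alpha)) in H.
  + eapply Rle_trans; [exact H|]. right. field. lra.
  + apply Rmult_le_pos; lra.
- assert (E : smooth alpha (seg_pow A (type_res A) r 1 u) = l).
  { apply (half_line_unique _ _ _
      (half_line_linear (smooth alpha) _ _ (smooth_linear alpha Ha)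
        (proj1 (seg_pow_half_line A HA (type_res A) kap Hkap0 HQ M HM0 HMA r 1 u Hr
            ltac:(lra))))).
    revert Hl. apply half_line_ext. intros s Hs. unfold f.
    symmetry. apply (linear_scal _ (smooth_linear alpha Ha)). }
  rewrite E. pose proof (beta_int_pos r Hr) as Hbp.
  eapply Rle_trans; [apply norm_scal_pos; left; now apply Rinv_0_lt_compat|].
  apply (Rmult_le_compat_l (/ beta_int r)) in Hb; [|left; now apply Rinv_0_lt_compat].
  eapply Rle_trans; [exact Hb|].
  replace (/ beta_int r * (kap * (1 + kap) * norm u * Rpower alpha r * (/ r + / (1 - r)))) with
    (/ beta_int r * (/ r + / (1 - r)) * (kap * (1 + kap) * norm u * Rpower alpha r)) by ring.
  replace (2 * (kap * (1 + kap)) * Rpower alpha r * norm u) with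
    (2 * (kap * (1 + kap) * norm u * Rpower alpha r)) by ring.
  apply Rmult_le_compat_r; [|now apply inv_beta_int_le].
  apply Rmult_le_pos; [now apply Rmult_le_pos | left; apply Rpower_pos].
Qed.

Lemma iter_smooth_linear m alpha : 0 < alpha -> is_linear (Nat.iter m (smooth alpha)).
Proof. intros. now apply iter_linear, smooth_linear. Qed.

Lemma iter_smooth_A m alpha u : 0 < alpha ->
  Nat.iter m (smooth alpha) (A u) = A (Nat.iter m (smooth alpha) u).
Proof. intros Ha. symmetry. apply iter_commutes. intros x. symmetry. now apply smooth_A. Qed.

Lemma iter_smooth_bound m alpha u : 0 < alpha ->
    norm (Nat.iter m (smooth alpha) u) <= kap ^ m * norm u.
Proof.
intros Ha. induction m as [|m IH]; simpl; [lra|].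
eapply Rle_trans; [now apply smooth_bound|]. rewrite Rmult_assoc. apply Rmult_le_compat_l; lra.
Qed.

(** Each factor [A] is paired with its own [smooth alpha] and gains one [alpha]; the unpaired
    factors only cost powers of [kap]. *)
Lemma iter_smooth_iter_bound m n alpha u : 0 < alpha -> (n <= m)%nat ->
  norm (Nat.iter m (smooth alpha) (Nat.iter n A u)) <= (1 + kap) ^ m * alpha ^ n * norm u.
Proof.
intros Ha. revert n. induction m as [|m IH]; intros n Hn.
- replace n with 0%nat by lia. simpl. lra.
- destruct n as [|n].
  + simpl Nat.iter at 2. eapply Rle_trans; [now apply iter_smooth_bound|].
    apply Rmult_le_compat_r; [apply norm_nonneg|]. rewrite pow_O, Rmult_1_r. apply pow_incr. lra.
  + simpl. rewrite iter_smooth_A by trivial. eapply Rle_trans; [now apply smooth_A_bound|].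
    specialize (IH n ltac:(lia)). apply (Rmult_le_compat_l ((1 + kap) * alpha)) in IH.
    * eapply Rle_trans; [exact IH|]. right. ring.
    * apply Rmult_le_pos; lra.
Qed.

(* Qualification of the iterated Lavrentiev operator [(alpha (A + alpha)^-1)^m]: order [m]. *)
Lemma iter_smooth_pow_bound m : exists C, 0 < C /\ forall alpha p u, 0 < alpha ->
    0 <= p <= INR m ->
  norm (Nat.iter m (smooth alpha) (op_pow A p u)) <= C * Rpower alpha p * norm u.
Proof.
exists (2 * (kap * (1 + kap)) * (1 + kap) ^ m).
assert (H1 : 1 <= kap * (1 + kap)).
{ rewrite <- (Rmult_1_l 1). apply Rmult_le_compat; lra. }
assert (H2 : 0 < (1 + kap) ^ m) by (apply pow_lt; lra).
split; [apply Rmult_lt_0_compat; lra|].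
intros alpha p u Ha Hp. destruct (nat_frac_decomposition p ltac:(lra)) as [n [r [-> Hr]]].
rewrite op_pow_eq by trivial. rewrite Rpower_plus, Rpower_pow by trivial.
assert (Ham : 0 < alpha ^ n) by now apply pow_lt.
pose proof (norm_nonneg u) as Hu.
destruct (Req_dec r 0) as [->|Hr0].
- rewrite frac_pow_0, Rpower_O, Rmult_1_r by trivial.
  assert (Hn : (n <= m)%nat) by (apply INR_le; lra).
  eapply Rle_trans; [now apply iter_smooth_iter_bound|].
  apply Rmult_le_compat_r; trivial. apply Rmult_le_compat_r; [lra|].
  rewrite <- (Rmult_1_l ((1 + kap) ^ m)) at 1. apply Rmult_le_compat_r; lra.
- assert (Hn : (n < m)%nat) by (apply INR_lt; lra).
  (* One smoothing factor is reserved for the fractional part [r], and the remaining ones still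
     suffice for the [n] integer factors, since [n < m] before the split. *)
  destruct m as [|m]; [lia|]. simpl Nat.iter.
  rewrite <- (frac_pow_commutes r (Nat.iter m (smooth alpha))); trivial.
  2:{ now apply iter_smooth_linear. }
  2:{ intros; now apply iter_smooth_A. }
  rewrite frac_pow_pos by lra. eapply Rle_trans; [apply smooth_frac_bound; trivial; lra|].
  pose proof (iter_smooth_iter_bound m n alpha u Ha ltac:(lia)) as IH.
  pose proof (Rpower_pos alpha r) as Hpr.
  apply (Rmult_le_compat_l (2 * (kap * (1 + kap)) * Rpower alpha r)) in IH.
  + eapply Rle_trans; [exact IH|].
    replace (2 * (kap * (1 + kap)) * Rpower alpha r * ((1 + kap) ^ m * alpha ^ n * norm u)) with
      ((1 + kap) ^ m * (2 * (kap * (1 + kap)) * (Rpower alpha r * alpha ^ n * norm u))) by ring.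
    replace (2 * (kap * (1 + kap)) * (1 + kap) ^ S m * (alpha ^ n * Rpower alpha r) * norm u) with
      ((1 + kap) ^ S m * (2 * (kap * (1 + kap)) * (Rpower alpha r * alpha ^ n * norm u))) by ring.
    apply Rmult_le_compat_r.
    * repeat apply Rmult_le_pos; lra.
    * apply Rle_pow; [lra | lia].
  + repeat apply Rmult_le_pos; lra.
Qed.

(** Telescoping [I - S^(m+1) = (I - S^m) + S^m (I - S)] with [I - S = (A + alpha)^-1 A]. *)
Lemma iter_smooth_diff_bound m : exists C, 0 < C /\ forall alpha u, 0 < alpha ->
  norm (minus u (Nat.iter m (smooth alpha) u)) <= C * (norm (A u) / alpha).
Proof.
induction m as [|m [C [HC IH]]].
- exists 1. split; [lra|]. intros alpha u Ha. simpl.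
  replace (norm (minus u u)) with 0.
  + apply Rmult_le_pos; [lra|]. apply Rmult_le_pos; [apply norm_nonneg | left;
      now apply Rinv_0_lt_compat].
  + rewrite <- (norm_zero (K := R_AbsRing) (V := X)). f_equal. module_ring.
- exists (C + kap ^ m * kap). split.
  { apply Rplus_lt_0_compat; trivial. apply Rmult_lt_0_compat; [apply pow_lt|]; lra. }
  intros alpha u Ha.
  replace (minus u (Nat.iter (S m) (smooth alpha) u)) with
    (plus (minus u (Nat.iter m (smooth alpha) u)) (Nat.iter m (smooth alpha) (minus u (smooth
        alpha u)))).
  2:{ rewrite (linear_minus _ _ _ (iter_smooth_linear m alpha Ha)),
      Nat.iter_succ_r. module_ring. }
  eapply Rle_trans; [apply norm_plus_le|].
  pose proof (IH alpha u Ha) as B1.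
  pose proof (iter_smooth_bound m alpha (minus u (smooth alpha u)) Ha) as B2.
  rewrite smooth_diff in B2 at 2 by trivial.
  pose proof (pt_res_bound alpha (A u) Ha) as B3.
  apply (Rmult_le_compat_l (kap ^ m)) in B3; [|left; apply pow_lt; lra].
  eapply Rle_trans; [exact (Rplus_le_compat _ _ _ _ B1 B2)|].
  replace (kap ^ m * (kap / alpha * norm (A u)))
      with (kap ^ m * kap * (norm (A u) / alpha)) in B3 by (field; lra).
  lra.
Qed.

(** * The logarithm and its shifted powers *)

Lemma exp_neg_taylor (lambda : R) : exists C, 0 <= C /\ forall h, 0 <= h <= 1 ->
  Rabs (exp (- (lambda * h)) - 1 + lambda * h) <= C * h ^ 2.
Proof.
exists (lambda ^ 2 * exp (Rabs lambda)).
split; [apply Rmult_le_pos; [apply pow2_ge_0 | left; apply exp_pos]|].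
intros h Hh.
pose proof (taylor_1 (fun h => exp (- (lambda * h))) (fun h => - lambda * exp (- (lambda * h)))
  (fun h => lambda ^ 2 * exp (- (lambda * h))) 0 1 (lambda ^ 2 * exp (Rabs lambda))) as T.
assert (T1 : forall t, 0 <= t <= 1 ->
    is_derive (fun h => exp (- (lambda * h))) t (- lambda * exp (- (lambda * t)))).
{ intros t _. auto_derive; trivial. ring. }
assert (T2 : forall t, 0 <= t <= 1 ->
    is_derive (fun h => - lambda * exp (- (lambda * h))) t (lambda ^ 2 * exp (- (lambda * t)))).
{ intros t _. auto_derive; trivial. ring. }
assert (T3 : forall t, 0 <= t <= 1 ->
    Rabs (lambda ^ 2 * exp (- (lambda * t))) <= lambda ^ 2 * exp (Rabs lambda)).
{ intros t Ht. rewrite Rabs_pos_eq by (apply Rmult_le_pos; [apply pow2_ge_0 | left;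
    apply exp_pos]).
  apply Rmult_le_compat_l; [apply pow2_ge_0|]. apply exp_le_compat.
  pose proof (Rle_abs (- lambda)) as H1. rewrite Rabs_Ropp in H1.
  pose proof (Rabs_pos lambda) as H2.
  apply Rle_trans with (Rabs lambda * t).
  - replace (- (lambda * t)) with (- lambda * t) by ring. apply Rmult_le_compat_r; lra.
  - rewrite <- (Rmult_1_r (Rabs lambda)) at 2. apply Rmult_le_compat_l; lra. }
specialize (T T1 T2 T3 0 h ltac:(lra) Hh).
cbv beta in T. rewrite Rmult_0_r, Ropp_0, exp_0, Rminus_0_r in T.
replace (exp (- (lambda * h)) - 1 + lambda * h)
    with (exp (- (lambda * h)) - 1 - h * (- lambda * 1)) by ring.
exact T.
Qed.

Lemma at_right_0_elim (P : R -> Prop) : at_right 0 P ->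
    exists d, 0 < d /\ forall x, 0 < x < d -> P x.
Proof.
intros [[d Hd] H]. exists d. split; trivial. intros x Hx. apply H; [|lra].
change (Rabs (x - 0) < d). rewrite Rminus_0_r, Rabs_pos_eq; lra.
Qed.

(** The right derivative at [0] of [exp (- lambda h) A^h v] is [- (lambda - log A) v]. The [o(h)]
    form is all that the telescoping needs. *)
Lemma shifted_log_increment (lambda : R) v l : is_op_log A v l ->
  forall eta, 0 < eta -> exists d, 0 < d /\ forall h, 0 < h < d ->
    norm (minus (minus v (scal (exp (- (lambda * h))) (op_pow A h v)))
                (scal h (minus (scal lambda v) l))) <= eta * h.
Proof.
intros Hl eta Heta. destruct (exp_neg_taylor lambda) as [C [HC HT]].
set (E := exp (Rabs lambda)). assert (HE : 0 < E) by apply exp_pos.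
unfold is_op_log in Hl.
apply (proj2 (filterlim_norm_lt (F := at_right 0) _ _)) with (e := eta / (2 * E)) in Hl;
    [|apply Rdiv_lt_0_compat; lra].
apply at_right_0_elim in Hl. destruct Hl as [d0 [Hd0 Hd]].
pose proof (norm_nonneg v) as Hv. pose proof (norm_nonneg l)
    as Hnl. pose proof (Rabs_pos lambda) as Hal.
(* Collects the coefficients of [h^2]; half of [eta] pays for them and the other half for the
   difference quotient. The [1] keeps [D] positive. *)
set (D := C * norm v + (Rabs lambda + C) * norm l + 1).
assert (HD : 0 < D).
{ unfold D. assert (0 <= C * norm v) by now apply Rmult_le_pos.
  assert (0 <= (Rabs lambda + C) * norm l) by (apply Rmult_le_pos; lra). lra. }
exists (Rmin d0 (Rmin 1 (eta / (2 * D)))).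
assert (HeD : 0 < eta / (2 * D)) by (apply Rdiv_lt_0_compat; lra).
split; [repeat apply Rmin_glb_lt; lra|].
intros h [Hh0 Hh]. pose proof (Rmin_l d0 (Rmin 1 (eta / (2 * D)))) as R1.
pose proof (Rmin_r d0 (Rmin 1 (eta / (2 * D)))) as R2.
pose proof (Rmin_l 1 (eta / (2 * D))) as R3. pose proof (Rmin_r 1 (eta / (2 * D))) as R4.
specialize (Hd h ltac:(lra)). specialize (HT h ltac:(lra)).
set (x := scal (/ h) (minus (op_pow A h v) v)) in *.
assert (Ex : op_pow A h v = plus v (scal h x)).
{ unfold x. module_eq; field; lra. }
set (e := exp (- (lambda * h))) in *.
assert (He : 0 < e <= E).
{ split; [apply exp_pos|]. apply exp_le_compat.
  pose proof (Rle_abs (- lambda)) as H1. rewrite Rabs_Ropp in H1.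
  apply Rle_trans with (Rabs lambda * h).
  - replace (- (lambda * h)) with (- lambda * h) by ring. apply Rmult_le_compat_r; lra.
  - rewrite <- (Rmult_1_r (Rabs lambda)) at 2. apply Rmult_le_compat_l; lra. }
(* With [A^h v = v + h x] the error splits into the Taylor remainder of the exponential, the change
   of the weight on [l], and the deviation of the difference quotient [x] from [l]. *)
eapply Rle_trans with (norm (plus (plus (scal (- (e - 1 + lambda * h)) v) (scal (h * (1 - e))
    l)) (scal (- (h * e)) (minus x l)))).
{ right. f_equal. rewrite Ex. clearbody x. module_ring. }
assert (Hh2 : C * h ^ 2 <= C * h).
{ apply Rmult_le_compat_l; trivial. simpl. rewrite Rmult_1_r. rewrite <- (Rmult_1_r h) at 3.
    apply Rmult_le_compat_l; lra. }
assert (B1 : norm (scal (- (e - 1 + lambda * h)) v) <= C * h ^ 2 * norm v).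
{ eapply Rle_trans; [apply norm_scal_le|]. rewrite Rabs_Ropp. now apply Rmult_le_compat_r. }
assert (Be : Rabs (1 - e) <= (Rabs lambda + C) * h).
{ replace (1 - e) with (- (e - 1 + lambda * h) + lambda * h) by ring.
  eapply Rle_trans; [apply Rabs_triang|]. rewrite Rabs_Ropp, Rabs_mult,
      (Rabs_pos_eq h) by lra. lra. }
assert (B2 : norm (scal (h * (1 - e)) l) <= h * ((Rabs lambda + C) * h) * norm l).
{ eapply Rle_trans; [apply norm_scal_le|]. rewrite Rabs_mult, (Rabs_pos_eq h) by lra.
  apply Rmult_le_compat_r; trivial. apply Rmult_le_compat_l; lra. }
assert (B3 : norm (scal (- (h * e)) (minus x l)) <= h * (eta / 2)).
{ eapply Rle_trans; [apply norm_scal_le|]. rewrite Rabs_Ropp, Rabs_mult, (Rabs_pos_eq h),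
    (Rabs_pos_eq e) by lra.
  rewrite Rmult_assoc. apply Rmult_le_compat_l; [lra|].
  apply Rle_trans with (E * (eta / (2 * E))).
  - apply Rmult_le_compat; [lra | apply norm_nonneg | lra | left; exact Hd].
  - right. field. lra. }
eapply Rle_trans; [apply norm_plus_le|].
eapply Rle_trans; [apply Rplus_le_compat_r; apply norm_plus_le|].
eapply Rle_trans; [exact (Rplus_le_compat _ _ _ _ (Rplus_le_compat _ _ _ _ B1 B2) B3)|].
assert (HhD : h * D <= eta / 2).
{ apply Rle_trans with (eta / (2 * D) * D); [apply Rmult_le_compat_r; lra|]. right. field. lra. }
apply (Rmult_le_compat_l h) in HhD; [|lra]. unfold D in HhD.
assert (0 <= h * h) by (apply Rmult_le_pos; lra). simpl. lra.
Qed.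

(* Discrete form of [v = exp (- lambda H) A^H v + int_0^H exp (- lambda s) A^s (lambda - log A) v ds]:
   telescope along a subdivision of [[0, H]], whose mesh tends to [0]. *)
Lemma laplace_bound (P : X -> X) (lambda p H ell K B : R) (v l : X) :
  is_linear P -> is_op_log A v l -> 0 <= p -> 0 < H -> 0 < ell -> 0 <= K -> 0 <= B ->
  (forall s x, 0 <= s <= H -> norm (P (op_pow A (p + s) x)) <= K * exp (- (ell * s)) * norm x) ->
  (forall s, 0 <= s <= H ->
     norm (P (op_pow A (p + s) (minus (scal lambda v) l))) <= B * exp (- (ell * s))) ->
  norm (P (op_pow A p v)) <=
    exp (- (lambda * H)) * norm (P (op_pow A (p + H) v)) + exp (Rabs lambda * H) * B / ell.
Proof.
intros HP Hl Hp HH Hell HK HB HKs HBs.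
set (E := exp (Rabs lambda * H)). assert (HE : 0 < E) by apply exp_pos.
set (v1 := minus (scal lambda v) l) in *.
assert (Hell' : 0 < / ell) by now apply Rinv_0_lt_compat.
apply le_epsilon. intros eps Heps.
set (W := E * B + E * K * / ell + E * K + 1).
assert (HEB : 0 <= E * B) by (apply Rmult_le_pos; lra).
assert (HEK : 0 <= E * K) by (apply Rmult_le_pos; lra).
assert (HEKl : 0 <= E * K * / ell) by (apply Rmult_le_pos; lra).
assert (HW : 0 < W) by (unfold W; lra).
set (eta := Rmin 1 (eps / W)).
assert (Heta : 0 < eta) by (apply Rmin_glb_lt; [lra | now apply Rdiv_lt_0_compat]).
assert (Heta1 : eta <= 1) by apply Rmin_l.
assert (HetaW : eta * W <= eps).
{ apply Rle_trans with (eps / W * W); [apply Rmult_le_compat_r;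
    [lra | apply Rmin_r]|]. right. field. lra. }
destruct (shifted_log_increment lambda v l Hl eta Heta) as [d0 [Hd0 Hd]]. fold v1 in Hd.
assert (Hm : 0 < Rmin d0 eta) by (apply Rmin_glb_lt; lra).
destruct (INR_archimed (Rmin d0 eta) H Hm) as [N0 HN0].
set (N := S N0). assert (HN : 0 < INR N) by (apply lt_0_INR; unfold N; lia).
set (h := H / INR N). assert (Hh : 0 < h) by now apply Rdiv_lt_0_compat.
assert (HhN : INR N * h = H) by (unfold h; field; lra).
assert (Hhm : h < Rmin d0 eta).
{ unfold h. apply Rmult_lt_reg_r with (INR N); trivial.
  replace (H / INR N * INR N) with H by (field; lra).
  unfold N. rewrite S_INR. lra. }
pose proof (Rmin_l d0 eta) as Rm1. pose proof (Rmin_r d0 eta) as Rm2.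
set (D := E * (B + K * eta)).
assert (HD : 0 <= D).
{ apply Rmult_le_pos; [lra|]. apply Rplus_le_le_0_compat; trivial. apply Rmult_le_pos; lra. }
set (g := fun k => exp (- (lambda * (INR k * h))) * norm (P (op_pow A (p + INR k * h) v))).
(* Replaces the geometric sum: from [1 + ell h <= exp (ell h)] follows
   [G k - G (S k) >= h exp (- ell k h)], so summing the error terms telescopes. *)
set (G := fun k => exp (- (ell * (INR k * h))) * (/ ell + h)).
assert (Hstep : forall k, (k < N)%nat -> g k <= g (S k) + D * (G k - G (S k))).
{ intros k Hk. set (s := INR k * h).
  assert (Hs : 0 <= s <= H).
  { unfold s. pose proof (pos_INR k). split; [apply Rmult_le_pos; lra|].
    rewrite <- HhN. apply Rmult_le_compat_r; [lra|]. apply le_INR. lia. }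
  assert (HSk : INR (S k) * h = s + h) by (rewrite S_INR; unfold s; ring).
  unfold g, G. rewrite HSk. fold s.
  pose proof (Hd h ltac:(lra)) as Hrem.
  set (rem := minus (minus v (scal (exp (- (lambda * h))) (op_pow A h v))) (scal h v1)) in *.
  (* After [P A^(p+s)] is applied, the first term becomes the next [g], the second is one slice of
     the integral, and the third is negligible as the mesh shrinks. *)
  assert (Ev : v = plus (plus (scal (exp (- (lambda * h))) (op_pow A h v)) (scal h v1)) rem).
  { unfold rem. module_ring. }
  assert (L : is_linear (fun x => P (op_pow A (p + s) x))).
  { apply (is_linear_comp (op_pow A (p + s)) P); trivial. apply op_pow_linear. lra. }
  assert (B0 : norm (P (op_pow A (p + s) v)) <=
    exp (- (lambda * h)) * norm (P (op_pow A (p + (s + h)) v)) + h * (B * exp (- (ell * s)))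
    + K * exp (- (ell * s)) * (eta * h)).
  { rewrite Ev at 1.
    pose proof (linear_plus _ L (plus (scal (exp (- (lambda * h))) (op_pow A h v)) (scal h v1))
        rem) as L1.
    pose proof (linear_plus _ L (scal (exp (- (lambda * h))) (op_pow A h v)) (scal h v1)) as L2.
    pose proof (linear_scal _ L (exp (- (lambda * h))) (op_pow A h v)) as L3.
    pose proof (linear_scal _ L h v1) as L4.
    cbv beta in L1, L2, L3, L4.
    eapply Rle_trans; [right; apply f_equal; exact L1|].
    eapply Rle_trans; [apply norm_plus_le|]. apply Rplus_le_compat.
    - eapply Rle_trans; [right; apply f_equal; exact L2|].
      eapply Rle_trans; [apply norm_plus_le|]. apply Rplus_le_compat.
      + eapply Rle_trans; [right; apply f_equal; exact L3|].
        eapply Rle_trans; [apply norm_scal_pos; left; apply exp_pos|].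
        replace (p + (s + h)) with (p + s + h) by ring. rewrite (op_pow_plus (p + s) h) by lra.
        apply Rle_refl.
      + eapply Rle_trans; [right; apply f_equal; exact L4|].
        eapply Rle_trans; [apply norm_scal_pos; lra|]. apply Rmult_le_compat_l;
            [lra|]. now apply HBs.
    - eapply Rle_trans; [now apply HKs|]. apply Rmult_le_compat_l; trivial.
      apply Rmult_le_pos; [lra | left; apply exp_pos]. }
  assert (HEs : exp (- (lambda * s)) <= E).
  { apply exp_le_compat. pose proof (Rle_abs (- lambda)) as H1. rewrite Rabs_Ropp in H1.
    apply Rle_trans with (Rabs lambda * s).
    - replace (- (lambda * s)) with (- lambda * s) by ring. apply Rmult_le_compat_r; lra.
    - apply Rmult_le_compat_l; [apply Rabs_pos | lra]. }
  pose proof (exp_pos (- (lambda * s))) as Hes. pose proof (exp_pos (- (ell * s))) as Hls.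
  apply (Rmult_le_compat_l (exp (- (lambda * s)))) in B0; [|lra].
  assert (HG : exp (- (ell * s)) * h <=
     exp (- (ell * s)) * (/ ell + h) - exp (- (ell * (s + h))) * (/ ell + h)).
  { replace (- (ell * (s + h))) with (- (ell * s) + - (ell * h)) by ring. rewrite exp_plus.
    assert (Hx : exp (- (ell * h)) * (/ ell + h) <= / ell).
    { pose proof (exp_ineq1_le (ell * h)) as H1.
      assert (Helh : 0 < ell * h) by now apply Rmult_lt_0_compat.
      rewrite exp_Ropp. apply Rmult_le_reg_l with (exp (ell * h) * ell).
      - apply Rmult_lt_0_compat; [apply exp_pos | trivial].
      - replace (exp (ell * h) * ell * (/ exp (ell * h) * (/ ell + h))) with (1 + ell * h)
          by (field; split; [lra | apply Rgt_not_eq, exp_pos]).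
        replace (exp (ell * h) * ell * / ell) with (exp (ell * h)) by (field; lra). exact H1. }
    apply (Rmult_le_compat_l (exp (- (ell * s)))) in Hx; lra. }
  apply (Rmult_le_compat_l D) in HG; trivial.
  replace (- (lambda * (s + h))) with (- (lambda * s) + - (lambda * h)) by ring. rewrite exp_plus.
  assert (Hfin : exp (- (lambda * s)) * (exp (- (ell * s)) * h * (B + K * eta)) <=
                 E * (exp (- (ell * s)) * h * (B + K * eta))).
  { apply Rmult_le_compat_r; trivial. apply Rmult_le_pos; [apply Rmult_le_pos; lra|].
    apply Rplus_le_le_0_compat; trivial. apply Rmult_le_pos; lra. }
  unfold D in *. lra. }
assert (Htel : forall k, (k <= N)%nat -> g 0%nat <= g k + D * (G 0%nat - G k)).
{ induction k as [|k IH]; intros Hk; [lra|].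
  specialize (IH ltac:(lia)). specialize (Hstep k ltac:(lia)). lra. }
specialize (Htel N ltac:(lia)). unfold g, G in Htel. rewrite HhN in Htel.
simpl (INR 0) in Htel. rewrite Rmult_0_l, !Rmult_0_r, Ropp_0, exp_0, Rplus_0_r,
    !Rmult_1_l in Htel.
assert (HGN : 0 <= D * (exp (- (ell * H)) * (/ ell + h))).
{ apply Rmult_le_pos; trivial. apply Rmult_le_pos; [left; apply exp_pos | lra]. }
assert (HDh : D * (/ ell + h) <= D * (/ ell + eta)) by (apply Rmult_le_compat_l; lra).
assert (Hlast : D * (/ ell + eta) <= E * B / ell + eps).
{ apply Rle_trans with (E * B / ell + eta * W); [|lra]. unfold D, W, Rdiv.
  assert (0 <= E * K * eta * (1 - eta)) by (repeat apply Rmult_le_pos; lra).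
  lra. }
lra.
Qed.

Lemma is_op_log_unique v l1 l2 : is_op_log A v l1 -> is_op_log A v l2 -> l1 = l2.
Proof.
intros H1 H2.
apply (filterlim_locally_unique (K := R_AbsRing) (V := X) (F := at_right 0) _ _ _ H1 H2).
Qed.

Lemma op_log_correct v : dom_log A v -> is_op_log A v (op_log A v).
Proof.
intros [l Hl]. unfold op_log. apply (iota_correct (V := X) (is_op_log A v)).
exists l. split; trivial. intros l' Hl'. now apply (is_op_log_unique v).
Qed.

Lemma is_op_log_comb v1 v2 l1 l2 (a b : R) : is_op_log A v1 l1 -> is_op_log A v2 l2 ->
  is_op_log A (plus (scal a v1) (scal b v2)) (plus (scal a l1) (scal b l2)).
Proof.
intros H1 H2. unfold is_op_log in *.
apply (filterlim_ext_loc (F := at_right 0)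
  (fun p => plus (scal a (scal (/ p) (minus (op_pow A p v1) v1))) (scal b (scal (/ p) (minus
      (op_pow A p v2) v2))))).
- apply (at_right_0_intro _ 1); [lra|]. intros p Hp.
  pose proof (op_pow_linear p ltac:(lra)) as L.
  rewrite (linear_plus _ L), !(linear_scal _ L). module_ring.
- eapply filterlim_comp_2.
  + eapply filterlim_comp; [exact H1 | apply (filterlim_scal_r (K := R_AbsRing) (V := X))].
  + eapply filterlim_comp; [exact H2 | apply (filterlim_scal_r (K := R_AbsRing) (V := X))].
  + apply (filterlim_plus (K := R_AbsRing) (V := X)).
Qed.

(** [op_log] is a description operator, so its linearity on the domain comes from uniqueness of
    limits. *)
Lemma dom_log_pow_comb k v1 v2 (a b : R) : dom_log_pow A k v1 -> dom_log_pow A k v2 ->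
  dom_log_pow A k (plus (scal a v1) (scal b v2)).
Proof.
revert v1 v2. induction k as [|k IH]; intros v1 v2; simpl; trivial.
intros [D1 P1] [D2 P2].
pose proof (is_op_log_comb _ _ _ _ a b (op_log_correct v1 D1) (op_log_correct v2 D2)) as H.
assert (D : dom_log A (plus (scal a v1) (scal b v2))) by (eexists; exact H).
split; trivial.
rewrite (is_op_log_unique _ _ _ (op_log_correct _ D) H). now apply IH.
Qed.

Lemma dom_log_pow_S k v : dom_log_pow A (S k) v -> dom_log_pow A k v.
Proof.
revert v. induction k as [|k IH]; intros v; [now simpl|].
intros [H1 H2]. split; trivial. now apply IH.
Qed.

Lemma dom_log_pow_shifted k v (lambda : R) : dom_log_pow A (S k) v ->
  dom_log_pow A k (minus (scal lambda v) (op_log A v)).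
Proof.
intros H. replace (minus (scal lambda v) (op_log A v)) with
  (plus (scal lambda v) (scal (-1) (op_log A v))) by module_ring.
apply dom_log_pow_comb; [now apply dom_log_pow_S | apply H].
Qed.

(** The Laplace representation over [[0, n]] with [P] the identity and [p = 0]. Its boundary term is
    at most [(m exp (- lambda))^n |v| <= |v| / 2] and is absorbed on the left, whence the factor
    [2]. *)
Lemma shifted_log_resolvent_bound (lambda m : R) :
  0 <= m -> (forall x, norm (A x) <= m * norm x) -> m < exp lambda ->
  exists C, 0 < C /\ forall v, dom_log A v ->
    norm v <= C * norm (minus (scal lambda v) (op_log A v)).
Proof.
intros Hm HmA Hlm.
assert (He : 0 < exp (- lambda)) by apply exp_pos.
assert (Hr : 0 <= m * exp (- lambda) < 1).
{ split; [apply Rmult_le_pos; lra|].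
  replace 1 with (exp lambda * exp (- lambda)).
  - now apply Rmult_lt_compat_r.
  - rewrite <- exp_plus, Rplus_opp_r. apply exp_0. }
destruct (pow_lt_1_zero (m * exp (- lambda))) with (y := / 2) as [N0 HN0]; [rewrite Rabs_pos_eq;
    lra | lra |].
specialize (HN0 (S N0) ltac:(lia)). set (n := S N0) in *.
rewrite Rabs_pos_eq in HN0 by (apply pow_le; lra).
assert (Hn : 0 < INR n) by (apply lt_0_INR; unfold n; lia).
destruct (op_pow_bound n) as [C [HC HCb]].
set (E := exp (Rabs lambda * INR n)). assert (HE : 0 < E) by apply exp_pos.
exists (2 * E * (C * exp (INR n))).
split; [repeat apply Rmult_lt_0_compat; try lra; apply exp_pos|].
intros v Hv. pose proof (op_log_correct v Hv) as Hl. set (l := op_log A v) in *.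
set (v1 := minus (scal lambda v) l).
(* There is no decay to exploit here: the rate [ell] is set to [1] and compensated by the constant
   [exp (INR n)]. *)
assert (Hs : forall s x, 0 <= s <= INR n ->
    norm (op_pow A (0 + s) x) <= C * exp (INR n) * exp (- (1 * s)) * norm x).
{ intros s x Hs. rewrite Rplus_0_l. eapply Rle_trans; [now apply HCb|].
  apply Rmult_le_compat_r; [apply norm_nonneg|].
  rewrite Rmult_assoc, <- exp_plus. rewrite <- (Rmult_1_r C) at 1. apply Rmult_le_compat_l;
      [lra|].
  assert (H0 : exp 0 <= exp (INR n + - (1 * s))) by (apply exp_le_compat; lra).
  rewrite exp_0 in H0. exact H0. }
pose proof (laplace_bound (fun x => x) lambda 0 (INR n) 1 (C * exp (INR n)) (C * exp (INR n) *
    norm v1) v l) as LB.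
specialize (LB is_linear_id Hl ltac:(lra) Hn ltac:(lra)).
assert (HCe : 0 <= C * exp (INR n)) by (apply Rmult_le_pos; [lra | left; apply exp_pos]).
specialize (LB HCe ltac:(apply Rmult_le_pos; [trivial | apply norm_nonneg]) Hs).
assert (Hs1 : forall s, 0 <= s <= INR n ->
    norm (op_pow A (0 + s) v1) <= C * exp (INR n) * norm v1 * exp (- (1 * s))).
{ intros s Hs'. pose proof (Hs s v1 Hs'). lra. }
specialize (LB Hs1).
assert (E0 : op_pow A 0 v = v) by (apply (op_pow_nat 0)).
rewrite E0, Rplus_0_l, op_pow_nat in LB. fold E in LB. rewrite Rdiv_1_r in LB.
assert (HA' : norm (Nat.iter n A v) <= m ^ n * norm v).
{ clear - HmA Hm. induction n as [|k IH]; simpl; [lra|]. eapply Rle_trans; [apply HmA|].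
  rewrite Rmult_assoc. now apply Rmult_le_compat_l. }
assert (Hexp : exp (- (lambda * INR n)) = exp (- lambda) ^ n).
{ rewrite <- Rpower_pow by trivial. unfold Rpower. rewrite ln_exp. f_equal. ring. }
rewrite Hexp in LB.
apply (Rmult_le_compat_l (exp (- lambda) ^ n)) in HA'; [|apply pow_le; lra].
rewrite <- Rmult_assoc, <- Rpow_mult_distr, (Rmult_comm (exp (- lambda))) in HA'.
pose proof (norm_nonneg v) as Hnv.
assert ((m * exp (- lambda)) ^ n * norm v <= / 2 * norm v) by (apply Rmult_le_compat_r; lra).
fold v1. lra.
Qed.

(** Raise [x / k <= exp (x / k)] to the power [k]. It serves to trade a factor [alpha] for any power
    of [1 / ln (/ alpha)]. *)
Lemma pow_mul_exp_neg_le k x : 0 <= x -> x ^ k * exp (- x) <= INR k ^ k.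
Proof.
intros Hx. rewrite exp_Ropp. pose proof (exp_pos x) as He.
apply Rmult_le_reg_r with (exp x); trivial.
replace (x ^ k * / exp x * exp x) with (x ^ k) by (field; lra).
destruct k as [|k]; [simpl; rewrite Rmult_1_l; pose proof (exp_ineq1_le x); lra|].
set (n := S k). assert (Hn : 0 < INR n) by (apply lt_0_INR; unfold n; lia).
assert (E : exp x = exp (x / INR n) ^ n).
{ rewrite <- Rpower_pow by apply exp_pos. unfold Rpower. rewrite ln_exp. f_equal. field. lra. }
rewrite E, <- Rpow_mult_distr. apply pow_incr. split; trivial.
pose proof (exp_ineq1_le (x / INR n)) as H1.
apply Rle_trans with (INR n * (x / INR n)); [right; field; lra|].
apply Rmult_le_compat_l; lra.
Qed.

Lemma shifted_log_pow_S (lambda : R) k v :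
  shifted_log_pow A lambda (S k) v = shifted_log_pow A lambda k (minus (scal lambda v) (op_log A
      v)).
Proof. unfold shifted_log_pow. now rewrite Nat.iter_succ_r. Qed.

Lemma shifted_log_pow_bound (lambda m : R) (k : nat) :
  0 <= m -> (forall x, norm (A x) <= m * norm x) -> m < exp lambda ->
  exists C, 0 < C /\ forall v, dom_log_pow A k v ->
      norm v <= C * norm (shifted_log_pow A lambda k v).
Proof.
intros Hm HmA Hlm. destruct (shifted_log_resolvent_bound lambda m Hm HmA Hlm) as [C [HC H]].
exists (C ^ k). split; [now apply pow_lt|].
induction k as [|k IH]; intros v Hv; [unfold shifted_log_pow; simpl; lra|].
rewrite shifted_log_pow_S.
eapply Rle_trans; [apply H; apply Hv|]. simpl pow. rewrite Rmult_assoc.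
apply Rmult_le_compat_l; [lra|]. apply IH. now apply dom_log_pow_shifted.
Qed.

(* Induction on [k] by [laplace_bound] with [H = 1]; each step uses up one unit of the
   qualification [n]. *)
Lemma iter_smooth_log_bound (lambda m p : R) (n k : nat) :
  0 <= m -> (forall x, norm (A x) <= m * norm x) -> m < exp lambda -> 0 <= p ->
  forall T, 0 <= T -> p + T + INR k <= INR n ->
  exists C, 0 < C /\ forall alpha v t, 0 < alpha < 1 -> dom_log_pow A k v -> 0 <= t <= T ->
    norm (Nat.iter n (smooth alpha) (op_pow A (p + t) v)) <=
    C * Rpower alpha (p + t) * / ln (/ alpha) ^ k * norm (shifted_log_pow A lambda k v).
Proof.
intros Hm HmA Hlm Hp.
destruct (iter_smooth_pow_bound n) as [Cn [HCn Hsm]].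
induction k as [|k IH]; intros T HT Hn.
- exists Cn. split; trivial. intros alpha v t Ha _ Ht. simpl in *.
  rewrite Rinv_1, Rmult_1_r. apply Hsm; lra.
- rewrite S_INR in Hn.
  (* The integrand has order [t + s] with [s <= 1], hence the longer interval. *)
  destruct (IH (T + 1) ltac:(lra) ltac:(lra)) as [Ck [HCk Hk]].
  destruct (shifted_log_pow_bound lambda m (S k) Hm HmA Hlm) as [Cr [HCr Hr]].
  set (E := exp (Rabs lambda)). assert (HE : 0 < E) by apply exp_pos.
  (* The first summand comes from the boundary term at [1], the second from the integral, which
     gains one factor [1 / ell] over the induction hypothesis. *)
  exists (E * Cn * Cr * INR (S k) ^ S k + E * Ck).
  assert (HSk : 0 < INR (S k) ^ S k) by (apply pow_lt, lt_0_INR; lia).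
  split.
  { apply Rplus_lt_0_compat; [apply Rmult_lt_0_compat; trivial|];
      repeat apply Rmult_lt_0_compat; trivial. }
  intros alpha v t Ha Hv Ht.
  set (ell := ln (/ alpha)).
  assert (Eell : ell = - ln alpha) by (unfold ell; apply ln_Rinv; lra).
  assert (Hell : 0 < ell).
  { rewrite Eell. assert (ln alpha < ln 1) by (apply ln_increasing;
      lra). rewrite ln_1 in H. lra. }
  set (w := shifted_log_pow A lambda (S k) v).
  pose proof (norm_nonneg w) as Hw.
  assert (Ew : shifted_log_pow A lambda k (minus (scal lambda v) (op_log A v)) = w).
  { symmetry. apply shifted_log_pow_S. }
  assert (Hpow : forall s, Rpower alpha (p + t + s) = Rpower alpha (p + t) * exp (- (ell * s))).
  { intros s. rewrite Rpower_plus. f_equal. unfold Rpower. f_equal. rewrite Eell. ring. }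
  pose proof (Rpower_pos alpha (p + t)) as Hpt.
  assert (Hellk : 0 < ell ^ k) by now apply pow_lt.
  assert (Hik : 0 < / ell ^ k) by now apply Rinv_0_lt_compat.
  pose proof (laplace_bound (Nat.iter n (smooth alpha)) lambda (p + t) 1 ell
    (Cn * Rpower alpha (p + t)) (Ck * Rpower alpha (p + t) * / ell ^ k * norm w) v (op_log A v)
    (iter_smooth_linear n alpha ltac:(lra)) (op_log_correct v (proj1 Hv)) ltac:(lra) ltac:(lra)
        Hell) as LB.
  specialize (LB ltac:(apply Rmult_le_pos; lra) ltac:(repeat apply Rmult_le_pos; lra)).
  assert (LB1 : forall s x, 0 <= s <= 1 ->
      norm (Nat.iter n (smooth alpha) (op_pow A (p + t + s) x)) <=
     Cn * Rpower alpha (p + t) * exp (- (ell * s)) * norm x).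
  { intros s x Hs. eapply Rle_trans; [apply Hsm; [lra|]|].
    - pose proof (pos_INR k). lra.
    - right. rewrite Hpow. ring. }
  assert (LB2 : forall s, 0 <= s <= 1 ->
    norm (Nat.iter n (smooth alpha) (op_pow A (p + t + s) (minus (scal lambda v) (op_log A v))))
        <=
    Ck * Rpower alpha (p + t) * / ell ^ k * norm w * exp (- (ell * s))).
  { intros s Hs. replace (p + t + s) with (p + (t + s)) at 1 by ring.
    eapply Rle_trans; [apply (Hk alpha _ (t + s) Ha); [now apply dom_log_pow_shifted | lra]|].
    right. rewrite Ew. replace (p + (t + s))
        with (p + t + s) by ring. rewrite Hpow. unfold ell. ring. }
  specialize (LB LB1 LB2). rewrite !Rmult_1_r in LB. fold E in LB.
  assert (HEl : exp (- lambda) <= E).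
  { apply exp_le_compat. pose proof (Rle_abs (- lambda)) as H1. now rewrite Rabs_Ropp in H1. }
  pose proof (LB1 1 v ltac:(lra)) as B1. rewrite Rmult_1_r in B1.
  pose proof (Hr v Hv) as B2. fold w in B2.
  pose proof (pow_mul_exp_neg_le (S k) ell ltac:(lra)) as B3.
  assert (HellS : 0 < ell ^ S k) by now apply pow_lt.
  (* Here [exp (- ell)] is [alpha], the surplus factor of the boundary term; it is weakened to the
     logarithmic order of the other term. *)
  assert (B4 : exp (- ell) <= INR (S k) ^ S k * / ell ^ S k).
  { apply Rmult_le_reg_r with (ell ^ S k); trivial.
    replace (INR (S k) ^ S k * / ell ^ S k * ell ^ S k) with (INR (S k) ^ S k) by (field; lra).
    rewrite Rmult_comm. exact B3. }
  pose proof (exp_pos (- ell)) as Hel.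
  assert (B5 : norm (Nat.iter n (smooth alpha) (op_pow A (p + t + 1) v)) <=
    Cn * Rpower alpha (p + t) * (INR (S k) ^ S k * / ell ^ S k) * (Cr * norm w)).
  { eapply Rle_trans; [exact B1|]. apply Rmult_le_compat; trivial.
    - repeat apply Rmult_le_pos; lra.
    - apply norm_nonneg.
    - apply Rmult_le_compat_l; trivial. apply Rmult_le_pos; lra. }
  assert (B6 : exp (- lambda) * norm (Nat.iter n (smooth alpha) (op_pow A (p + t + 1) v)) <=
    E * (Cn * Rpower alpha (p + t) * (INR (S k) ^ S k * / ell ^ S k) * (Cr * norm w))).
  { apply Rmult_le_compat; trivial; [left; apply exp_pos | apply norm_nonneg]. }
  eapply Rle_trans; [exact LB|].
  eapply Rle_trans; [apply Rplus_le_compat_r; exact B6|].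
  right. simpl pow. field. split; apply Rgt_not_eq; trivial.
Qed.

End FractionalPowers.

(** * The logarithmic source condition *)

(* The choice [alpha = c (t log(1/t)^nu)^(1/(p+1))] balances the two terms. *)
Lemma balanced_parameter (p : R) (nu : nat) : 0 <= p -> (1 <= nu)%nat ->
  exists C, 0 < C /\ forall t, 0 < t < 1 -> exists alpha, 0 < alpha < 1 /\
    Rpower alpha p * / ln (/ alpha) ^ nu <= C * log_rate p nu t /\
    t / alpha <= C * log_rate p nu t.
Proof.
intros Hp Hnu.
set (n := INR nu). assert (Hn : 1 <= n) by (apply (le_INR 1); trivial).
(* From [ln x <= x] at [x = L / (2 n)]: [n ln L <= L / 2 + c1], so the logarithmic correction uses
   at most half of [L] up to a constant. *)
set (c1 := n * ln (2 * n)).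
assert (Hc1 : 0 <= c1).
{ apply Rmult_le_pos; [lra|]. rewrite <- ln_1. apply ln_le; lra. }
assert (Hi : 0 < / (p + 1)) by (apply Rinv_0_lt_compat; lra).
set (c0 := c1 * / (p + 1)). assert (Hc0 : 0 <= c0) by (apply Rmult_le_pos; lra).
(* The cost of replacing [ln (/ alpha)] by its lower bound [L / (2 (p + 1))]. *)
set (c2 := n * ln (2 * (p + 1))).
assert (Hc2 : 0 <= c2).
{ apply Rmult_le_pos; [lra|]. rewrite <- ln_1. apply ln_le; lra. }
exists (exp (c0 + c2)). split; [apply exp_pos|].
intros t Ht.
set (L := - ln t).
assert (HL : 0 < L).
{ unfold L. assert (ln t < ln 1) by (apply ln_increasing; lra). rewrite ln_1 in H. lra. }
set (y := ln L).
assert (Hy : n * y <= L / 2 + c1).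
{ assert (Hl : ln (L / (2 * n)) <= L / (2 * n)).
  { assert (Hq : 0 < L / (2 * n)) by (apply Rdiv_lt_0_compat; lra).
    pose proof (exp_ineq1_le (ln (L / (2 * n)))) as H1. rewrite exp_ln in H1 by trivial. lra. }
  unfold Rdiv in Hl. rewrite ln_mult, ln_Rinv in Hl by (try apply Rinv_0_lt_compat; lra).
  fold y in Hl. apply (Rmult_le_compat_l n) in Hl; [|lra].
  replace (n * (L * / (2 * n))) with (L / 2) in Hl by (field; lra). unfold c1. lra. }
(* [a] is [ln alpha], with [L = ln (1 / t)] and [y = ln L]. The shift [c0] is just large enough that
   [- a >= L / (2 (p + 1))], so [alpha < 1] for every [t] in []0, 1[]. *)
set (a := (- L + n * y) * / (p + 1) - c0).
assert (Ha : a <= - (L / (2 * (p + 1)))).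
{ unfold a, c0. replace (- (L / (2 * (p + 1))))
    with ((- L + (L / 2 + c1)) * / (p + 1) - c1 * / (p + 1)) by (field; lra).
  apply Rplus_le_compat_r. apply Rmult_le_compat_r; lra. }
assert (HL2 : 0 < L / (2 * (p + 1))) by (apply Rdiv_lt_0_compat; lra).
assert (Erate : log_rate p nu t = exp (- (L * p * / (p + 1)) - n * y * / (p + 1))).
{ unfold log_rate. destruct (Req_EM_T t 0); [lra|].
  unfold Rpower. rewrite <- exp_plus. f_equal.
  replace (1 / t) with (/ t) by (field; lra). rewrite ln_Rinv by lra. fold L y n.
  replace (ln t) with (- L) by (unfold L; ring). field. lra. }
exists (exp a). split; [|split].
- split; [apply exp_pos|]. rewrite <- exp_0. apply exp_increasing. lra.
- rewrite ln_Rinv, ln_exp by apply exp_pos.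
  assert (Hna : 0 < - a) by lra.
  assert (Hly : y - ln (2 * (p + 1)) <= ln (- a)).
  { replace (y - ln (2 * (p + 1))) with (ln (L / (2 * (p + 1)))).
    - apply ln_le; lra.
    - unfold Rdiv. rewrite ln_mult, ln_Rinv by (try apply Rinv_0_lt_compat; lra). reflexivity. }
  apply (Rmult_le_compat_l n) in Hly; [|lra].
  rewrite <- (Rpower_pow nu) by trivial. rewrite <- Rpower_Ropp. fold n.
  unfold Rpower. rewrite ln_exp, Erate, <- !exp_plus. apply exp_le_compat.
  assert (Hpa : p * a <= p * ((- L + n * y) * / (p + 1))).
  { apply Rmult_le_compat_l; trivial. unfold a. lra. }
  apply Rle_trans with (p * ((- L + n * y) * / (p + 1)) + (- (n * y) + c2)); [unfold c2; lra|].
  replace (p * ((- L + n * y) * / (p + 1)) + (- (n * y) + c2)) with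
    (c2 + (- (L * p * / (p + 1)) - n * y * / (p + 1))) by (field; lra).
  lra.
- unfold Rdiv. rewrite <- exp_Ropp. rewrite <- (exp_ln t) by lra. rewrite <- exp_plus.
  rewrite (exp_ln t) by lra.
  rewrite Erate, <- exp_plus. apply exp_le_compat.
  replace (ln t) with (- L) by (unfold L; ring).
  replace (- L + - a) with (c0 + (- (L * p * / (p + 1)) - n * y * / (p + 1))) by (unfold a;
      field; lra).
  lra.
Qed.

Theorem theorem8 :
  forall (X : CompleteNormedModule R_AbsRing) (A : X -> X),
    is_linear A ->
    positive_type A ->
    Injective A ->
    unbounded_inverse A ->
    forall (p : R) (nu : nat) (delta0 lambda : R),
      0 <= p ->
      (1 <= nu)%nat ->
      0 < delta0 < 1 ->
      ln (real (op_norm A)) < lambda ->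
      exists c : R, 0 < c /\
        forall u v w : X,
          u = op_pow A p v ->
          dom_log_pow A nu v ->
          norm (A u) <= delta0 ->
          w = shifted_log_pow A lambda nu v ->
          norm u <= c * Rmax (norm w) 1 * log_rate p nu (norm (A u)).
Proof.
intros X A HA HP HI _ p nu delta0 lambda Hp Hnu Hd0 Hlam.
destruct (positive_type_resolvent A HA HP) as [kap [Hkap HQ]].
destruct (op_norm_linear A HA) as [Hm0 HmA].
set (m := real (op_norm A)) in *.
assert (Hm : m < exp lambda).
(* For [m = 0] the value of [ln] is a default, and the inequality is just positivity of [exp]. *)
{ destruct (Rle_lt_or_eq_dec 0 m Hm0) as [Hpos|<-]; [|apply exp_pos].
  rewrite <- (exp_ln m) by trivial. now apply exp_increasing. }
set (M := m + 1). assert (HM : 1 <= M) by (unfold M; lra).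
assert (HMA : forall x, norm (A x) <= M * norm x).
{ intros x. eapply Rle_trans; [apply HmA|]. apply Rmult_le_compat_r;
    [apply norm_nonneg | unfold M; lra]. }
(* The number of smoothing factors: order [p] plus one unit for each logarithm. *)
destruct (INR_archimed 1 (p + INR nu) ltac:(lra)) as [n Hn].
destruct (iter_smooth_log_bound A HA kap Hkap HQ M HM HMA lambda m p n nu Hm0 HmA Hm Hp 0
    ltac:(lra) ltac:(lra))
  as [C1 [HC1 H1]].
destruct (iter_smooth_diff_bound A HA kap Hkap HQ n) as [C2 [HC2 H2]].
destruct (balanced_parameter p nu Hp Hnu) as [C3 [HC3 H3]].
exists ((C1 + C2) * C3). split; [apply Rmult_lt_0_compat; lra|].
intros u v w Hu Hv Hdelta Hw.
pose proof (Rmax_l (norm w) 1) as HW1. pose proof (Rmax_r (norm w) 1) as HW2.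
set (d := Rmax (norm w) 1) in *.
(* Injectivity gives [u = 0] when [A u = 0], matching the value [0] of [log_rate] there. *)
destruct (Req_dec (norm (A u)) 0) as [E|E].
- assert (Eu : u = zero).
  { apply HI. transitivity (zero : X).
    - now apply (norm_eq_zero (K := R_AbsRing) (V := X)).
    - symmetry. apply (linear_zero A HA). }
  unfold log_rate. destruct (Req_EM_T (norm (A u)) 0); [|contradiction].
  rewrite Rmult_0_r, Eu. right. apply (norm_zero (K := R_AbsRing) (V := X)).
- set (t := norm (A u)) in *.
  assert (Ht : 0 < t < 1) by (pose proof (norm_nonneg (A u)) as H; fold t in H; lra).
  destruct (H3 t Ht) as [alpha [Ha [R1 R2]]].
  pose proof (H1 alpha v 0 Ha Hv ltac:(lra)) as B1.
  rewrite Rplus_0_r, <- Hu, <- Hw in B1.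
  pose proof (H2 alpha u ltac:(lra)) as B2. fold t in B2.
  set (r := log_rate p nu t) in *.
  set (Su := Nat.iter n (smooth A alpha) u) in *.
  replace u with (plus Su (minus u Su)) at 1 by module_ring.
  eapply Rle_trans; [apply norm_plus_le|].
  eapply Rle_trans; [exact (Rplus_le_compat _ _ _ _ B1 B2)|].
  assert (Hr : 0 <= C3 * r).
  { eapply Rle_trans; [|exact R2]. apply Rmult_le_pos; [lra | left; apply Rinv_0_lt_compat;
      lra]. }
  pose proof (norm_nonneg w) as Hnw.
  assert (B3 : C1 * Rpower alpha p * / ln (/ alpha) ^ nu * norm w <= C1 * (C3 * r) * d).
  { apply Rmult_le_compat; trivial.
    - rewrite Rmult_assoc. apply Rmult_le_pos; [lra|]. apply Rmult_le_pos; [left;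
        apply Rpower_pos|].
      left. apply Rinv_0_lt_compat, pow_lt. rewrite <- ln_1. apply ln_increasing; [lra|].
      rewrite <- Rinv_1 at 1. apply Rinv_lt_contravar; lra.
    - rewrite Rmult_assoc. apply Rmult_le_compat_l; lra. }
  (* This term does not involve [w]; the lower bound [1 <= d] brings it under the common factor. *)
  assert (B4 : C2 * (t / alpha) <= C2 * (C3 * r) * d).
  { rewrite <- (Rmult_1_r (C2 * (t / alpha))). apply Rmult_le_compat; try lra.
    - apply Rmult_le_pos; [lra|]. apply Rmult_le_pos; [lra | left; apply Rinv_0_lt_compat; lra].
    - apply Rmult_le_compat_l; lra. }
  lra.
Qed.
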